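(* Let $V$ be a Hilbert module over the Clifford algebra $\mathbb{R}_d$ and let $T\in\mathcal{K}(V)$ be injective and bisectorial of angle $\omega\in(0,\frac{\pi}{2})$. Then for every $f\in\mathcal{SH}_L^{\mathrm{poly}}(D_\theta)$ or $f\in\mathcal{SH}_R^{\mathrm{poly}}(D_\theta)$, for some $\theta\in(\omega,\frac{\pi}{2})$, the $H^\infty$-functional calculi of $T^*$ and $T$ are connected via $$f(T^* )=f^\#(T)^*,\qquad f^\#(s):=\overline{f(\overline{s})}.$$ Here, if $f\in\mathcal{SH}_L^{\mathrm{poly}}(D_\theta)$, then $f(T^* )$ is the left $H^\infty$-functional calculus and $f^\#(T)$ the right $H^\infty$-functional calculus; if $f\in\mathcal{SH}_R^{\mathrm{poly}}(D_\theta)$, then $f(T^* )$ is the right $H^\infty$-functional calculus (a multivalued operator) and $f^\#(T)$ the left $H^\infty$-functional calculus. The identity is an identity of multivalued operators (operators being identified with their graphs), and the adjoint on the right-hand side is the adjoint of a multivalued operator, which coincides with the usual operator adjoint for densely defined operators.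
   Context: Clifford algebra: for $d\in\mathbb{N}$, $d\ge1$, $\mathbb{R}_d$ is the real Clifford algebra generated by $e_1,\dots,e_d$ with $e_i^2=-1$, $e_ie_j=-e_je_i$ for $i\neq j$, with real basis $e_A=e_{i_1}\cdots e_{i_r}$, $A=(i_1,\dots,i_r)$, $1\le i_1<\dots<i_r\le d$, $e_\emptyset=1$. For $s=\sum_As_Ae_A$: $\overline{s}=\sum_A(-1)^{|A|(|A|+1)/2}s_Ae_A$, $|s|^2=\sum_As_A^2$. Paravectors: $\mathbb{R}^{d+1}=\{s_0+s_1e_1+\dots+s_de_d\}$, $\operatorname{Im}(s)=s_1e_1+\dots+s_de_d$. $\mathbb{S}=\{J\in\mathbb{R}^{d+1}\mid J_0=0,|J|=1\}$, $\mathbb{C}_J=\{x+Jy\mid x,y\in\mathbb{R}\}$, $[s]=\{s_0+J|\operatorname{Im}(s)|\mid J\in\mathbb{S}\}$; $U\subseteq\mathbb{R}^{d+1}$ is axially symmetric if $[s]\subseteq U$ for all $s\in U$. Slice hyperholomorphic functions: for $U$ open, axially symmetric, let $\mathcal{U}=\{(x,y)\in\mathbb{R}^2\mid x+\mathbb{S}y\subseteq U\}$. $f:U\to\mathbb{R}_d$ is in $\mathcal{SH}_L(U)$ (resp. $\mathcal{SH}_R(U)$) if there are $C^1$ functions $f_0,f_1:\mathcal{U}\to\mathbb{R}_d$ with $f(x+Jy)=f_0(x,y)+Jf_1(x,y)$ (resp. $f(x+Jy)=f_0(x,y)+f_1(x,y)J$) for all $J\in\mathbb{S}$, $f_0(x,-y)=f_0(x,y)$,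 $f_1(x,-y)=-f_1(x,y)$, $\partial_xf_0=\partial_yf_1$, $\partial_yf_0=-\partial_xf_1$. If $f_0,f_1$ are real valued, $f$ is intrinsic, $f\in\mathcal{N}(U)$. Hilbert module: for a real Hilbert space $V_\mathbb{R}$, $V=\{\sum_Av_A\otimes e_A\mid v_A\in V_\mathbb{R}\}$ with $\|v\|^2=\sum_A\|v_A\|_\mathbb{R}^2$, $sv=\sum_{A,B}(s_Bv_A)\otimes(e_Be_A)$, $vs=\sum_{A,B}(v_As_B)\otimes(e_Ae_B)$, $\langle v,w\rangle=\sum_{A,B}\langle v_A,w_B\rangle_\mathbb{R}\overline{e_A}e_B$. $\mathcal{B}(V)$: bounded everywhere defined right-linear operators; $\mathcal{K}(V)$: closed right-linear operators $T:\operatorname{dom}(T)\subseteq V\to V$ (domain a right submodule). The adjoint of a densely defined right-linear $T$ has $\operatorname{dom}(T^* )=\{w\in V\mid\exists v_w\in V:\langle v_w,v\rangle=\langle w,Tv\rangle\ \forall v\in\operatorname{dom}(T)\}$, $T^*w=v_w$. Clifford numbers act on operators by left multiplication: $(sT)v=s(Tv)$, $(Ts)v=T(sv)$. Multivalued operators: right-linear subspaces $T\subseteq V\times V$; a right-linear operator is identified with its graph. The closure $\overline{T}$ is the closure in $V\times V$, and the adjoint is $T^*=\{(w,v)\in V\times V\mid\langle v,\widetilde v\rangle=\langle w,\widetilde w\rangle\text{ for all }(\widetilde v,\widetilde w)\in T\}$. $S$-spectrum: $Q_s[T]=T^2-2s_0T+|s|^2$ on $\operatorname{dom}(T^2)$,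 $\rho_S(T)=\{s\in\mathbb{R}^{d+1}\mid Q_s[T]^{-1}\in\mathcal{B}(V)\}$, $\sigma_S(T)=\mathbb{R}^{d+1}\setminus\rho_S(T)$; $S_L^{-1}(s,T)=Q_s[T]^{-1}\overline{s}-TQ_s[T]^{-1}$, $S_R^{-1}(s,T)=(\overline{s}-T)Q_s[T]^{-1}$ for $s\in\rho_S(T)$. Double sector: $D_\omega=\{s\in\mathbb{R}^{d+1}\setminus\{0\}\mid\operatorname{Arg}(s)\in I_\omega\}$, $I_\omega=(-\omega,\omega)\cup(\pi-\omega,\pi+\omega)$, $\operatorname{Arg}(s)=\arccos(s_0/|s|)\in[0,\pi]$. Bisectorial: $T\in\mathcal{K}(V)$ is bisectorial of angle $\omega\in(0,\frac{\pi}{2})$ if $\sigma_S(T)\subseteq\overline{D_\omega}$ and for every $\varphi\in(\omega,\frac{\pi}{2})$ there is $C_\varphi\ge0$ with $\|S_L^{-1}(s,T)\|\le C_\varphi/|s|$ for all $s\in\mathbb{R}^{d+1}\setminus(D_\varphi\cup\{0\})$. (If $T$ is injective and bisectorial on a Hilbert module, then $T$ is densely defined and $T^*$ is again injective and bisectorial of the same angle, so $f(T^* )$ is defined.) Function spaces: $\mathcal{SH}_L^0(D_\theta)$, $\mathcal{SH}_R^0(D_\theta)$, $\mathcal{N}^0(D_\theta)$ are the sets of bounded $f$ in $\mathcal{SH}_L(D_\theta)$, $\mathcal{SH}_R(D_\theta)$, $\mathcal{N}(D_\theta)$ with $\int_0^\infty|f(te^{J\phi})|\frac{dt}{t}<\infty$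 for all $J\in\mathbb{S}$, $\phi\in I_\theta$ ($e^{J\phi}=\cos\phi+J\sin\phi$). $\mathcal{SH}_L^{\mathrm{poly}}(D_\theta)$ (resp. $\mathcal{SH}_R^{\mathrm{poly}}(D_\theta)$) is the set of $f\in\mathcal{SH}_L(D_\theta)$ (resp. $\mathcal{SH}_R(D_\theta)$) for which there are $C,\alpha\ge0$ with $|f(s)|\le C(|s|^\alpha+|s|^{-\alpha})$ for all $s\in D_\theta$. $\omega$-functional calculus: for $T$ bisectorial of angle $\omega$, $\theta\in(\omega,\frac\pi2)$, $g\in\mathcal{SH}_L^0(D_\theta)$ (resp. $\mathcal{SH}_R^0(D_\theta)$), $$g(T):=\frac{1}{2\pi}\int_{\partial D_\varphi\cap\mathbb{C}_J}S_L^{-1}(s,T)\,ds_J\,g(s)\qquad\Big(\text{resp. }g(T):=\frac{1}{2\pi}\int_{\partial D_\varphi\cap\mathbb{C}_J}g(s)\,ds_J\,S_R^{-1}(s,T)\Big),$$ with arbitrary $J\in\mathbb{S}$, $\varphi\in(\omega,\theta)$ (the value is independent of them, and for intrinsic $g$ both versions coincide). Here $ds_J:=-J\,ds$ and the path is positively oriented: the rays $\{te^{J\varphi}\}$, $\{te^{J(\pi+\varphi)}\}$ are traversed from $\infty$ to $0$, the rays $\{te^{-J\varphi}\}$, $\{te^{J(\pi-\varphi)}\}$ from $0$ to $\infty$. $H^\infty$-functional calculus: let $T\in\mathcal{K}(V)$ be injective and bisectorial of angle $\omega$, $\theta\in(\omega,\frac{\pi}{2})$. For $f\in\mathcal{SH}_L^{\mathrm{poly}}(D_\theta)$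 the left $H^\infty$-functional calculus is $f(T):=e(T)^{-1}(ef)(T)$; for $f\in\mathcal{SH}_R^{\mathrm{poly}}(D_\theta)$ the right $H^\infty$-functional calculus is $f(T):=\overline{(fe)(T)e(T)^{-1}}$, the closure being taken in the sense of multivalued operators. Here $e(s)=\frac{s^m}{(1+s^2)^m}\in\mathcal{N}^0(D_\theta)$ with $m\in\mathbb{N}$, $m>\alpha$, where $\alpha$ is the exponent in the growth bound of $f$; $e(T)$, $(ef)(T)$, $(fe)(T)$ are defined by the $\omega$-functional calculus, and $e(T)=T^m(1+T^2)^{-m}$ is injective. The result does not depend on $m$. *)

(* Defs.v *)
From HB Require Import structures.
From mathcomp Require Import all_boot all_order all_algebra.
From mathcomp Require Import all_classical all_reals all_analysis measurable_realfun.
From mathcomp Require Import ring lra.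

Set Implicit Arguments.
Unset Strict Implicit.
Unset Printing Implicit Defensive.

Import Order.TTheory GRing.Theory Num.Theory.
Import numFieldNormedType.Exports.

Local Open Scope classical_set_scope.
Local Open Scope ring_scope.

HB.mixin Record NormedModule_hasInner (R : realType) V
    & CompleteNormedModule R V := {
  inner : V -> V -> R;
  innerC : forall v w, inner v w = inner w v;
  innerDl : forall u v w, inner (u + v) w = inner u w + inner v w;
  innerZl : forall (a : R) v w, inner (a *: v) w = a * inner v w;
  inner_norm : forall v, inner v v = `|v| ^+ 2
}.

#[short(type="hilbertType")]
HB.structure Definition RealHilbert (R : realType) :=
  { V of CompleteNormedModule R V & NormedModule_hasInner R V }.

(* Families indexed by the subsets A of {0, .., d-1}, the coordinate at A being
   the one at e_A; the generator written e_1 on paper is indexed by 0. *)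
Definition cliffmod (d : nat) (W : Type) := {ffun {set 'I_d} -> W}.

Section L2.
Variables (R : realType) (I : finType).
Implicit Types a b c : I -> R.

Lemma l2_CS a b :
  (\sum_i a i * b i) ^+ 2 <= (\sum_i a i ^+ 2) * (\sum_i b i ^+ 2).
Proof.
set A := \sum_i a i ^+ 2; set B := \sum_i b i ^+ 2; set P := \sum_i a i * b i.
have A0 : 0 <= A by apply: sumr_ge0 => i _; exact: sqr_ge0.
have B0 : 0 <= B by apply: sumr_ge0 => i _; exact: sqr_ge0.
have H (t : R) : 0 <= A * t ^+ 2 + 2 * P * t + B.
  have -> : A * t ^+ 2 + 2 * P * t + B = \sum_i (a i * t + b i) ^+ 2.
    rewrite /A /B /P mulr_sumr !mulr_suml -!big_split /=.
    by apply: eq_bigr => i _; ring.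
  by apply: sumr_ge0 => i _; exact: sqr_ge0.
have [A_eq0|A_neq0] := eqVneq A 0; last first.
  have A_gt0 : 0 < A by rewrite lt_def A_neq0.
  have := H (- P / A).
  have -> : A * (- P / A) ^+ 2 + 2 * P * (- P / A) + B = B - P ^+ 2 / A.
    by field.
  by rewrite subr_ge0 ler_pdivrMr// mulrC.
suff -> : P = 0 by rewrite expr0n /= mulr_ge0.
apply: big1 => i _; have /psumr_eq0P := A_eq0.
move=> /(_ (fun i _ => sqr_ge0 _)) /(_ i isT) /eqP.
by rewrite sqrf_eq0 => /eqP ->; rewrite mul0r.
Qed.

Lemma l2_triangle a b c : (forall i, 0 <= c i <= a i + b i) ->
  Num.sqrt (\sum_i c i ^+ 2) <=
  Num.sqrt (\sum_i a i ^+ 2) + Num.sqrt (\sum_i b i ^+ 2).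
Proof.
move=> hc.
have A0 : 0 <= \sum_i a i ^+ 2 by apply: sumr_ge0 => i _; exact: sqr_ge0.
have B0 : 0 <= \sum_i b i ^+ 2 by apply: sumr_ge0 => i _; exact: sqr_ge0.
rewrite -(@ler_pXn2r _ 2)// ?nnegrE ?addr_ge0 ?sqrtr_ge0//.
rewrite sqr_sqrtr; last by apply: sumr_ge0 => i _; exact: sqr_ge0.
apply: (@le_trans _ _ (\sum_i (a i + b i) ^+ 2)).
  apply: ler_sum => i _; have /andP[c0 cab] := hc i.
  by rewrite ler_pXn2r// nnegrE ?(le_trans c0).
rewrite sqrrD !sqr_sqrtr//.
under eq_bigr do rewrite sqrrD.
rewrite !big_split /= lerD2r lerD2l -mulr2n lerMn2r /=.
apply: le_trans (ler_norm _) _.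
rewrite -(@ler_pXn2r _ 2)// ?nnegrE ?mulr_ge0 ?sqrtr_ge0//.
by rewrite exprMn !sqr_sqrtr// -normrX ger0_norm ?sqr_ge0// l2_CS.
Qed.

End L2.

Section Module.
Variables (R : realType) (d : nat) (W : normedModType R).

HB.instance Definition _ := GRing.Lmodule.copy (cliffmod d W)
  {ffun {set 'I_d} -> W}.

Definition cliffmod_norm (v : cliffmod d W) : R := Num.sqrt (\sum_A `|v A| ^+ 2).

Lemma cliffmod_normD (v w : cliffmod d W) :
  cliffmod_norm (v + w) <= cliffmod_norm v + cliffmod_norm w.
Proof.
by apply: l2_triangle => A; rewrite normr_ge0 ffunE ler_normD.
Qed.

Lemma cliffmod_normZ (a : R) (v : cliffmod d W) :
  cliffmod_norm (a *: v) = `|a| * cliffmod_norm v.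
Proof.
rewrite /cliffmod_norm.
under eq_bigr do rewrite ffunE normrZ exprMn.
by rewrite -mulr_sumr sqrtrM ?sqr_ge0// sqrtr_sqr normr_id.
Qed.

Lemma cliffmod_norm_eq0 (v : cliffmod d W) : cliffmod_norm v = 0 -> v = 0.
Proof.
move/eqP; rewrite sqrtr_eq0 => h; apply/ffunP => A; rewrite ffunE.
have /eqP : \sum_A `|v A| ^+ 2 = 0.
  by apply/eqP; rewrite eq_le h sumr_ge0// => B _; exact: sqr_ge0.
rewrite psumr_eq0; last by move=> B _; exact: sqr_ge0.
by move=> /allP /(_ A); rewrite mem_index_enum sqrf_eq0 normr_eq0 => /(_ isT)/eqP.
Qed.

HB.instance Definition _ := Lmodule_isNormed.Build R (cliffmod d W)
  cliffmod_normD cliffmod_normZ cliffmod_norm_eq0.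

End Module.

Section Signs.
Variable d : nat.
Implicit Types A B C : {set 'I_d}.

Definition symd A B : {set 'I_d} := (A :\: B) :|: (B :\: A).

(* e_A e_B = (-1)^(inversions A B) e_(symd A B): an inversion j < i costs a swap of
   e_i and e_j, and a common index j = i costs e_i^2 = -1. *)
Definition inversions A B : nat := \sum_(i in A) \sum_(j in B) (j <= i).

Lemma in_symd A B i : (i \in symd A B) = (i \in A) (+) (i \in B).
Proof. by rewrite !inE; case: (i \in A); case: (i \in B). Qed.

Lemma symdC A B : symd A B = symd B A.
Proof. by apply/setP => i; rewrite !in_symd addbC. Qed.

Lemma symdA A B C : symd A (symd B C) = symd (symd A B) C.
Proof. by apply/setP => i; rewrite !in_symd addbA. Qed.

Lemma symd0 A : symd A finset.set0 = A.
Proof. by apply/setP => i; rewrite !in_symd inE addbF. Qed.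

Lemma sym0d A : symd finset.set0 A = A.
Proof. by rewrite symdC symd0. Qed.

Lemma odd_sum_symd (F : 'I_d -> nat) A B :
  odd (\sum_(i in symd A B) F i) =
  odd (\sum_(i in A) F i) (+) odd (\sum_(i in B) F i).
Proof.
rewrite ![in LHS]big_mkcond [in X in X (+) _]big_mkcond.
rewrite [in X in _ (+) X]big_mkcond /=.
rewrite -oddD -big_split /=.
apply: (big_ind2 (fun m n => odd m = odd n)) => // [m n p q h1 h2|i _].
  by rewrite !oddD h1 h2.
rewrite in_symd; case: (i \in A); case: (i \in B) => //=; rewrite ?addn0//.
by rewrite oddD addbb.
Qed.

Lemma odd_inversions_symdl A B C : odd (inversions (symd A B) C) = odd (inversions A C) (+) odd (inversions B C).
Proof. exact: odd_sum_symd. Qed.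

Lemma odd_inversions_symdr A B C : odd (inversions A (symd B C)) = odd (inversions A B) (+) odd (inversions A C).
Proof.
rewrite /inversions exchange_big /= odd_sum_symd.
by rewrite [in X in X (+) _]exchange_big [in X in _ (+) X]exchange_big.
Qed.

Lemma inversions0l A : inversions finset.set0 A = 0%N.
Proof. by rewrite /inversions big_set0. Qed.

Lemma inversions0r A : inversions A finset.set0 = 0%N.
Proof. by rewrite /inversions; under eq_bigr do rewrite big_set0; rewrite big1. Qed.

End Signs.

Definition clifford (R : realType) (d : nat) := cliffmod d R^o.

Section Clifford.
Variables (R : realType) (d : nat).
Local Notation Cl := (clifford R d).
Implicit Types (x y z s : Cl).

HB.instance Definition _ := NormedModule.copy (clifford R d) (cliffmod d R^o).

Definition cl_basis (A : {set 'I_d}) : Cl := [ffun B => (B == A)%:R].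

Definition cl_mul x y : Cl :=
  [ffun C => \sum_A \sum_(B | symd A B == C) (-1) ^+ inversions A B * (x A * y B)].

Lemma cl_mulA : associative cl_mul.
Proof.
move=> x y z; apply/ffunP => D; rewrite !ffunE.
transitivity (\sum_A \sum_B \sum_(C | symd A (symd B C) == D)
   (-1) ^+ (inversions A B + inversions A C + inversions B C) * (x A * y B * z C)).
  apply: eq_bigr => A _.
  under eq_bigr do rewrite ffunE mulr_sumr mulr_sumr.
  rewrite exchange_big /=; apply: eq_bigr => B _.
  under eq_bigr do rewrite mulr_sumr mulr_sumr.
  rewrite (exchange_big_dep (fun C => symd A (symd B C) == D)) /=; last first.
    by move=> E C /eqP <- /eqP ->.
  apply: eq_bigr => C hC.
  rewrite (big_pred1 (symd B C)); last first.
    by move=> E /=; have [->|ne] := eqVneq E (symd B C); rewrite ?hC ?andbF.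
  have -> : (-1) ^+ (inversions A B + inversions A C + inversions B C) =
            (-1) ^+ inversions A (symd B C) * (-1) ^+ inversions B C :> R.
    rewrite exprD; congr (_ * _).
    by rewrite -signr_odd oddD -odd_inversions_symdr signr_odd.
  by ring.
transitivity (\sum_A \sum_B \sum_C \sum_(E | (symd A B == E) && (symd E C == D))
   (-1) ^+ inversions E C * ((-1) ^+ inversions A B * (x A * y B) * z C)); last first.
  symmetry.
  transitivity (\sum_E \sum_C \sum_A \sum_(B | (symd A B == E) && (symd E C == D))
     (-1) ^+ inversions E C * ((-1) ^+ inversions A B * (x A * y B) * z C)).
    apply: eq_bigr => E _; rewrite big_mkcond /=; apply: eq_bigr => C _.
    rewrite ffunE; case: (symd E C == D); last first.
      by rewrite big1// => A _; rewrite big1// => B; rewrite andbF.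
    rewrite mulr_suml mulr_sumr; apply: eq_bigr => A _.
    rewrite mulr_suml mulr_sumr; apply: eq_bigl => B.
    by rewrite andbT.
  transitivity (\sum_C \sum_E \sum_A \sum_B if (symd A B == E) && (symd E C == D)
     then (-1) ^+ inversions E C * ((-1) ^+ inversions A B * (x A * y B) * z C) else 0).
    rewrite exchange_big /=; do 3!apply: eq_bigr => ? _.
    by rewrite big_mkcond.
  transitivity (\sum_A \sum_B \sum_C \sum_E if (symd A B == E) && (symd E C == D)
     then (-1) ^+ inversions E C * ((-1) ^+ inversions A B * (x A * y B) * z C) else 0).
    under eq_bigr => C _ do rewrite exchange_big /=.
    rewrite exchange_big /=; apply: eq_bigr => A _.
    under eq_bigr => C _ do rewrite exchange_big /=.
    by rewrite exchange_big.
  by do 3!apply: eq_bigr => ? _; rewrite [RHS]big_mkcond.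
apply: eq_bigr => A _; apply: eq_bigr => B _; rewrite big_mkcond /=.
apply: eq_bigr => C _; rewrite symdA; case: ifPn => hD; last first.
  by rewrite big1// => E /andP[/eqP <-]; rewrite (negbTE hD).
rewrite (big_pred1 (symd A B)); last first.
  by move=> E /=; rewrite eq_sym; case: eqP => // ->.
have -> : (-1) ^+ (inversions A B + inversions A C + inversions B C) =
          (-1) ^+ inversions (symd A B) C * (-1) ^+ inversions A B :> R.
  rewrite -addnA addnC exprD; congr (_ * _).
  by rewrite -signr_odd oddD -odd_inversions_symdl signr_odd.
by ring.
Qed.

Lemma cl_mul1l : left_id (cl_basis finset.set0) cl_mul.
Proof.
move=> x; apply/ffunP => C; rewrite ffunE (bigD1 finset.set0)//= [X in _ + X]big1.
  rewrite addr0 (big_pred1 C); last by move=> B /=; rewrite sym0d.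
  by rewrite inversions0l ffunE eqxx !mul1r.
by move=> A A0; rewrite big1// => B _; rewrite ffunE (negbTE A0) mul0r mulr0.
Qed.

Lemma cl_mul1r : right_id (cl_basis finset.set0) cl_mul.
Proof.
move=> x; apply/ffunP => C; rewrite ffunE (bigD1 C)//= [X in _ + X]big1.
  rewrite addr0 (bigD1 finset.set0) ?symd0//= big1 ?addr0.
    by rewrite inversions0r ffunE eqxx mul1r mulr1.
  by move=> B /andP[_ B0]; rewrite ffunE (negbTE B0) !mulr0.
move=> A AC; rewrite big1// => B; have [->|B0] := eqVneq B finset.set0.
  by rewrite symd0 (negbTE AC).
by rewrite ffunE (negbTE B0) !mulr0.
Qed.

Lemma cl_mulDl : left_distributive cl_mul +%R.
Proof.
move=> x y z; apply/ffunP => C; rewrite !ffunE -big_split /=.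
apply: eq_bigr => A _; rewrite -big_split /=; apply: eq_bigr => B _.
by rewrite ffunE mulrDl mulrDr.
Qed.

Lemma cl_mulDr : right_distributive cl_mul +%R.
Proof.
move=> x y z; apply/ffunP => C; rewrite !ffunE -big_split /=.
apply: eq_bigr => A _; rewrite -big_split /=; apply: eq_bigr => B _.
by rewrite ffunE !mulrDr.
Qed.

Lemma cl_1neq0 : cl_basis finset.set0 != 0.
Proof.
apply/eqP => /ffunP /(_ finset.set0) /eqP; rewrite !ffunE eqxx.
by rewrite oner_eq0.
Qed.

HB.instance Definition _ := GRing.Zmodule_isNzRing.Build (clifford R d)
  cl_mulA cl_mul1l cl_mul1r cl_mulDl cl_mulDr cl_1neq0.

Lemma cl_basisM A B : cl_basis A * cl_basis B = (-1) ^+ inversions A B *: cl_basis (symd A B).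
Proof.
apply/ffunP => C; rewrite [LHS]ffunE !ffunE (bigD1 A)//= [X in _ + X]big1.
  rewrite addr0; have [->|hC] := eqVneq C (symd A B).
    rewrite (bigD1 B)//= big1 ?addr0; first by rewrite !ffunE ?eqxx mulr1.
    by move=> D /andP[_ DB]; rewrite !ffunE (negbTE DB) !mulr0.
  rewrite big1 ?scaler0//.
  move=> D hD; rewrite !ffunE; have [DB|_] := eqVneq D B; last by rewrite !mulr0.
  by move: hD; rewrite DB eq_sym (negbTE hC).
by move=> D DA; rewrite big1// => E _; rewrite !ffunE (negbTE DA) mul0r mulr0.
Qed.

Definition cl_gen (i : 'I_d) : Cl := cl_basis [set i]%SET.

Lemma cl_gen_sqr i : cl_gen i * cl_gen i = - 1.
Proof.
rewrite /cl_gen cl_basisM /inversions !big_set1 leqnn expr1 scaleN1r.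
by congr (- cl_basis _); apply/setP => j; rewrite in_symd addbb inE.
Qed.

Lemma cl_gen_anticomm i j : i != j ->
  cl_gen i * cl_gen j = - (cl_gen j * cl_gen i).
Proof.
move=> ij; rewrite /cl_gen !cl_basisM /inversions !big_set1 symdC -scaleNr.
congr (_ *: _); move: ij; rewrite -val_eqE /= neq_ltn.
by case: ltngtP => //= _ _; rewrite expr0 expr1 ?opprK.
Qed.

Definition cl_conj s : Cl :=
  [ffun A : {set 'I_d} => (-1) ^+ (#|A| * #|A|.+1)./2 * s A].

Definition cl_re s : R := s finset.set0.

Definition paravector s : Prop := forall A : {set 'I_d}, (1 < #|A|)%N -> s A = 0.

Definition sphere : set Cl := [set J | [/\ paravector J, cl_re J = 0 & `|J| = 1]].

Definition slice_point (J : Cl) (p : R * R) : Cl := p.1 *: (1 : Cl) + p.2 *: J.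

Definition expJ (J : Cl) (phi : R) : Cl := slice_point J (cos phi, sin phi).

(* The inverse of a nonzero paravector. *)
Definition cl_pinv s : Cl := (`|s| ^+ 2)^-1 *: cl_conj s.

Definition slice_domain (U : set Cl) : set (R * R) :=
  [set p | forall J, sphere J -> U (slice_point J p)].

Definition dx (g : R * R -> Cl) : R * R -> Cl := 'D_(1, 0) g.
Definition dy (g : R * R -> Cl) : R * R -> Cl := 'D_(0, 1) g.

Definition C1_on (O : set (R * R)) (g : R * R -> Cl) : Prop :=
  forall p, O p ->
    [/\ derivable g p (1, 0), derivable g p (0, 1),
        {for p, continuous (dx g)} & {for p, continuous (dy g)}].

Definition slice_pair (O : set (R * R)) (f0 f1 : R * R -> Cl) : Prop :=
  [/\ C1_on O f0, C1_on O f1 &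
      forall x y : R, O (x, y) ->
        [/\ f0 (x, - y) = f0 (x, y), f1 (x, - y) = - f1 (x, y),
            dx f0 (x, y) = dy f1 (x, y) & dy f0 (x, y) = - dx f1 (x, y)]].

Definition SHL (U : set Cl) (f : Cl -> Cl) : Prop :=
  exists f0 f1 : R * R -> Cl, slice_pair (slice_domain U) f0 f1 /\
    forall p J, slice_domain U p -> sphere J ->
      f (slice_point J p) = f0 p + J * f1 p.

Definition SHR (U : set Cl) (f : Cl -> Cl) : Prop :=
  exists f0 f1 : R * R -> Cl, slice_pair (slice_domain U) f0 f1 /\
    forall p J, slice_domain U p -> sphere J ->
      f (slice_point J p) = f0 p + f1 p * J.

Definition cl_arg s : R := acos (cl_re s / `|s|).

Definition I_ (w : R) : set R :=
  [set` `]- w, w[] `|` [set` `](pi - w), (pi + w)[].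

Definition D_ (w : R) : set Cl := [set s | [/\ paravector s, s != 0 & I_ w (cl_arg s)]].

Definition growth (theta alpha : R) (f : Cl -> Cl) : Prop :=
  exists2 C : R, 0 <= C & forall s, D_ theta s ->
    `|f s| <= C * (`|s| `^ alpha + `|s| `^ (- alpha)).

Definition SHLpoly (theta : R) (f : Cl -> Cl) : Prop :=
  SHL (D_ theta) f /\ exists2 alpha : R, 0 <= alpha & growth theta alpha f.

Definition SHRpoly (theta : R) (f : Cl -> Cl) : Prop :=
  SHR (D_ theta) f /\ exists2 alpha : R, 0 <= alpha & growth theta alpha f.

Definition sharp (f : Cl -> Cl) : Cl -> Cl := fun s => cl_conj (f (cl_conj s)).

Definition regularizer (m : nat) : Cl -> Cl :=
  fun s => s ^+ m * cl_pinv (1 + s ^+ 2) ^+ m.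

End Clifford.

Arguments sphere {R d}.
Arguments D_ {R} d w.
Arguments regularizer {R d} m.

Section HilbertModule.
Variables (R : realType) (d : nat) (VR : hilbertType R).
Local Notation Cl := (clifford R d).
Local Notation V := (cliffmod d VR).
Implicit Types (s : Cl) (v w : V).

Definition lact s v : V :=
  [ffun C => \sum_B \sum_(A | symd B A == C) (-1) ^+ inversions B A *: (s B *: v A)].

Definition ract v s : V :=
  [ffun C => \sum_A \sum_(B | symd A B == C) (-1) ^+ inversions A B *: (s B *: v A)].

Definition cl_inner v w : Cl :=
  \sum_A \sum_B inner (v A) (w B) *: (cl_conj (cl_basis R A) * cl_basis R B).

(* (Multivalued) operators are represented by their graphs, the set of pairs
   (argument, value). *)
Definition oprel := set (V * V).
Implicit Types (T S : oprel) (A K L : V -> V).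

Definition opgraph A : oprel := [set p | p.2 = A p.1].

Definition right_linear T : Prop :=
  [/\ T (0, 0), forall p q, T p -> T q -> T (p + q) &
      forall p s, T p -> T (ract p.1 s, ract p.2 s)].

Definition single_valued T : Prop := forall v w w', T (v, w) -> T (v, w') -> w = w'.

Definition injective_rel T : Prop := forall v v' w, T (v, w) -> T (v', w) -> v = v'.

Definition closed_operator T : Prop :=
  [/\ right_linear T, single_valued T & closed T].

Definition rel_inv T : oprel := [set p | T (p.2, p.1)].

Definition rel_comp T S : oprel := [set p | exists2 u, S (p.1, u) & T (u, p.2)].

Definition rel_sub T S : oprel :=
  [set p | exists a b, [/\ T (p.1, a), S (p.1, b) & p.2 = a - b]].

Definition adjoint T : oprel :=
  [set p | forall q, T q -> cl_inner p.2 q.1 = cl_inner p.1 q.2].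

(* The value at v of a single-valued operator whose domain contains v. *)
Definition app T v : V := xget 0 [set w | T (v, w)].

Definition bounded_operator A : Prop :=
  right_linear (opgraph A) /\ exists C : R, forall v, `|A v| <= C * `|v|.

Definition opnorm A : \bar R :=
  ereal_sup [set `|A v|%:E | v in [set v | `|v| <= 1]].

Definition Q_ s T : oprel :=
  [set p | exists u w, [/\ T (p.1, u), T (u, w) &
     p.2 = w - (2 * cl_re s) *: u + (`|s| ^+ 2) *: p.1]].

Definition resolvent_set T : set Cl :=
  [set s | paravector s /\
    exists2 A, bounded_operator A & rel_inv (Q_ s T) = opgraph A].

Definition S_spectrum T : set Cl :=
  [set s | paravector s /\ ~ resolvent_set T s].

Definition SL_rel s T : oprel :=
  rel_sub (rel_comp (rel_inv (Q_ s T)) (opgraph (lact (cl_conj s))))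
          (rel_comp T (rel_inv (Q_ s T))).

Definition SR_rel s T : oprel :=
  rel_comp (rel_sub (opgraph (lact (cl_conj s))) T) (rel_inv (Q_ s T)).

Definition SL s T : V -> V := app (SL_rel s T).
Definition SR s T : V -> V := app (SR_rel s T).

Definition bisectorial (w : R) T : Prop :=
  [/\ closed_operator T, 0 < w < pi / 2, S_spectrum T `<=` closure (D_ d w) &
      forall phi, w < phi < pi / 2 -> exists2 C : R, 0 <= C &
        forall s, paravector s -> s != 0 -> ~ D_ d phi s ->
          (opnorm (SL s T) <= (C / `|s|)%:E)%E].

(* Bochner integral of functions with values in the space of bounded operators:
   approximation by simple functions in the L^1 distance given by the operator
   norm. *)
Record opsimple := OpSimple {
  opsimple_size : nat;
  opsimple_set : 'I_opsimple_size -> set R;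
  opsimple_val : 'I_opsimple_size -> V -> V }.

Arguments opsimple_set : clear implicits.
Arguments opsimple_val : clear implicits.

Definition opsimple_wf (D : set R) (h : opsimple) : Prop :=
  forall i, [/\ measurable (opsimple_set h i), opsimple_set h i `<=` D,
    (lebesgue_measure (opsimple_set h i) < +oo)%E &
    bounded_operator (opsimple_val h i)].

Definition opsimple_fun (h : opsimple) (t : R) : V -> V :=
  fun v => \sum_i \1_(opsimple_set h i) t *: opsimple_val h i v.

Definition opsimple_integral (h : opsimple) : V -> V :=
  fun v => \sum_i fine (lebesgue_measure (opsimple_set h i)) *:
                  opsimple_val h i v.

Definition is_bochner (D : set R) (K : R -> V -> V) L : Prop :=
  bounded_operator L /\
  exists h : nat -> opsimple,
    [/\ forall n, opsimple_wf D (h n),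
        forall n, measurable_fun D (fun t => opnorm (K t - opsimple_fun (h n) t)),
        (\int[lebesgue_measure]_(t in D)
            opnorm (K t - opsimple_fun (h n) t)%R)%E @[n --> \oo] --> 0%E &
        opnorm (L - opsimple_integral (h n)) @[n --> \oo] --> 0%E].

(* 0 if K is not Bochner integrable. *)
Definition bochner (D : set R) (K : R -> V -> V) : V -> V :=
  xget 0 [set L | is_bochner D K L].

(* Integrals over the ray t e^(J psi), traversed from 0 to oo, on which
   ds = e^(J psi) dt and hence ds_J = - J e^(J psi) dt. *)
Definition ray_left (J : Cl) (T : oprel) (g : Cl -> Cl) (psi : R) : V -> V :=
  bochner [set` `]0, +oo[] (fun t v => let s := t *: expJ J psi in
    SL s T (lact (- J * expJ J psi * g s) v)).

Definition ray_right (J : Cl) (T : oprel) (g : Cl -> Cl) (psi : R) : V -> V :=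
  bochner [set` `]0, +oo[] (fun t v => let s := t *: expJ J psi in
    lact (g s * (- J * expJ J psi)) (SR s T v)).

Definition contour (ray : R -> V -> V) (phi : R) : V -> V :=
  - ray phi + ray (- phi) - ray (pi + phi) + ray (pi - phi).

Definition omegaL (J : Cl) (phi : R) T (g : Cl -> Cl) : V -> V :=
  (2 * pi)^-1 *: contour (ray_left J T g) phi.

Definition omegaR (J : Cl) (phi : R) T (g : Cl -> Cl) : V -> V :=
  (2 * pi)^-1 *: contour (ray_right J T g) phi.

(* The calculi are indexed by the auxiliary data entering their definition: the
   path is determined by J and phi, the regularizer by m. *)
Definition HinfL (J : Cl) (phi : R) (m : nat) T (f : Cl -> Cl) : oprel :=
  rel_comp (rel_inv (opgraph (omegaL J phi T (regularizer m))))
           (opgraph (omegaL J phi T (fun s => regularizer m s * f s))).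

Definition HinfR (J : Cl) (phi : R) (m : nat) T (f : Cl -> Cl) : oprel :=
  closure (rel_comp (opgraph (omegaR J phi T (fun s => f s * regularizer m s)))
                    (rel_inv (opgraph (omegaR J phi T (regularizer m))))).

End HilbertModule.

Definition admissible (R : realType) (d : nat) (omega theta : R)
    (f : clifford R d -> clifford R d) (J : clifford R d) (phi : R) (m : nat) :=
  [/\ sphere J, omega < phi < theta &
      exists alpha : R, [/\ 0 <= alpha, growth theta alpha f & alpha < m%:R]].

(* Main.v *)
Require Import Defs.
From HB Require Import structures.
From mathcomp Require Import all_boot all_order all_algebra.
From mathcomp Require Import all_classical all_reals all_analysis measurable_realfun.
From mathcomp Require Import complex ring lra.
Set Implicit Arguments.
Unset Strict Implicit.
Unset Printing Implicit Defensive.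
Import Order.TTheory GRing.Theory Num.Theory.
Import numFieldNormedType.Exports.
Local Open Scope classical_set_scope.
Local Open Scope ring_scope.

(** Everything is reduced to complex function theory. For [z = x + i y] outside
    the double sector put [Q = T^2 - 2 x T + |z|^2], [A z = x Q^(-1) - T Q^(-1)]
    and [B z = - y Q^(-1)]: these are the real and imaginary parts of
    [(z - T)^(-1)] on the complexification of the module, they satisfy the
    resolvent identity, and for [s = x + J y] the S-resolvents are
    [v |-> A v + B (J v)] and [v |-> A v + J (B v)] (SL_family). A slice function
    has coordinates [g_C] that are holomorphic functions of [z], one for each
    basis element [e_C] (slice_pair_holomorphic). The two rays of the contour
    that are conjugate to each other contribute with opposite [J], and in their
    sum only an imaginary part survives: the omega-calculus is the operator with
    matrix elements [- 1/pi] times a difference of two integrals of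
    [Im (sum_C <u, (z - T)^(-1) e_C v> g_C(z) dz)] over rays of the upper half
    plane (omegaL_value).

    Duality at the level of the omega-calculus is then visible. The adjoints
    [A^*], [B^*] form the family of [T^*], and moving the operators across the
    inner product turns the integral defining the right calculus of [g] into
    that of the left calculus of [T^*], with each coordinate of [g] multiplied
    by the sign of the conjugation of [e_C] (omegaR_value); these are the
    coordinates of the sharp function. For the regularized calculi this gives
    the following. The left calculus of [f] is [{(w, v) | E v = G w}] with
    [E = e(T)], [G = (ef)(T)], and the right calculus is the closure of
    [{(E u, G u)}]. The adjoint of the second set is [{(w, v) | E^* v = G^* w}]
    (adjoint_closure), and by a double orthogonal complement the adjoint of the
    first is the closure of [{(E^* u, G^* u)}] (adjoint_kernel). So both sides
    of the identity have the same shape, but they may be built from different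
    [J], angles and powers [m].

    The independence of these data (regularizer_independence) rests on two
    facts. Rays may be rotated inside a sector by Cauchy's theorem
    (sector_cauchy). Passing from [m] to [m + 1] multiplies the integrand by
    [z / (1 + z^2)], and by partial fractions of the resolvent and Cauchy's
    theorem this composes the operators with [T (1 + T^2)^(-1)]
    (left_value_reg_mul), which is injective with [T]. The same must hold for
    [T^*], and [T^*] must be single valued; both follow from the density of the
    range of [T (1 + T^2)^(-1)] (reg_operator_dense). The Bochner integrals
    exist because their integrands are continuous in operator norm and dominated
    by an integrable weight (bochner_weak). *)

(** * Hilbert space geometry *)

(** The geometry serves a module and also its square, whose product norm is a
    maximum; hence completeness is stated through the form itself. *)
Record hilbert_form (R : realType) (U : lmodType R) (ip : U -> U -> R) : Prop :=
  HilbertForm {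
    ipC : forall u v, ip u v = ip v u;
    ipDl : forall u v w, ip (u + v) w = ip u w + ip v w;
    ipZl : forall a u v, ip (a *: u) v = a * ip u v;
    ip_ge0 : forall u, 0 <= ip u u;
    ip_eq0 : forall u, ip u u = 0 -> u = 0;
    ip_complete : forall u : nat -> U,
      (forall e, 0 < e -> exists N, forall m n, (N <= m)%N -> (N <= n)%N ->
         ip (u m - u n) (u m - u n) < e) ->
      exists l, forall e, 0 < e -> exists N, forall n, (N <= n)%N ->
         ip (u n - l) (u n - l) < e }.

Definition linear_set (R : realType) (U : lmodType R) (S : set U) : Prop :=
  S 0 /\ forall a u v, S u -> S v -> S (a *: u + v).

Section HilbertGeometry.
Variables (R : realType) (U : lmodType R) (ip : U -> U -> R).
Hypothesis H : hilbert_form ip.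
Implicit Types (u v w x y : U) (S : set U).

Lemma ipDr u v w : ip u (v + w) = ip u v + ip u w.
Proof. by rewrite (ipC H) (ipDl H) !(ipC H _ u). Qed.

Lemma ipZr a u v : ip u (a *: v) = a * ip u v.
Proof. by rewrite (ipC H) (ipZl H) (ipC H v). Qed.

Lemma ip0l v : ip 0 v = 0.
Proof. by rewrite -(scale0r 0) (ipZl H) mul0r. Qed.

Lemma ip0r v : ip v 0 = 0.
Proof. by rewrite (ipC H) ip0l. Qed.

Lemma ipNl u v : ip (- u) v = - ip u v.
Proof. by rewrite -scaleN1r (ipZl H) mulN1r. Qed.

Lemma ipNr u v : ip u (- v) = - ip u v.
Proof. by rewrite (ipC H) ipNl (ipC H v). Qed.

Lemma ipBl u v w : ip (u - v) w = ip u w - ip v w.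
Proof. by rewrite (ipDl H) ipNl. Qed.

Lemma ipBr u v w : ip u (v - w) = ip u v - ip u w.
Proof. by rewrite ipDr ipNr. Qed.

Definition ipE := (ipDl H, ipDr, ipZl H, ipZr, ipNl, ipNr).

Lemma ip_ext u v : (forall w, ip w u = ip w v) -> u = v.
Proof.
move=> h; apply/eqP; rewrite -subr_eq0; apply/eqP/(ip_eq0 H).
by rewrite ipBr !h subrr.
Qed.

Lemma ip_sqrB u v a :
  ip (u - a *: v) (u - a *: v) = ip u u - 2 * a * ip u v + a ^+ 2 * ip v v.
Proof. by rewrite !ipE (ipC H v u); ring. Qed.

Lemma ip_CS u v : ip u v ^+ 2 <= ip u u * ip v v.
Proof.
have [v0|v0] := eqVneq (ip v v) 0.
  by rewrite (ip_eq0 H v0) !ip0r expr0n mulr0.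
have vp : 0 < ip v v by rewrite lt_neqAle eq_sym v0 (ip_ge0 H).
have := ip_ge0 H (u - (ip u v / ip v v) *: v); rewrite ip_sqrB.
have -> : ip u u - 2 * (ip u v / ip v v) * ip u v + (ip u v / ip v v) ^+ 2 *
    ip v v = ip u u - ip u v ^+ 2 / ip v v by field.
by rewrite subr_ge0 ler_pdivrMr.
Qed.

(** The orthogonal projection of [x] on the closure of [S]: a minimizing
    sequence for the distance is Cauchy by the parallelogram identity. *)
Lemma projection_exists S x : linear_set S ->
  exists y, (forall e, 0 < e -> exists2 s, S s & ip (s - y) (s - y) < e) /\
            (forall s, S s -> ip (x - y) s = 0).
Proof.
move=> [S0 SL].
pose D := [set ip (x - s) (x - s) | s in S].
have D0 : D !=set0 by exists (ip (x - 0) (x - 0)); exists 0.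
have Dlb : lbound D 0 by move=> _ [s _ <-]; exact: ip_ge0.
have hD : has_inf D by split => //; exists 0.
have dle s : S s -> inf D <= ip (x - s) (x - s).
  by move=> Ss; apply: ge_inf; [exists 0|exists s].
have [ep [ep0 small]] : exists ep : nat -> R, (forall n, 0 < ep n) /\
    forall e, 0 < e -> exists N, forall n, (N <= n)%N -> ep n < e.
  exists (fun n => n.+1%:R^-1); split=> [n|e e0]; first by [].
  have [N _ hN] := near_infty_natSinv_lt (PosNum e0).
  by exists N => n Nn; exact: hN.
have /choice[s_ hs] (n : nat) :
    exists s, S s /\ ip (x - s) (x - s) < inf D + ep n.
  by have [_ [s Ss <-] lt] := inf_adherent (ep0 n) hD; exists s.
have Ss n : S (s_ n) by case: (hs n).
have slt n : ip (x - s_ n) (x - s_ n) < inf D + ep n by case: (hs n).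
have cauchy m n : ip (s_ m - s_ n) (s_ m - s_ n) <=
    2 * ep m + 2 * ep n.
  have hmid : S (2^-1 *: s_ m + 2^-1 *: s_ n).
    apply: (SL _ _ _ (Ss m)).
    by have := SL 2^-1 _ _ (Ss n) S0; rewrite addr0.
  have := dle _ hmid; have := slt m; have := slt n.
  rewrite !ipE (ipC H (s_ n) (s_ m)) (ipC H (s_ m) x) (ipC H (s_ n) x) .
  move: (ep m) (ep n) => a b.
  move: (ip x x) (ip x (s_ m)) (ip x (s_ n)) (ip (s_ m) (s_ m)) (ip (s_ m) (s_ n)) (ip (s_ n) (s_ n)) (inf D) => *; lra.
have [y hy] : exists y, forall e, 0 < e -> exists N, forall n, (N <= n)%N ->
    ip (s_ n - y) (s_ n - y) < e.
  apply: (ip_complete H) => e e0.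
  have [N hN] := small (e / 4) ltac:(lra).
  exists N => m n Nm Nn; apply: le_lt_trans (cauchy m n) _.
  have := hN _ Nm; have := hN _ Nn; lra.
exists y; split.
  by move=> e /hy[N hN]; exists (s_ N) => //; exact: hN.
move=> s Hs.
have almost n : ip (x - s_ n) s ^+ 2 <= ip s s * ep n.
  have [ss0|ss0] := eqVneq (ip s s) 0.
    by rewrite (ip_eq0 H ss0) !ip0r expr0n mul0r.
  have sp : 0 < ip s s by rewrite lt_neqAle eq_sym ss0 (ip_ge0 H).
  set t := ip (x - s_ n) s / ip s s.
  have := dle _ (SL t s (s_ n) Hs (Ss n)).
  have -> : x - (t *: s + s_ n) = (x - s_ n) - t *: s by rewrite opprD addrCA addrC.
  have := slt n; set p := x - s_ n.
  have -> : ip (p - t *: s) (p - t *: s) = ip p p - ip p s ^+ 2 / ip s s.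
    by rewrite ip_sqrB /t -/p; field.
  move=> h1 h2; rewrite mulrC -ler_pdivrMr//.
  move: h1 h2; move: (_ / _) (ip p p) => *; lra.
have bnd e : 0 < e -> ip (x - y) s ^+ 2 <= ip s s * e.
  move=> e0; have [N1 h1] := small (e / 4) ltac:(lra).
  have [N2 h2] := hy (e / 4) ltac:(lra).
  pose n := maxn N1 N2.
  have -> : x - y = (x - s_ n) + (s_ n - y) by rewrite addrA subrK.
  rewrite (ipDl H).
  have := almost n; have := ip_CS (s_ n - y) s.
  have := h1 n (leq_maxl _ _); have := h2 n (leq_maxr _ _).
  have := ip_ge0 H s.
  set a := ip (x - s_ n) s; set b := ip (s_ n - y) s.
  set c := ip (s_ n - y) _; set k := ip s s; set t := ep n.
  move=> k0 hc ht hb ha.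
  have := sqr_ge0 (a - b); rewrite sqrrB.
  have : k * t <= k * (e / 4) by apply: ler_wpM2l => //; exact: ltW.
  have : c * k <= k * (e / 4) by rewrite mulrC; apply: ler_wpM2l => //; exact: ltW.
  rewrite sqrrD; move: ha hb hc ht; rewrite mulrC; nra.
apply/eqP; rewrite -sqrf_eq0 eq_le sqr_ge0 andbT; apply/ler_addgt0Pr => e e0.
have k1 : 0 < ip s s + 1 by have := ip_ge0 H s; lra.
apply: (le_trans (bnd (e / (ip s s + 1)) ltac:(exact: divr_gt0))).
rewrite add0r mulrA ler_pdivrMr// mulrC; apply: ler_wpM2l; first exact: ltW.
lra.
Qed.

Lemma ip_cvg_eq0 S y z : (forall e, 0 < e -> exists2 s, S s & ip (s - y) (s - y) < e) ->
  (forall s, S s -> ip z s = 0) -> ip z y = 0.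
Proof.
move=> hy hz; apply/eqP; rewrite -sqrf_eq0 eq_le sqr_ge0 andbT.
apply/ler_addgt0Pr => e e0; rewrite add0r.
have k1 : 0 < ip z z + 1 by have := ip_ge0 H z; lra.
have [s Ss hs] := hy (e / (ip z z + 1)) ltac:(exact: divr_gt0).
have -> : ip z y = - ip z (s - y) by rewrite ipBr (hz s Ss) sub0r opprK.
rewrite sqrrN; apply: le_trans (ip_CS _ _) _.
apply: (@le_trans _ _ (ip z z * (e / (ip z z + 1)))).
  by apply: ler_wpM2l; [exact: ip_ge0|exact: ltW].
by rewrite mulrA ler_pdivrMr// mulrC; apply: ler_wpM2l; [exact: ltW|lra].
Qed.

Lemma dense_of_orthogonal S x : linear_set S ->
  (forall y, (forall s, S s -> ip y s = 0) -> ip y x = 0) ->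
  forall e, 0 < e -> exists2 s, S s & ip (s - x) (s - x) < e.
Proof.
move=> LS hx e e0; have [y [hy hxy]] := projection_exists x LS.
have h1 : ip (x - y) x = 0 by exact: hx.
have h2 : ip (x - y) y = 0 by exact: ip_cvg_eq0 hxy.
have /eqP : x - y = 0 by apply: (ip_eq0 H); rewrite ipBr h1 h2 subrr.
by rewrite subr_eq0 => /eqP ->; exact: hy.
Qed.

Lemma riesz (l : U -> R) (C : R) :
  (forall a u v, l (a *: u + v) = a * l u + l v) ->
  (forall u, l u ^+ 2 <= C * ip u u) -> exists w, forall u, l u = ip w u.
Proof.
move=> lL lb.
have l0 : l 0 = 0 by have := lL (-1) 0 0; rewrite scaler0 addr0; lra.
have lB u v : l (u - v) = l u - l v.
  by rewrite addrC -scaleN1r lL mulN1r addrC.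
have lZ a u : l (a *: u) = a * l u by rewrite -[a *: u]addr0 lL l0 addr0.
pose S := [set u | l u = 0].
have LS : linear_set S by split=> // a u v; rewrite /S /= lL => -> ->; rewrite mulr0 addr0.
have [[x lx]|all0] := pselect (exists x, l x != 0); last first.
  exists 0 => u; rewrite ip0l; apply/eqP/negPn/negP => lu.
  by apply: all0; exists u.
have [y [hy hxy]] := projection_exists x LS.
have ly : l y = 0.
  apply/eqP; rewrite -sqrf_eq0 eq_le sqr_ge0 andbT; apply/ler_addgt0Pr => e e0.
  have k1 : 0 < `|C| + 1 by have := normr_ge0 C; lra.
  have [s Ss hs] := hy (e / (`|C| + 1)) ltac:(exact: divr_gt0).
  have := lb (s - y); rewrite lB Ss sub0r sqrrN add0r => h; apply: le_trans h _.
  apply: (@le_trans _ _ ((`|C| + 1) * ip (s - y) (s - y))).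
    by apply: ler_wpM2r; [exact: ip_ge0|have := ler_norm C; lra].
  by rewrite mulrC -ler_pdivlMr//; exact: ltW.
set z := x - y; have lz : l z != 0 by rewrite lB ly subr0.
have zz : ip z z != 0.
  by apply: contra lz => /eqP/(ip_eq0 H) ->; rewrite l0.
exists ((l z / ip z z) *: z) => u; rewrite (ipZl H).
have : ip z (u - (l u / l z) *: z) = 0.
  by apply: hxy; rewrite /S /= lB lZ divfK// subrr.
rewrite ipBr ipZr => /eqP; rewrite subr_eq0 => /eqP ->.
by field; rewrite zz lz.
Qed.

End HilbertGeometry.

(** * The Clifford algebra and its modules *)

Lemma mulr_norm (R : realType) (x : R^o) : (x : R) * x = `|x| ^+ 2.
Proof. by rewrite real_normK ?num_real. Qed.

HB.instance Definition _ (R : realType) :=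
  NormedModule_hasInner.Build R (R^o)
    (fun x y : R => mulrC x y) (fun x y z : R => mulrDl x y z)
    (fun a x y : R => esym (mulrA a x y))
    (@mulr_norm R).

Section Module.
Variables (R : realType) (d : nat) (W : hilbertType R).
Local Notation Cl := (clifford R d).
Local Notation V := (cliffmod d W).
Implicit Types (s t : Cl) (u v w : V) (x : W) (A B C : {set 'I_d}).

Lemma inner0l x : inner (0 : W) x = 0.
Proof. by rewrite -(scale0r 0) innerZl mul0r. Qed.

Lemma innerDr x y z : inner (x : W) (y + z) = inner x y + inner x z.
Proof. by rewrite innerC innerDl !(innerC _ x). Qed.

Lemma innerZr x a y : inner (x : W) (a *: y) = a * inner x y.
Proof. by rewrite innerC innerZl innerC. Qed.

Lemma inner_sumr I (r : seq I) (P : pred I) x (F : I -> W) :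
  inner x (\sum_(i <- r | P i) F i) = \sum_(i <- r | P i) inner x (F i).
Proof.
elim/big_rec2 : _ => [|i y z _ <-]; first by rewrite innerC inner0l.
by rewrite innerDr.
Qed.

Definition re_inner v w : R := \sum_A inner (v A) (w A).

Lemma re_inner_norm v : re_inner v v = `|v| ^+ 2.
Proof.
rewrite /re_inner; under eq_bigr do rewrite inner_norm.
by rewrite sqr_sqrtr// sumr_ge0// => A _; rewrite sqr_ge0.
Qed.

Lemma coord_norm v A : `|v A| <= `|v|.
Proof.
rewrite -(@ler_pXn2r _ 2)// ?nnegrE ?normr_ge0// -re_inner_norm.
rewrite /re_inner (bigD1 A)//= inner_norm lerDl sumr_ge0// => B _.
by rewrite inner_norm sqr_ge0.
Qed.

Lemma norm_le_coords v e : (forall A, `|v A| <= e) ->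
  `|v| <= #|{set 'I_d}|%:R * e.
Proof.
move=> h; have e0 : 0 <= e := le_trans (normr_ge0 _) (h finset.set0).
rewrite -(@ler_pXn2r _ 2)// ?nnegrE ?mulr_ge0//.
rewrite -re_inner_norm /re_inner.
apply: (@le_trans _ _ (\sum_(A : {set 'I_d}) e ^+ 2)).
  by apply: ler_sum => A _; rewrite inner_norm ler_pXn2r ?nnegrE.
rewrite sumr_const -[_ *+ _]mulr_natl exprMn ler_wpM2r ?sqr_ge0//.
rewrite -natrX ler_nat -[leqLHS]muln1 expnS expn1 leq_mul//.
by apply/card_gt0P; exists finset.set0.
Qed.

Lemma module_complete (u : nat -> V) :
  (forall e, 0 < e -> exists N, forall m n, (N <= m)%N -> (N <= n)%N ->
     re_inner (u m - u n) (u m - u n) < e) ->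
  exists l, forall e, 0 < e -> exists N, forall n, (N <= n)%N ->
     re_inner (u n - l) (u n - l) < e.
Proof.
move=> hu.
have hu' e : 0 < e -> exists N, forall m n, (N <= m)%N -> (N <= n)%N ->
    `|u m - u n| < e.
  move=> e0; have [N hN] := hu (e ^+ 2) (exprn_gt0 _ e0).
  exists N => m n Nm Nn; have := hN m n Nm Nn.
  by rewrite re_inner_norm ltr_pXn2r// nnegrE ?normr_ge0// ltW.
have coordB v w A : (v - w) A = v A - w A by rewrite !ffunE.
have /choice[l hl] A : exists l : W, u n A @[n --> \oo] --> l.
  suff : cvg (u n A @[n --> \oo]) by move=> cv; exists (lim (u n A @[n --> \oo])).
  apply: cauchy_cvg; apply: (@cauchy_exP R) => e e0.
  have [N hN] := hu' e e0; exists (u N A); exists N => // n /= Nn.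
  rewrite -ball_normE /=; apply: le_lt_trans (hN N n (leqnn _) Nn).
  by rewrite -coordB coord_norm.
exists (finfun l) => e e0.
set k : R := #|{set 'I_d}|%:R.
have k0 : 0 < k + 1 by rewrite ltr_wpDl.
pose e' := Num.sqrt e / (k + 1).
have e'0 : 0 < e' by rewrite divr_gt0// sqrtr_gt0.
have /choice[N hN] A : exists N, forall n, (N <= n)%N -> `|l A - u n A| < e'.
  have /cvgrPdist_lt/(_ e' e'0)[N _ hN] := hl A.
  by exists N => n Nn; exact: hN.
exists (\max_A N A) => n hn.
rewrite re_inner_norm -[e]sqr_sqrtr ?(ltW e0)// ltr_pXn2r ?nnegrE ?sqrtr_ge0//.
apply: (@le_lt_trans _ _ (k * e')).
  apply: norm_le_coords => A; rewrite coordB ffunE distrC; apply/ltW/hN.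
  exact: leq_trans (leq_bigmax A) hn.
have <- : (k + 1) * e' = Num.sqrt e by rewrite /e' mulrC divfK ?gt_eqF.
by rewrite ltr_pM2r// ltrDl.
Qed.

Lemma module_hilbert : hilbert_form re_inner.
Proof.
split; last exact: module_complete.
- by move=> u v; apply: eq_bigr => A _; rewrite innerC.
- move=> u v w; rewrite /re_inner -big_split /=; apply: eq_bigr => A _.
  by rewrite ffunE innerDl.
- move=> a u v; rewrite /re_inner mulr_sumr; apply: eq_bigr => A _.
  by rewrite ffunE innerZl.
- by move=> u; rewrite re_inner_norm sqr_ge0.
- move=> u; rewrite re_inner_norm => /eqP; rewrite sqrf_eq0 normr_eq0.
  by move/eqP.
Qed.

Lemma re_inner_CS u v : `|re_inner u v| <= `|u| * `|v|.
Proof.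
rewrite -(@ler_pXn2r _ 2)// ?nnegrE ?normr_ge0 ?mulr_ge0//.
by rewrite -normrX ger0_norm ?sqr_ge0// exprMn -!re_inner_norm ip_CS//; exact: module_hilbert.
Qed.

(** Pairing the coordinates with a fixed vector maps the module to the Clifford
    algebra, compatibly with both actions; these maps are jointly injective, so
    the module axioms follow from the ring axioms. *)
Definition slot x v : Cl := [ffun A => inner x (v A)].

Lemma slot_inj v w : (forall x, slot x v = slot x w) -> v = w.
Proof.
move=> h; apply/ffunP => A; apply/eqP; rewrite -subr_eq0 -normr_eq0 -sqrf_eq0.
rewrite -inner_norm -[- w A]scaleN1r innerDr innerZr mulN1r.
have /ffunP/(_ A) := h (v A + -1 *: w A); rewrite !ffunE => ->.
by rewrite subrr.
Qed.

Lemma slot_lact x s v : slot x (lact s v) = s * slot x v.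
Proof.
apply/ffunP => C; rewrite !ffunE inner_sumr; apply: eq_bigr => A _.
by rewrite inner_sumr; apply: eq_bigr => B _; rewrite !innerZr ffunE.
Qed.

Lemma slot_ract x v s : slot x (ract v s) = slot x v * s.
Proof.
apply/ffunP => C; rewrite !ffunE inner_sumr; apply: eq_bigr => A _.
rewrite inner_sumr; apply: eq_bigr => B _; rewrite !innerZr ffunE.
by rewrite (mulrC (s B)).
Qed.

Lemma slotD x v w : slot x (v + w) = slot x v + slot x w.
Proof. by apply/ffunP => A; rewrite !ffunE innerDr. Qed.

Lemma slotZ x a v : slot x (a *: v) = a *: slot x v.
Proof. by apply/ffunP => A; rewrite !ffunE innerZr. Qed.

Lemma cl_scalerAl a s t : a *: (s * t) = (a *: s) * t.
Proof.
apply/ffunP => C; rewrite !ffunE scaler_sumr; apply: eq_bigr => A _.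
rewrite scaler_sumr; apply: eq_bigr => B _; rewrite ffunE /GRing.scale /=.
by ring.
Qed.

Lemma cl_scalerAr a s t : a *: (s * t) = s * (a *: t).
Proof.
apply/ffunP => C; rewrite !ffunE scaler_sumr; apply: eq_bigr => A _.
rewrite scaler_sumr; apply: eq_bigr => B _; rewrite ffunE /GRing.scale /=.
by ring.
Qed.

Lemma lactA s t v : lact s (lact t v) = lact (s * t) v.
Proof. by apply: slot_inj => x; rewrite !slot_lact mulrA. Qed.

Lemma lact1 v : lact (1 : Cl) v = v.
Proof. by apply: slot_inj => x; rewrite slot_lact mul1r. Qed.

Lemma lactDl s t v : lact (s + t) v = lact s v + lact t v.
Proof. by apply: slot_inj => x; rewrite slotD !slot_lact mulrDl. Qed.

Lemma lactDr s v w : lact s (v + w) = lact s v + lact s w.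
Proof. by apply: slot_inj => x; rewrite !(slotD, slot_lact) mulrDr. Qed.

Lemma lactZl a s v : lact (a *: s) v = a *: lact s v.
Proof. by apply: slot_inj => x; rewrite !(slotZ, slot_lact) cl_scalerAl. Qed.

Lemma lactZr a s v : lact s (a *: v) = a *: lact s v.
Proof. by apply: slot_inj => x; rewrite !(slotZ, slot_lact) cl_scalerAr. Qed.

Lemma lactNl s v : lact (- s) v = - lact s v.
Proof. by rewrite -scaleN1r lactZl scaleN1r. Qed.

Lemma lactBl s t v : lact (s - t) v = lact s v - lact t v.
Proof. by rewrite lactDl lactNl. Qed.

Lemma ractDl v w s : ract (v + w) s = ract v s + ract w s.
Proof. by apply: slot_inj => x; rewrite !(slotD, slot_ract) mulrDl. Qed.

Lemma ractZl a v s : ract (a *: v) s = a *: ract v s.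
Proof. by apply: slot_inj => x; rewrite !(slotZ, slot_ract) cl_scalerAl. Qed.

Lemma ract_real v a : ract v (a *: (1 : Cl)) = a *: v.
Proof. by apply: slot_inj => x; rewrite !(slotZ, slot_ract) -cl_scalerAr mulr1. Qed.

Lemma lact_real v a : lact (a *: (1 : Cl)) v = a *: v.
Proof. by rewrite lactZl lact1. Qed.

Lemma ract_lact s t v : ract (lact s v) t = lact s (ract v t).
Proof. by apply: slot_inj => x; rewrite !(slot_lact, slot_ract) mulrA. Qed.

End Module.

Section Conjugation.
Variables (R : realType) (d : nat).
Local Notation Cl := (clifford R d).
Implicit Types (s t : Cl) (A B C : {set 'I_d}).

(** Counting pairs (i, j) of elements of [A] in both orders counts the diagonal
    twice, so twice the inversions of [A] with itself is |A|^2 + |A|; this is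
    the exponent in the conjugation. *)
Lemma inversions_diag A : inversions A A = (#|A| * #|A|.+1)./2.
Proof.
have h : (inversions A A + inversions A A = #|A| * #|A|.+1)%N.
  rewrite {2}/inversions exchange_big /= -big_split /=.
  under eq_bigr do rewrite -big_split /=.
  transitivity (\sum_(i in A) #|A|.+1)%N; last by rewrite sum_nat_const.
  apply: eq_bigr => i iA; rewrite (bigD1 i)//= leqnn.
  have -> : #|A|.+1 = (1 + 1 + \sum_(j in A | j != i) 1)%N.
    rewrite -addnA add1n; congr _.+1.
    by rewrite -sum1_card (bigD1 i).
  congr (_ + _)%N; apply: eq_bigr => j /andP[_ ji].
  by move: ji; rewrite -val_eqE /= neq_ltn; case: ltngtP.
by rewrite -h addnn doubleK.
Qed.

Lemma sign_diag A : (-1) ^+ inversions A A * (-1) ^+ inversions A A = 1 :> R.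
Proof. by rewrite -expr2 sqrr_sign. Qed.

Lemma cl_conjE s A : cl_conj s A = (-1) ^+ inversions A A * s A.
Proof. by rewrite ffunE inversions_diag. Qed.

Lemma cl_conjK : involutive (@cl_conj R d).
Proof. by move=> s; apply/ffunP => A; rewrite !cl_conjE mulrA sign_diag mul1r. Qed.

Lemma cl_conjD s t : cl_conj (s + t) = cl_conj s + cl_conj t.
Proof. by apply/ffunP => A; rewrite !(cl_conjE, ffunE) mulrDr. Qed.

Lemma cl_conjZ a s : cl_conj (a *: s) = a *: cl_conj s.
Proof.
by apply/ffunP => A; rewrite !(cl_conjE, ffunE) /GRing.scale /= mulrCA.
Qed.

Lemma cl_conj_norm s : `|cl_conj s| = `|s|.
Proof.
rewrite /Num.norm /= /cliffmod_norm; congr Num.sqrt; apply: eq_bigr => A _.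
by rewrite cl_conjE normrM normrX normrN1 expr1n mul1r.
Qed.

Lemma symd_eq A B C : (symd A B == C) = (symd A C == B).
Proof.
have symdK D E : symd D (symd D E) = E.
  by apply/setP => i; rewrite !in_symd addbA addbb.
by apply/eqP/eqP => <-; rewrite symdK.
Qed.

Section Action.
Variable W : hilbertType R.
Implicit Types (u v w : cliffmod d W).

Lemma lact_adjoint s v w : re_inner (lact s v) w = re_inner v (lact (cl_conj s) w).
Proof.
rewrite /re_inner.
transitivity (\sum_C \sum_B \sum_(A | symd B A == C)
    (-1) ^+ inversions B A * (s B * inner (v A) (w C))).
  apply: eq_bigr => C _; rewrite ffunE innerC inner_sumr; apply: eq_bigr => B _.
  by rewrite inner_sumr; apply: eq_bigr => A _; rewrite !innerZr innerC.
transitivity (\sum_A \sum_B \sum_(C | symd B C == A)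
    (-1) ^+ inversions B C * (cl_conj s B * inner (v A) (w C))); last first.
  apply: eq_bigr => C _; rewrite ffunE inner_sumr; apply: eq_bigr => B _.
  by rewrite inner_sumr; apply: eq_bigr => A _; rewrite !innerZr.
rewrite exchange_big /= [RHS]exchange_big /=; apply: eq_bigr => B _.
under eq_bigr do rewrite big_mkcond.
rewrite exchange_big /=; apply: eq_bigr => A _; rewrite [RHS]big_mkcond /=.
apply: eq_bigr => C _; rewrite symd_eq; case: ifP => // /eqP BCA.
rewrite cl_conjE !mulrA -exprD; congr (_ * _ * _).
by rewrite -BCA -signr_odd odd_inversions_symdr -[RHS]signr_odd oddD addbC.
Qed.

Lemma ract_adjoint s v w : re_inner (ract v s) w = re_inner v (ract w (cl_conj s)).
Proof.
rewrite /re_inner.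
transitivity (\sum_C \sum_A \sum_(B | symd A B == C)
    (-1) ^+ inversions A B * (s B * inner (v A) (w C))).
  apply: eq_bigr => C _; rewrite ffunE innerC inner_sumr; apply: eq_bigr => B _.
  by rewrite inner_sumr; apply: eq_bigr => A _; rewrite !innerZr innerC.
transitivity (\sum_A \sum_C \sum_(B | symd C B == A)
    (-1) ^+ inversions C B * (cl_conj s B * inner (v A) (w C))); last first.
  apply: eq_bigr => C _; rewrite ffunE inner_sumr; apply: eq_bigr => B _.
  by rewrite inner_sumr; apply: eq_bigr => A _; rewrite !innerZr.
rewrite exchange_big /=; apply: eq_bigr => A _; apply: eq_bigr => C _.
rewrite big_mkcond [RHS]big_mkcond /=; apply: eq_bigr => B _.
rewrite (symdC A B) symd_eq (symdC B C); case: ifP => // /eqP CBA.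
rewrite cl_conjE !mulrA -exprD; congr (_ * _ * _).
by rewrite -CBA -signr_odd odd_inversions_symdl -[RHS]signr_odd oddD.
Qed.

End Action.

Lemma lactE s t : @lact R d (R^o : hilbertType R) s t = s * t.
Proof.
apply/ffunP => C; rewrite !ffunE; apply: eq_bigr => A _.
by apply: eq_bigr => B _; rewrite /GRing.scale.
Qed.

Lemma cl_conjM s t : cl_conj (s * t) = cl_conj t * cl_conj s.
Proof.
have key (x y : Cl) :
    @re_inner R d (R^o : hilbertType R) x (cl_conj (s * t) * y) =
    @re_inner R d (R^o : hilbertType R) x (cl_conj t * cl_conj s * y).
  rewrite -(lactE (cl_conj (s * t)) y) -lact_adjoint.
  rewrite -(lactE (cl_conj t * cl_conj s) y).
  by rewrite -[in RHS]lactA -[RHS]lact_adjoint -[RHS]lact_adjoint [in RHS]lactA.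
rewrite -[LHS]mulr1 -[RHS]mulr1.
by apply: (ip_ext (module_hilbert d (R^o : hilbertType R))) => x; exact: key.
Qed.

Lemma cl_conj1 : cl_conj (1 : Cl) = 1.
Proof.
apply/ffunP => A; rewrite cl_conjE ffunE; have [->|_] := eqVneq A finset.set0.
  by rewrite inversions0l mul1r.
by rewrite mulr0.
Qed.

Lemma cl_conj_basisM A : cl_conj (cl_basis R A) * cl_basis R A = 1.
Proof.
have -> : cl_conj (cl_basis R A) = (-1) ^+ inversions A A *: cl_basis R A.
  apply/ffunP => B; rewrite cl_conjE !ffunE.
  by have [->|_] := eqVneq B A; rewrite ?mulr1 ?mulr0 ?scaler0// /GRing.scale /= mulr1.
rewrite -cl_scalerAl cl_basisM scalerA sign_diag scale1r.
by congr cl_basis; apply/setP => i; rewrite in_symd addbb inE.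
Qed.

Lemma cl_sum s : s = \sum_A s A *: cl_basis R A.
Proof.
apply/ffunP => B; rewrite sum_ffunE (bigD1 B)//= !ffunE eqxx big1.
  by rewrite addr0 /GRing.scale /= mulr1.
by move=> A AB; rewrite !ffunE eq_sym (negbTE AB) scaler0.
Qed.

Lemma cl_coord_norm s A : `|s A| <= `|s|.
Proof. exact: (@coord_norm R d (R^o : hilbertType R) s A). Qed.

Section Bounds.
Variable W : hilbertType R.
Implicit Types (u v w : cliffmod d W).

Lemma lact_basis_norm A v : `|lact (cl_basis R A) v| = `|v|.
Proof.
apply/eqP; rewrite -(@eqrXn2 _ 2)// -!re_inner_norm lact_adjoint lactA.
by rewrite cl_conj_basisM lact1.
Qed.

Lemma lact_sum s v : lact s v = \sum_A s A *: lact (cl_basis R A) v.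
Proof.
rewrite {1}[s]cl_sum; elim/big_rec2 : _ => [|A y z _ <-].
  by rewrite -[0](scale0r (1 : Cl)) lactZl scale0r.
by rewrite lactDl lactZl.
Qed.

Lemma lact_norm s v : `|lact s v| <= #|{set 'I_d}|%:R * `|s| * `|v|.
Proof.
rewrite lact_sum; apply: le_trans (ler_norm_sum _ _ _) _.
apply: (@le_trans _ _ (\sum_(A : {set 'I_d}) `|s| * `|v|)).
  apply: ler_sum => A _; rewrite normrZ lact_basis_norm.
  by rewrite ler_wpM2r ?normr_ge0 ?cl_coord_norm.
by rewrite sumr_const -[_ *+ _]mulr_natl mulrA.
Qed.

End Bounds.

(** The adjoint condition is stated with the Clifford valued inner product;
    since the graphs involved are right submodules, its real part suffices. *)
Section CliffordInner.
Variable W : hilbertType R.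
Implicit Types (u v w : cliffmod d W).

Lemma cl_innerE v w : cl_inner v w = \sum_A cl_conj (cl_basis R A) * slot (v A) w.
Proof.
apply: eq_bigr => A _; rewrite [slot _ _]cl_sum mulr_sumr.
by apply: eq_bigr => B _; rewrite ffunE -cl_scalerAr.
Qed.

Lemma cl_inner_ract v w s : cl_inner v (ract w s) = cl_inner v w * s.
Proof.
rewrite !cl_innerE mulr_suml; apply: eq_bigr => A _.
by rewrite slot_ract mulrA.
Qed.

Lemma cl_re_sum I (r : seq I) (F : I -> Cl) :
  cl_re (\sum_(i <- r) F i) = \sum_(i <- r) cl_re (F i).
Proof. by rewrite /cl_re sum_ffunE. Qed.

Lemma cl_re_mul s t : cl_re (cl_conj s * t) = \sum_A s A * t A.
Proof.
rewrite /cl_re ffunE; apply: eq_bigr => A _; rewrite (big_pred1 A).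
  by rewrite cl_conjE mulrA mulrA sign_diag mul1r.
move=> B /=; rewrite symd_eq symd0; exact: eq_sym.
Qed.

Lemma cl_re_inner v w : cl_re (cl_inner v w) = re_inner v w.
Proof.
rewrite cl_innerE cl_re_sum; apply: eq_bigr => A _.
rewrite cl_re_mul (bigD1 A)//= big1 ?addr0; first by rewrite !ffunE eqxx mul1r.
by move=> B BA; rewrite !ffunE (negbTE BA) mul0r.
Qed.

Lemma cl_inner_ext (v v' w w' : cliffmod d W) :
  (forall s, re_inner v (ract w s) = re_inner v' (ract w' s)) ->
  cl_inner v w = cl_inner v' w'.
Proof.
move=> h; apply/ffunP => A.
have re_coord (x : Cl) : x A = cl_re (x * cl_conj (cl_basis R A)).
  rewrite -[x * _]cl_conjK cl_conjM cl_conjK.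
  have reJ (y : Cl) : cl_re (cl_conj y) = cl_re y :> R.
    by rewrite /cl_re cl_conjE inversions0l mul1r.
  rewrite reJ -{1}[cl_basis R A]cl_conjK cl_re_mul.
  rewrite (bigD1 A)//= big1 ?addr0; last first.
    by move=> B BA; rewrite cl_conjE ffunE (negbTE BA) mulr0 mul0r.
  by rewrite !cl_conjE ffunE eqxx mulr1 mulrA sign_diag mul1r.
by rewrite !re_coord -!cl_inner_ract !cl_re_inner h.
Qed.

End CliffordInner.
End Conjugation.

(** * Slices as copies of the complex plane, and double sectors *)

Section Slices.
Variables (R : realType) (d : nat).
Local Notation Cl := (clifford R d).
Local Notation Re := complex.Re.
Local Notation Im := complex.Im.
Local Notation normc := ComplexField.Normc.normc.
Implicit Types (s t J : Cl) (z w : R[i]) (A B C : {set 'I_d}).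

Lemma cl_re_inner_conj s t :
  @re_inner R d (R^o : hilbertType R) s t = cl_re (cl_conj s * t).
Proof. by rewrite cl_re_mul. Qed.

Lemma cl_norm_sqr s : `|s| ^+ 2 = cl_re (cl_conj s * s).
Proof. by rewrite -cl_re_inner_conj (@re_inner_norm R d (R^o : hilbertType R)). Qed.

Lemma sphere_conj J : sphere J -> cl_conj J = - J.
Proof.
move=> [pJ rJ _]; apply/ffunP => A; rewrite !ffunE.
have [cA|] := ltnP 1 #|A|; first by rewrite (pJ A cA) mulr0 oppr0.
rewrite leq_eqVlt ltnS leqn0 => /predU1P[->|].
  by rewrite /= expr1 mulN1r.
by rewrite cards_eq0 => /eqP ->; move: rJ; rewrite /cl_re => ->; rewrite mulr0 oppr0.
Qed.

(** The square [x] of [J] is fixed by the conjugation, whose sign on e_C is -1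
    when |C| is 1 or 2; since [J] has components of degree 1 only, [x] has none
    of degree above 2, and so it is real. *)
Lemma sphere_sqr J : sphere J -> J * J = - 1.
Proof.
move=> SJ; have [pJ rJ nJ] := SJ; set x := J * J.
have xJ : cl_conj x = x by rewrite cl_conjM !(sphere_conj SJ) mulrNN.
have degJ A : J A != 0 -> (#|A| <= 1)%N.
  by apply: contraR; rewrite -ltnNge => /pJ ->; rewrite eqxx.
have x2 C : (2 < #|C|)%N -> x C = 0.
  move=> cC; rewrite ffunE big1// => A _; rewrite big1// => B /eqP ABC.
  have [->|/degJ cA] := eqVneq (J A) 0; first by rewrite mul0r mulr0.
  have [->|/degJ cB] := eqVneq (J B) 0; first by rewrite !mulr0.
  suff : (#|C| <= 2)%N by rewrite leqNgt cC.
  rewrite -ABC; apply: leq_trans (leq_card_setU _ _) _.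
  apply: (@leq_trans (#|A| + #|B|)); last exact: (leq_add cA cB).
  by apply: leq_add; apply: subset_leq_card; apply: subsetDl.
apply/ffunP => C; rewrite [RHS]ffunE.
have [->|C0] := eqVneq C finset.set0.
  have : cl_re (cl_conj J * J) = 1 by rewrite -cl_norm_sqr nJ expr1n.
  rewrite (sphere_conj SJ) mulNr -/x /cl_re ffunE => /eqP.
  by rewrite eqr_oppLR => /eqP ->; rewrite ffunE eqxx.
rewrite [X in - X]ffunE (negbTE C0) oppr0.
have [/x2//|] := ltnP 2 #|C|; rewrite leq_eqVlt ltnS leq_eqVlt ltnS leqn0 cards_eq0.
rewrite (negbTE C0) orbF => cC; apply/eqP; rewrite -[_ == 0](mulrn_eq0 _ 2) mulr2n.
have sgn : (-1) ^+ (#|C| * #|C|.+1)./2 = -1 :> R.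
  by case/orP: cC => /eqP ->; rewrite -signr_odd.
move/ffunP/(_ C): xJ; rewrite ffunE sgn mulN1r => {1}<-.
by rewrite addNr.
Qed.

Lemma sphereN J : sphere J -> sphere (- J).
Proof.
move=> [pJ rJ nJ]; split; last by rewrite normrN.
  by move=> A cA; rewrite ffunE pJ// oppr0.
by rewrite /cl_re ffunE; move: rJ; rewrite /cl_re => ->; rewrite oppr0.
Qed.

Definition iota_slice J z : Cl := slice_point J (Re z, Im z).

Lemma iotaE J z : iota_slice J z = Re z *: (1 : Cl) + Im z *: J.
Proof. by []. Qed.

Lemma iota_conj J z : sphere J -> cl_conj (iota_slice J z) = iota_slice J (conjc z).
Proof.
case: z => a b SJ; rewrite !iotaE /= cl_conjD !cl_conjZ cl_conj1 (sphere_conj SJ).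
by rewrite scalerN scaleNr.
Qed.

Lemma iotaN J z : iota_slice (- J) z = iota_slice J (conjc z).
Proof. by case: z => a b; rewrite !iotaE /= scalerN scaleNr. Qed.

Lemma iotaD J z w : iota_slice J (z + w) = iota_slice J z + iota_slice J w.
Proof. by case: z w => [a b] [a' b']; rewrite !iotaE /= !scalerDl addrACA. Qed.

Lemma iota1 J : iota_slice J 1 = 1.
Proof. by rewrite iotaE /= scale0r scale1r addr0. Qed.

Lemma iotaM J z w : sphere J ->
  iota_slice J (z * w) = iota_slice J z * iota_slice J w.
Proof.
case: z w => [a b] [a' b'] SJ; rewrite !iotaE /=.
rewrite mulrDl !mulrDr -!cl_scalerAl -!cl_scalerAr !mul1r mulr1 (sphere_sqr SJ).
rewrite scalerN !scalerA scalerN scalerBl scalerDl scalerA -!addrA; congr (_ + _).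
by rewrite addrC -addrA; congr (_ + _); rewrite addrC.
Qed.

Lemma iotaX J z n : sphere J -> iota_slice J (z ^+ n) = iota_slice J z ^+ n.
Proof. by move=> SJ; elim: n => [|n IHn]; rewrite ?iota1// !exprS iotaM// IHn. Qed.

Lemma re_iota J z : sphere J -> cl_re (iota_slice J z) = Re z.
Proof.
move=> [_ rJ _]; rewrite /cl_re iotaE !ffunE eqxx.
by move: rJ; rewrite /cl_re => ->; rewrite /GRing.scale /= mulr0 mulr1 addr0.
Qed.

Lemma normc_sqr z : normc z ^+ 2 = Re z ^+ 2 + Im z ^+ 2.
Proof. by case: z => a b; rewrite /= sqr_sqrtr// addr_ge0 ?sqr_ge0. Qed.

Lemma normc_ge0 z : 0 <= normc z.
Proof. by case: z => a b; rewrite /= sqrtr_ge0. Qed.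

Lemma norm_iota J z : sphere J -> `|iota_slice J z| = normc z.
Proof.
move=> SJ; apply/eqP; rewrite -(@eqrXn2 _ 2) ?normc_ge0// cl_norm_sqr iota_conj//.
rewrite -iotaM// re_iota// normc_sqr; apply/eqP; case: z => a b /=; ring.
Qed.

Lemma paravector_iota J z : sphere J -> paravector (iota_slice J z).
Proof.
move=> [pJ _ _] A cA; rewrite iotaE !ffunE (pJ A cA).
have -> : (A == finset.set0) = false by apply/eqP => A0; rewrite A0 cards0 in cA.
by rewrite !scaler0 addr0.
Qed.

Lemma iota_pinv J z : sphere J -> cl_pinv (iota_slice J z) = iota_slice J z^-1.
Proof.
move=> SJ; rewrite /cl_pinv norm_iota// iota_conj// normc_sqr; case: z => a b.
rewrite !iotaE /= scalerDr !scalerA; congr (_ *: _ + _ *: _); first exact: mulrC.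
by ring.
Qed.

Definition regc (m : nat) z : R[i] := (z * (1 + z ^+ 2)^-1) ^+ m.

Lemma regularizer_iota J z m : sphere J ->
  regularizer m (iota_slice J z) = iota_slice J (regc m z).
Proof.
move=> SJ; rewrite /regularizer /regc -(iota1 J) -!iotaX// -iotaD iota_pinv//.
by rewrite -iotaX// -iotaM// -exprMn.
Qed.

Lemma cl_re_le_norm s : `|cl_re s| <= `|s|.
Proof. exact: cl_coord_norm. Qed.

(** The arccosine decreases, so the two intervals of angles become two
    inequalities for the slope [cl_re s / |s|]. *)
Lemma D_E (w : R) s : 0 < w < pi / 2 -> paravector s -> s != 0 ->
  D_ d w s <-> `|s| * cos w < `|cl_re s|.
Proof.
move=> /andP[w0 w2].
have wi : w \in `[0, pi].
  by rewrite in_itv/= ltW//= (le_trans (ltW w2))// ler_pdivrMr// ler_peMr ?pi_ge0// ler1n.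
have pwi : pi - w \in `[0, pi].
  by rewrite in_itv/=; have pi0 := pi_gt0 R; apply/andP; split; lra.
move=> ps s0.
have n0 : 0 < `|s| by rewrite normr_gt0.
set x := cl_re s / `|s|.
have x1 : -1 <= x <= 1.
  by rewrite -ler_norml normrM normfV normr_id ler_pdivrMr// mul1r cl_re_le_norm.
have ax : 0 <= acos x <= pi by rewrite acos_ge0 ?acos_lepi.
have cax : cos (acos x) = x by rewrite acosK// in_itv.
have -> : (`|s| * cos w < `|cl_re s|) = ((cos w < x) || (x < - cos w)).
  rewrite mulrC -ltr_pdivlMr// -[X in _ / X](gtr0_norm n0) -normf_div -/x.
  by rewrite lter_normr ltrNr.
have ai : acos x \in `[0, pi] by rewrite in_itv.
have cw : (acos x < w) = (cos w < x) by rewrite -(ltr_cos ai wi) cax.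
have cpw : (pi - w < acos x) = (x < - cos w).
  by rewrite -(ltr_cos pwi ai) cax cosB cospi sinpi mul0r addr0 mulN1r.
rewrite /D_ /I_ /cl_arg /= -/x !in_itv /=; split.
  move=> [_ _ [/andP[_ h]|/andP[h _]]]; first by rewrite -cw h.
  by rewrite -cpw h orbT.
move/andP: ax => [a0 api] /orP h; split=> //; case: h => [h|h]; [left|right].
  by rewrite cw h andbT (lt_le_trans _ a0)// oppr_lt0.
by rewrite cpw h /= (le_lt_trans api)// ltrDl.
Qed.

End Slices.

(** * Bounded operators, adjoints and orthogonal complements *)

Section Operators.
Variables (R : realType) (d : nat) (W : hilbertType R).
Local Notation Cl := (clifford R d).
Local Notation V := (cliffmod d W).
Local Notation ip := (@re_inner R d W).
Implicit Types (s t : Cl) (u v w x y : V) (A B M : V -> V) (S T : set (V * V)).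

Let HV := module_hilbert d W.

Definition real_linear A := forall (a : R) u v, A (a *: u + v) = a *: A u + A v.

Definition bounded_by (C : R) A := forall v, `|A v| <= C * `|v|.

Definition bounded_linear A := real_linear A /\ exists2 C, 0 <= C & bounded_by C A.

Definition right_homogeneous A := forall v s, A (ract v s) = ract (A v) s.

Lemma real_linear0 A : real_linear A -> A 0 = 0.
Proof. by move=> lA; have := lA (-1) 0 0; rewrite scaler0 addr0 scaleN1r addNr. Qed.

Lemma real_linearD A u v : real_linear A -> A (u + v) = A u + A v.
Proof. by move=> lA; have := lA 1 u v; rewrite !scale1r. Qed.

Lemma real_linearZ A a v : real_linear A -> A (a *: v) = a *: A v.
Proof. by move=> lA; have := lA a v 0; rewrite (real_linear0 lA) !addr0. Qed.

Lemma real_linearN A v : real_linear A -> A (- v) = - A v.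
Proof. by move=> lA; rewrite -scaleN1r real_linearZ// scaleN1r. Qed.

Lemma real_linearB A u v : real_linear A -> A (u - v) = A u - A v.
Proof. by move=> lA; rewrite real_linearD// real_linearN. Qed.

Lemma bounded_operatorP A :
  bounded_operator A <-> bounded_linear A /\ right_homogeneous A.
Proof.
split=> [[[_ hD hR] [C hC]]|[[lA [C C0 hC]] rA]].
  have D u v : A (u + v) = A u + A v by exact: esym (hD (u, A u) (v, A v) erefl erefl).
  have hR' : right_homogeneous A by move=> v s; exact: esym (hR (v, A v) s erefl).
  split=> //; split.
    by move=> a u v; rewrite D -(ract_real u a) hR' ract_real.
  exists `|C| => // v; apply: le_trans (hC v) _.
  by rewrite ler_wpM2r// ler_norm.
split; last by exists C.
split => [|p q|p s]; rewrite /opgraph /=.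
- by rewrite real_linear0.
- by move=> -> ->; rewrite real_linearD.
- by move=> ->; rewrite rA.
Qed.

Lemma opnorm_le A C : 0 <= C -> bounded_by C A -> (opnorm A <= C%:E)%E.
Proof.
move=> C0 hC; apply: ge_ereal_sup => _ [v /= v1 <-]; rewrite lee_fin.
by apply: le_trans (hC v) _; rewrite -[leRHS]mulr1 ler_wpM2l.
Qed.

Lemma opnorm_ge0 A : (0 <= opnorm A)%E.
Proof.
apply: le_trans (ereal_sup_ubound _); last by exists 0 => //=; rewrite normr0.
by rewrite lee_fin.
Qed.

Lemma bounded_by_opnorm A C : real_linear A -> (opnorm A <= C%:E)%E -> bounded_by C A.
Proof.
move=> lA hC v; have [->|v0] := eqVneq v 0.
  by rewrite real_linear0// normr0 mulr0.
have nv : 0 < `|v| by rewrite normr_gt0.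
have : (`|A (`|v|^-1 *: v)|%:E <= C%:E)%E.
  apply: le_trans hC; apply: ereal_sup_ubound; exists (`|v|^-1 *: v) => //=.
  by rewrite normrZ normfV normr_id mulVf// gt_eqF.
rewrite lee_fin real_linearZ// normrZ normfV normr_id.
by rewrite mulrC ler_pdivrMr.
Qed.

(** Riesz representation turns bounded bilinear forms into operators. *)
Lemma form_operator (b : V -> V -> R) (C : R) : 0 <= C ->
  (forall a u u' v, b (a *: u + u') v = a * b u v + b u' v) ->
  (forall a u v v', b u (a *: v + v') = a * b u v + b u v') ->
  (forall u v, `|b u v| <= C * `|u| * `|v|) ->
  exists A, [/\ real_linear A, bounded_by C A & forall u v, ip u (A v) = b u v].
Proof.
move=> C0 bl br bb.
have /choice[A hA] v : exists w, forall u, b u v = ip w u.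
  apply: (riesz HV (C := (C * `|v|) ^+ 2)) => [a u u'|u]; first exact: bl.
  rewrite re_inner_norm -exprMn -[b u v ^+ 2]ger0_norm ?sqr_ge0// normrX.
  rewrite ler_pXn2r ?nnegrE ?mulr_ge0//.
  by rewrite mulrAC; exact: bb.
have hA' u v : ip u (A v) = b u v by rewrite (ipC HV) hA.
exists A; split=> // [a u v|v].
  apply: (ip_ext HV) => w.
  by rewrite (ipDr HV) (ipZr HV) !hA' br.
have [->|nz] := eqVneq (A v) 0; first by rewrite normr0 mulr_ge0.
have nv : 0 < `|A v| by rewrite normr_gt0.
rewrite -(ler_pM2r nv) -expr2 -re_inner_norm hA'.
by apply: le_trans (ler_norm _) _; apply: le_trans (bb _ _) _; rewrite mulrAC.
Qed.

Definition adj A : V -> V := fun u => xget 0 [set w | forall v, ip w v = ip u (A v)].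

Lemma adj_spec A (C : R) : real_linear A -> 0 <= C -> bounded_by C A ->
  [/\ forall u v, ip (adj A u) v = ip u (A v), real_linear (adj A) &
      bounded_by C (adj A)].
Proof.
move=> lA C0 hC.
have [B [lB bB hB]] : exists B, [/\ real_linear B, bounded_by C B &
    forall u v, ip u (B v) = ip (A u) v].
  apply: form_operator => // [a u u' v|a u v v'|u v].
  - by rewrite lA (ipDl HV) (ipZl HV).
  - by rewrite (ipDr HV) (ipZr HV).
  - by apply: le_trans (re_inner_CS _ _) _; rewrite ler_wpM2r.
have AB : adj A = B.
  apply/funext => u; rewrite /adj; case: xgetP => [w _ /= hw|/(_ (B u))[] v].
    by apply: (ip_ext HV) => v; rewrite (ipC HV) hw (ipC HV) hB.
  by rewrite (ipC HV) hB (ipC HV).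
by rewrite AB; split=> // u v; rewrite (ipC HV) hB (ipC HV).
Qed.

Lemma adjE A u v : bounded_linear A -> ip (adj A u) v = ip u (A v).
Proof. by move=> [lA [C C0 hC]]; have [] := adj_spec lA C0 hC. Qed.

Lemma adjEr A u v : bounded_linear A -> ip u (adj A v) = ip (A u) v.
Proof. by move=> bA; rewrite (ipC HV) adjE// (ipC HV). Qed.

Lemma adj_bounded_linear A : bounded_linear A -> bounded_linear (adj A).
Proof.
by move=> [lA [C C0 hC]]; have [_ ? ?] := adj_spec lA C0 hC; split=> //; exists C.
Qed.

Lemma adj_bounded_by C A : real_linear A -> 0 <= C -> bounded_by C A ->
  bounded_by C (adj A).
Proof. by move=> lA C0 hC; have [] := adj_spec lA C0 hC. Qed.

Lemma adj_right A : bounded_linear A -> right_homogeneous A ->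
  right_homogeneous (adj A).
Proof.
move=> bA rA v s; apply: (ip_ext HV) => w.
rewrite adjEr// (ipC HV) ract_adjoint -rA.
by rewrite [RHS](ipC HV) ract_adjoint adjE.
Qed.

Lemma adj_uniq A B : bounded_linear A ->
  (forall u v, ip (B u) v = ip u (A v)) -> adj A = B.
Proof.
move=> bA h; apply/funext => u; apply: (ip_ext HV) => v.
by rewrite (ipC HV) adjE// (ipC HV v) h.
Qed.

Lemma bounded_linear_comp A B : bounded_linear A -> bounded_linear B ->
  bounded_linear (A \o B).
Proof.
move=> [lA [C C0 hA]] [lB [D D0 hB]]; split=> [a u v|]; first by rewrite /= lB lA.
exists (C * D) => [|v]; first exact: mulr_ge0.
by apply: le_trans (hA _) _; rewrite -mulrA ler_wpM2l.
Qed.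

Lemma bounded_linearZD (a : R) A B : bounded_linear A -> bounded_linear B ->
  bounded_linear (fun v => a *: A v + B v).
Proof.
move=> [lA [C C0 hA]] [lB [D D0 hB]]; split=> [b u v|].
  rewrite lA lB !scalerDr !scalerA mulrC -!addrA; congr (_ + _).
  by rewrite addrCA.
exists (`|a| * C + D) => [|v]; first by rewrite addr_ge0// mulr_ge0.
apply: le_trans (ler_normD _ _) _; rewrite normrZ mulrDl -mulrA.
by rewrite lerD// ler_wpM2l.
Qed.

Lemma bounded_linear_lact s : bounded_linear (fun v => lact s v).
Proof.
split=> [a u v|]; first by rewrite lactDr lactZr.
by exists (#|{set 'I_d}|%:R * `|s|) => [|v]; [exact: mulr_ge0|exact: lact_norm].
Qed.

(** If [w] is orthogonal to a set from which a bounded sequence runs with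
    images under the injective operator [M] tending to [M w], that sequence
    tends weakly to [w] because [adj M] has dense range; so [w] = 0. *)
Lemma orthogonal_weak_limit M (S : set V) (w : V) (C : R) :
  bounded_linear M -> (forall v, M v = 0 -> v = 0) ->
  (forall x, S x -> ip w x = 0) ->
  (forall e, 0 < e -> exists x, [/\ S x, `|x| <= C & `|M x - M w| < e]) -> w = 0.
Proof.
move=> bM iM Sw hx.
have [lM _] := bM; have [lMs _] := adj_bounded_linear bM.
have dense : forall e, 0 < e -> exists2 s, range (adj M) s & ip (s - w) (s - w) < e.
  apply: (dense_of_orthogonal HV).
    split; first by exists 0 => //; exact: real_linear0.
    by move=> a _ _ [u _ <-] [v _ <-]; exists (a *: u + v) => //; rewrite lMs.
  move=> y hy; rewrite (iM y) ?(ip0l HV)//; apply: (ip_ext HV) => u.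
  by rewrite (ip0r HV) (ipC HV) -adjEr// hy//; exists u.
apply/eqP; rewrite -normr_eq0 -sqrf_eq0 eq_le sqr_ge0 andbT.
apply/ler_addgt0Pr => e e0; rewrite add0r -re_inner_norm.
have C0 : 0 <= C by have [x [_ + _]] := hx 1 ltr01; apply: le_trans.
set k := `|w| + C + 1; have k0 : 0 < k by rewrite ltr_wpDl// addr_ge0.
have [_ [y _ <-] hy] := dense ((e / (2 * k)) ^+ 2) ltac:(by rewrite exprn_gt0// divr_gt0// mulr_gt0).
have {}hy : `|adj M y - w| < e / (2 * k).
  move: hy; rewrite re_inner_norm ltr_pXn2r ?nnegrE//.
  by rewrite ltW// divr_gt0// mulr_gt0.
have ky : 0 < `|y| + 1 by rewrite ltr_wpDl.
have [x [Sx xC Mx]] := hx (e / (2 * (`|y| + 1))) ltac:(by rewrite divr_gt0// mulr_gt0).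
have -> : ip w w = - ip (adj M y - w) (w - x) - ip y (M x - M w).
  rewrite -(real_linearB x w lM) -(adjE y (x - w) bM) !(ipBl HV) !(ipBr HV) (Sw x Sx).
  by ring.
apply: (@le_trans _ _ (e / 2 + e / 2)); last by rewrite -splitr.
apply: le_trans (ler_norm _) _; apply: le_trans (ler_normB _ _) _.
rewrite normrN; apply: lerD; apply: le_trans (re_inner_CS _ _) _.
  apply: (@le_trans _ _ (e / (2 * k) * k)).
    apply: ler_pM => //; first exact: ltW.
    by apply: le_trans (ler_normB _ _) _; rewrite /k; lra.
  by rewrite invfM mulrA divfK// gt_eqF.
apply: (@le_trans _ _ ((`|y| + 1) * (e / (2 * (`|y| + 1))))).
  by apply: ler_pM => //; [rewrite lerDl|exact: ltW].
by rewrite mulrC invfM mulrA divfK// gt_eqF.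
Qed.

Lemma closure_prodP (S : set (V * V)) p :
  closure S p <-> forall e, 0 < e ->
    exists q, [/\ S q, `|p.1 - q.1| < e & `|p.2 - q.2| < e].
Proof.
split=> [cS e e0|h B].
  have [q [Sq [q1 q2]]] := cS (ball p e) (nbhsx_ballx _ _ e0).
  by exists q; split=> //; move: q1 q2; rewrite -ball_normE.
move/nbhs_ballP => [e /= e0 hB]; have [q [Sq q1 q2]] := h e e0.
by exists q; split=> //; apply: hB; split; rewrite -ball_normE.
Qed.

Lemma closure_prod_ip (S : set (V * V)) a b :
  (forall q, S q -> ip a q.1 = ip b q.2) ->
  forall q, closure S q -> ip a q.1 = ip b q.2.
Proof.
move=> h p /closure_prodP cp; apply/eqP; rewrite -subr_eq0 -normr_eq0 eq_le normr_ge0 andbT.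
apply/ler_addgt0Pr => e e0; rewrite add0r.
set k := `|a| + `|b| + 1; have k0 : 0 < k by rewrite ltr_wpDl// addr_ge0.
have [q [Sq q1 q2]] := cp (e / k) (divr_gt0 e0 k0).
have -> : ip a p.1 - ip b p.2 = ip a (p.1 - q.1) - ip b (p.2 - q.2).
  by rewrite !(ipBr HV) (h q Sq); ring.
apply: le_trans (ler_normB _ _) _.
apply: (@le_trans _ _ (`|a| * (e / k) + `|b| * (e / k))).
  apply: lerD; apply: le_trans (re_inner_CS _ _) _; rewrite ler_wpM2l//; exact: ltW.
rewrite -mulrDl mulrA ler_pdivrMr// mulrC ler_wpM2l//; first exact: ltW.
by rewrite /k lerDl.
Qed.

Lemma adjointE T : right_linear T ->
  adjoint T = [set p | forall q, T q -> ip p.2 q.1 = ip p.1 q.2].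
Proof.
move=> [_ _ rT]; apply/seteqP; split=> p /= h q Tq.
  by rewrite -!cl_re_inner h.
by apply: cl_inner_ext => s; exact: (h _ (rT q s Tq)).
Qed.

Lemma adjoint_closure T : right_linear T ->
  adjoint (closure T) = [set p | forall q, T q -> ip p.2 q.1 = ip p.1 q.2].
Proof.
move=> rT; have [_ _ rT'] := rT; rewrite -adjointE//.
apply/seteqP; split=> p /= h q Tq; first by apply: h; exact: subset_closure.
apply: cl_inner_ext => s.
rewrite -[s]cl_conjK -!ract_adjoint; apply: closure_prod_ip Tq => q' Tq'.
rewrite !ract_adjoint -!cl_re_inner.
by apply: congr1; exact: (h _ (rT' q' _ Tq')).
Qed.

Definition prod_inner (p q : V * V) : R := ip p.1 q.1 + ip p.2 q.2.

Lemma prod_hilbert : hilbert_form (prod_inner : (V * V)%type -> _ -> _).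
Proof.
split.
- by move=> p q; rewrite /prod_inner (ipC HV) (ipC HV p.2).
- by move=> p q r; rewrite /prod_inner /= !(ipDl HV) addrACA.
- by move=> a p q; rewrite /prod_inner /= !(ipZl HV) mulrDr.
- by move=> p; rewrite addr_ge0// (ip_ge0 HV).
- move=> [a b] /eqP; rewrite paddr_eq0 ?(ip_ge0 HV)//= => /andP[/eqP h1 /eqP h2].
  by rewrite (ip_eq0 HV h1) (ip_eq0 HV h2).
move=> u hu.
have le1 (p : V * V) : ip p.1 p.1 <= prod_inner p p by rewrite lerDl (ip_ge0 HV).
have le2 (p : V * V) : ip p.2 p.2 <= prod_inner p p by rewrite lerDr (ip_ge0 HV).
have [a ha] := ip_complete HV (u := fun n => (u n).1) (fun e e0 =>
  let: ex_intro N hN := hu e e0 in ex_intro _ N (fun m n Nm Nn =>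
    le_lt_trans (le1 _) (hN m n Nm Nn))).
have [b hb] := ip_complete HV (u := fun n => (u n).2) (fun e e0 =>
  let: ex_intro N hN := hu e e0 in ex_intro _ N (fun m n Nm Nn =>
    le_lt_trans (le2 _) (hN m n Nm Nn))).
exists (a, b) => e e0; have e2 : 0 < e / 2 by rewrite divr_gt0.
have [N1 h1] := ha _ e2; have [N2 h2] := hb _ e2.
exists (maxn N1 N2) => n; rewrite geq_max => /andP[n1 n2].
by rewrite [ltRHS]splitr ltrD ?h1 ?h2.
Qed.

(** The graph is the kernel of (w, v) |-> G w - E v, so its adjoint is a double
    orthogonal complement in the square of the module, up to the flip of the
    two components; this is where the closure comes from. *)
Lemma adjoint_kernel (E G : V -> V) : bounded_linear E -> bounded_linear G ->
  right_homogeneous E -> right_homogeneous G ->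
  adjoint [set p | E p.2 = G p.1] =
  closure [set p | exists u, p.1 = adj E u /\ p.2 = adj G u].
Proof.
move=> bE bG rE rG; have [lE _] := bE; have [lG _] := bG.
have [lEs _] := adj_bounded_linear bE; have [lGs _] := adj_bounded_linear bG.
rewrite adjointE; last first.
  split=> /= [|p q|p s]; first by rewrite !real_linear0.
    by rewrite !real_linearD// => -> ->.
  by rewrite rE rG => ->.
apply/seteqP; split=> -[a b] /=; last first.
  move=> cab [w v] /= hwv.
  have := @closure_prod_ip _ v w _ _ cab => /= /(_ _)/esym h.
  rewrite (ipC HV b) (ipC HV a) h// => -[_ _] [u /= [-> ->]].
  by rewrite !adjEr// hwv.
move=> h; apply/closure_prodP => e e0.
pose S : set (V * V) := [set p | exists u, p = (adj G u, - adj E u)].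
have LS : linear_set S.
  split; first by exists 0; rewrite (real_linear0 lEs) (real_linear0 lGs) oppr0.
  move=> c _ _ [u ->] [v ->]; exists (c *: u + v).
  by rewrite lEs lGs opprD -scalerN.
have [] := dense_of_orthogonal prod_hilbert (x := (b, - a)) LS _ (exprn_gt0 2 e0).
  move=> [w v] hy; rewrite /prod_inner /= (ipNr HV) (ipC HV) (ipC HV v).
  apply/eqP; rewrite subr_eq0; apply/eqP; apply: (h (w, v)) => /=.
  apply: (ip_ext HV) => u; have := hy _ (ex_intro _ u erefl).
  rewrite /prod_inner /= (ipNr HV) !adjEr// => /eqP.
  by rewrite subr_eq0 (ipC HV u (E v)) (ipC HV u (G w)) => /eqP.
move=> _ [u ->]; rewrite /prod_inner /= !re_inner_norm => hu.
exists (adj E u, adj G u); split; first by exists u.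
  rewrite -(@ltr_pXn2r _ 2)// ?nnegrE ?(ltW e0)//; apply: le_lt_trans hu.
  by rewrite opprK addrC lerDr sqr_ge0.
rewrite -(@ltr_pXn2r _ 2)// ?nnegrE ?(ltW e0)//; apply: le_lt_trans hu.
by rewrite distrC lerDl sqr_ge0.
Qed.

End Operators.

(** * Integrals over a half-line *)

Section HalfLine.
Variable R : realType.
Local Notation mu := (@lebesgue_measure R).
Implicit Types (f g F : R -> R) (a b c t e C : R).

Definition half_line : set R := [set` `]0, +oo[].

Lemma half_lineE t : half_line t = (0 < t).
Proof. by rewrite /half_line /= in_itv/= andbT. Qed.

Lemma FTC_pos f F a b : 0 < a -> a < b ->
  (forall t, 0 < t -> is_derive t 1 F (f t)) ->
  (forall t, 0 < t -> {for t, continuous f}) ->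
  (\int[mu]_(t in `[a, b]) (f t)%:E = (F b - F a)%:E)%E.
Proof.
move=> a0 ab dF cf.
have cF t : 0 < t -> {for t, continuous F}.
  move=> t0; apply/differentiable_continuous/derivable1_diffP.
  by have [] := dF t t0.
have pos t : t \in `[a, b] -> 0 < t.
  by rewrite in_itv/= => /andP[h _]; exact: lt_le_trans h.
rewrite (@continuous_FTC2 R f F a b)// ?EFinB//.
- apply: continuous_in_subspaceT => t; rewrite inE /= => /pos; exact: cf.
- split.
  + move=> t /subset_itv_oo_cc/pos t0; by have [] := dF t t0.
  + by apply: cvg_at_right_filter; apply: cF.
  + by apply: cvg_at_left_filter; apply: cF; exact: lt_trans ab.
- move=> t /subset_itv_oo_cc/pos t0; have := dF t t0 => dFt.
  by rewrite derive1E derive_val.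
Qed.

Definition exhaustion (n : nat) : set R := [set` `[n.+1%:R^-1, n.+1%:R]].

Lemma exhaustion_pos n t : exhaustion n t -> 0 < t.
Proof.
rewrite /exhaustion /= in_itv/= => /andP[h _]; apply: lt_le_trans h.
by rewrite invr_gt0.
Qed.

Lemma exhaustion_nondecreasing : nondecreasing_seq exhaustion.
Proof.
move=> m n mn; apply/subsetPset => t; rewrite /exhaustion /= !in_itv/=.
move=> /andP[h1 h2]; apply/andP; split.
  by apply: le_trans h1; rewrite lef_pV2 ?posrE// ler_nat ltnS.
by apply: le_trans h2 _; rewrite ler_nat ltnS.
Qed.

Lemma exhaustionP t : 0 < t -> exists n, exhaustion n t.
Proof.
move=> t0.
have [n [h1 h2]] : exists n, t^-1 <= n.+1%:R /\ t <= n.+1%:R.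
  exists (maxn (Num.truncn t^-1) (Num.truncn t)); split.
    apply/ltW/(lt_le_trans (truncnS_gt _)); rewrite ler_nat ltnS leq_maxl//.
  by apply/ltW/(lt_le_trans (truncnS_gt _)); rewrite ler_nat ltnS leq_maxr.
exists n; rewrite /exhaustion /= in_itv/= h2 andbT.
by rewrite -[t]invrK lef_pV2 ?posrE ?invr_gt0.
Qed.

Lemma half_line_bigcup : half_line = \bigcup_n exhaustion n.
Proof.
apply/seteqP; split=> t; rewrite half_lineE.
  by move=> /exhaustionP[n ht]; exists n.
by move=> [n _ /exhaustion_pos].
Qed.

Lemma measurable_half_line : measurable half_line.
Proof. exact: measurable_itv. Qed.

Lemma continuous_pos_measurable f : (forall t, 0 < t -> {for t, continuous f}) ->
  measurable_fun half_line f.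
Proof.
move=> cf; apply: open_continuous_measurable_fun; first exact: interval_open.
by move=> t; rewrite inE half_lineE; exact: cf.
Qed.

(** The derivative of arctan(t^e) / e: it is comparable with
    min(t^e, t^(-e)) / t and its primitive is bounded. *)
Definition weight e t : R := t `^ e / (1 + (t `^ e) ^+ 2) / t.

Lemma weight_ge0 e t : 0 < t -> 0 <= weight e t.
Proof.
move=> t0; rewrite /weight !divr_ge0 ?powR_ge0 ?(ltW t0)//.
by rewrite addr_ge0// sqr_ge0.
Qed.

Lemma weight_derive e t : 0 < e -> 0 < t ->
  is_derive t 1 (fun t => e^-1 * atan (t `^ e)) (weight e t).
Proof.
move=> e0 t0.
have h1 : is_derive t 1 (fun t => t `^ e) (e * t `^ (e - 1)) by exact: is_derive1_powR.
have h2 := @is_derive1_comp R (@atan R) (fun t => t `^ e) t _ _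
  (is_derive1_atan (t `^ e)) h1.
have h3 := is_deriveZ e^-1 h2.
apply: is_derive_eq h3 _.
rewrite /weight powRB ?(gt_eqF t0) ?implybT// powRr1 ?ltW// /GRing.scale /=.
have n0 : 1 + (t `^ e) ^+ 2 != 0 by rewrite gt_eqF// ltr_pwDl// sqr_ge0.
by field; rewrite n0 !gt_eqF.
Qed.

Lemma powR_continuous e t : 0 < t -> {for t, continuous (fun t : R => t `^ e)}.
Proof.
move=> t0; apply/differentiable_continuous/derivable1_diffP.
by have [] := is_derive1_powR e t0.
Qed.

Lemma weight_continuous e t : 0 < t -> {for t, continuous (weight e)}.
Proof.
move=> t0; have c := @powR_continuous e t t0.
apply: cvgM; last by apply: cvgV => //; rewrite gt_eqF.
apply: cvgM => //; apply: cvgV; first by rewrite gt_eqF// ltr_pwDl// sqr_ge0.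
by apply: cvgD; [exact: cvg_cst|exact: cvgM].
Qed.

Lemma weight_integrable e : 0 < e -> mu.-integrable half_line (EFin \o weight e).
Proof.
move=> e0.
have mw : measurable_fun half_line (EFin \o weight e).
  apply/measurable_EFinP; apply: continuous_pos_measurable => t.
  exact: weight_continuous.
apply/integrableP; split=> //.
have -> : (\int[mu]_(x in half_line) `|(EFin \o weight e) x| =
    \int[mu]_(x in half_line) (weight e x)%:E)%E.
  apply: eq_integral; move=> t; rewrite inE half_lineE => t0.
  by rewrite /= ger0_norm// weight_ge0.
rewrite half_line_bigcup.
apply: (@le_lt_trans _ _ (e^-1 * pi)%:E); last exact: ltry.
have cv : (\int[mu]_(x in exhaustion n) (weight e x)%:E)%E @[n --> \oo] -->
    (\int[mu]_(x in \bigcup_n exhaustion n) (weight e x)%:E)%E.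
  apply: ge0_nondecreasing_set_cvg_integral => [|n|n|n t /exhaustion_pos t0].
  - exact: exhaustion_nondecreasing.
  - exact: measurable_itv.
  - by apply: measurable_funS mw => // [|t /exhaustion_pos]; rewrite ?half_lineE//; exact: measurable_half_line.
  - by rewrite /= lee_fin weight_ge0.
apply: (cvge_to_le cv); exists 1%N => // n /= n1.
have nn : n.+1%:R^-1 < n.+1%:R :> R.
  apply: (@lt_trans _ _ 1); first by rewrite invf_lt1// ltr1n ltnS.
  by rewrite ltr1n ltnS.
have n0 : 0 < n.+1%:R^-1 :> R by rewrite invr_gt0.
rewrite [leLHS](FTC_pos n0 nn (fun t => @weight_derive e t e0)
  (fun t => @weight_continuous e t)).
rewrite lee_fin -mulrBr ler_pM2l ?invr_gt0//.
have := atan_ltpi2 (n.+1%:R `^ e : R); have := atan_gtNpi2 (n.+1%:R^-1 `^ e : R).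
move: (atan _) (atan _) => x y h1 h2; lra.
Qed.

Lemma dominated_integrable_weight e C f : 0 < e ->
  (forall t, 0 < t -> {for t, continuous f}) ->
  (forall t, 0 < t -> `|f t| <= C * weight e t) ->
  mu.-integrable half_line (EFin \o f).
Proof.
move=> e0 cf fC.
have iw : mu.-integrable half_line (fun t => (C%:E * (weight e t)%:E)%E).
  by apply: integrableZl; [exact: measurable_half_line|exact: weight_integrable].
apply: (le_integrable _ _ _ iw).
- exact: measurable_half_line.
- by apply/measurable_EFinP; apply: continuous_pos_measurable.
move=> t; rewrite half_lineE => t0.
by rewrite /= lee_fin (le_trans (fC _ t0))// ler_norm.
Qed.

Lemma exhaustion_cvg f : mu.-integrable half_line (EFin \o f) ->
  (\int[mu]_(x in exhaustion n) f x)%R @[n --> \oo] -->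
  (\int[mu]_(x in half_line) f x)%R.
Proof.
move=> fi; have mf : measurable_fun half_line (EFin \o f) := measurable_int mu fi.
have mE n : measurable (exhaustion n) by exact: measurable_itv.
have sub n : exhaustion n `<=` half_line.
  by move=> t /exhaustion_pos; rewrite half_lineE.
pose f_ n := EFin \o (f \_ (exhaustion n)).
have [] := @dominated_convergence _ _ R mu half_line measurable_half_line
  f_ (EFin \o f) (fun t => `|(f t)%:E|%E).
- move=> n; rewrite /f_ -restrict_EFin; apply/(measurable_restrict _ (mE n) measurable_half_line).
  by apply: measurable_funS mf => //; exact: measurable_half_line.
- exact: mf.
- apply: aeW => t; rewrite half_lineE => /exhaustionP[N hN].
  apply: cvg_near_cst; exists N => // n /= Nn; rewrite /f_ /= patchE mem_set//.
  by have /subsetPset := exhaustion_nondecreasing Nn; apply.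
- exact: integrable_abse.
- apply: aeW => t n _; rewrite /f_ /= patchE; case: ifP => // _.
  by rewrite normr0 lee_fin.
move=> _ _ cv.
have -> : (fun n => \int[mu]_(x in exhaustion n) f x)%R =
    (fun n => fine (\int[mu]_(x in half_line) f_ n x)).
  apply/funext => n; rewrite /Rintegral; congr fine.
  rewrite /f_ -restrict_EFin -integral_mkcondr.
  by congr (integral _ _ _); apply/esym/setIidPr/sub.
apply: fine_cvg; rewrite fineK//; last by apply: integrable_fin_num => //; exact: measurable_half_line.
Qed.

Definition integrable_pos f := mu.-integrable half_line (EFin \o f).

Definition integral_pos f : R := \int[mu]_(t in half_line) f t.

Lemma integrable_posD f g : integrable_pos f -> integrable_pos g ->
  integrable_pos (fun t => f t + g t) /\
  integral_pos (fun t => f t + g t) = integral_pos f + integral_pos g.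
Proof.
move=> fi gi; split; last by apply: RintegralD => //; exact: measurable_half_line.
by apply: (integrableD _ fi gi); exact: measurable_half_line.
Qed.

Lemma integrable_posZ c f : integrable_pos f ->
  integrable_pos (fun t => c * f t) /\
  integral_pos (fun t => c * f t) = c * integral_pos f.
Proof.
move=> fi; split; last by apply: RintegralZl => //; exact: measurable_half_line.
by apply: (integrableZl _ c fi); exact: measurable_half_line.
Qed.

Lemma integrable_pos0 : integrable_pos (fun=> 0) /\ integral_pos (fun=> 0) = 0.
Proof.
split; first exact: (integrable0 mu half_line).
rewrite /integral_pos Rintegral_cst ?mul0r//; exact: measurable_half_line.
Qed.

Lemma integrable_pos_sum I (r : seq I) (f : I -> R -> R) (c : I -> R) :
  (forall i, integrable_pos (f i) /\ integral_pos (f i) = c i) ->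
  integrable_pos (fun t => \sum_(i <- r) f i t) /\
  integral_pos (fun t => \sum_(i <- r) f i t) = \sum_(i <- r) c i.
Proof.
move=> hf; elim: r => [|i r [IH1 IH2]].
  rewrite big_nil (_ : (fun t => _) = fun=> 0); first exact: integrable_pos0.
  by apply/funext => t; rewrite big_nil.
have [h1 h2] := hf i; have [h3 h4] := integrable_posD h1 IH1.
rewrite big_cons -h2 -IH2 -h4.
rewrite (_ : (fun t => \sum_(j <- i :: r) f j t) =
  fun t => f i t + \sum_(j <- r) f j t)//.
by apply/funext => t; rewrite big_cons.
Qed.

Lemma eq_integral_pos f g : (forall t, 0 < t -> f t = g t) ->
  integral_pos f = integral_pos g.
Proof. by move=> fg; apply: eq_Rintegral => t; rewrite inE half_lineE => /fg. Qed.

Lemma eq_integrable_pos f g : (forall t, 0 < t -> f t = g t) ->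
  integrable_pos f -> integrable_pos g.
Proof.
move=> fg; apply: eq_integrable; first exact: measurable_half_line.
by move=> t; rewrite inE half_lineE => /fg /= ->.
Qed.

Lemma integral_pos_norm f g : integrable_pos f -> integrable_pos g ->
  (forall t, 0 < t -> `|f t| <= g t) -> `|integral_pos f| <= integral_pos g.
Proof.
move=> fi gi fg; apply: le_trans (le_normr_Rintegral _ fi) _.
  exact: measurable_half_line.
apply: le_Rintegral => //; first exact: measurable_half_line.
- exact: (integrable_abse fi).
- by move=> t; rewrite half_lineE => /fg.
Qed.

End HalfLine.
Arguments half_line : clear implicits.
Arguments exhaustion : clear implicits.

(** * Cauchy's theorem in a sector *)

Section ComplexCurves.
Variable R : realType.
Local Notation Re := complex.Re.
Local Notation Im := complex.Im.
Implicit Types (k l : R -> R[i]) (t : R) (c z w : R[i]).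

Lemma cReM z w : Re (z * w) = Re z * Re w - Im z * Im w.
Proof. by case: z w => [a b] [a' b']. Qed.

Lemma cImM z w : Im (z * w) = Re z * Im w + Im z * Re w.
Proof. by case: z w => [a b] [a' b']. Qed.

Lemma cReD z w : Re (z + w) = Re z + Re w. Proof. by case: z w => [a b] [a' b']. Qed.
Lemma cImD z w : Im (z + w) = Im z + Im w. Proof. by case: z w => [a b] [a' b']. Qed.
Lemma cReN z : Re (- z) = - Re z. Proof. by case: z. Qed.
Lemma cImN z : Im (- z) = - Im z. Proof. by case: z. Qed.

Lemma eq_ReIm z w : Re z = Re w -> Im z = Im w -> z = w.
Proof. by case: z w => [a b] [a' b'] /= -> ->. Qed.

Lemma Re_inv z : Re z^-1 = Re z / (Re z ^+ 2 + Im z ^+ 2).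
Proof. by case: z. Qed.

Lemma Im_inv z : Im z^-1 = - (Im z / (Re z ^+ 2 + Im z ^+ 2)).
Proof. by case: z. Qed.

Lemma sqr_ReIm_eq0 z : (Re z ^+ 2 + Im z ^+ 2 == 0) = (z == 0).
Proof.
by case: z => a b /=; rewrite paddr_eq0 ?sqr_ge0// !sqrf_eq0 eq_complex.
Qed.

Definition curve_derive k t c :=
  is_derive t 1 (fun t => Re (k t)) (Re c) /\ is_derive t 1 (fun t => Im (k t)) (Im c).

Lemma curve_derive_cst c t : curve_derive (fun=> c) t 0.
Proof. by split; exact: is_derive_cst. Qed.

Lemma curve_deriveD k l t c c' : curve_derive k t c -> curve_derive l t c' ->
  curve_derive (fun t => k t + l t) t (c + c').
Proof.
move=> [k1 k2] [l1 l2]; split.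
  rewrite cReD (_ : (fun t => _) = (fun t => Re (k t)) + (fun t => Re (l t))).
    exact: is_deriveD.
  by apply/funext => u; rewrite cReD.
rewrite cImD (_ : (fun t => _) = (fun t => Im (k t)) + (fun t => Im (l t))).
  exact: is_deriveD.
by apply/funext => u; rewrite cImD.
Qed.

Lemma curve_deriveM k l t c c' : curve_derive k t c -> curve_derive l t c' ->
  curve_derive (fun t => k t * l t) t (c * l t + k t * c').
Proof.
move=> [k1 k2] [l1 l2]; split.
  rewrite (_ : (fun t => _) = (fun t => Re (k t)) * (fun t => Re (l t)) -
    (fun t => Im (k t)) * (fun t => Im (l t))).
    apply: is_derive_eq (is_deriveB (is_deriveM k1 l1) (is_deriveM k2 l2)) _.
    by rewrite cReD !cReM /GRing.scale /=; ring.
  by apply/funext => u; rewrite cReM.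
rewrite (_ : (fun t => _) = (fun t => Re (k t)) * (fun t => Im (l t)) +
    (fun t => Im (k t)) * (fun t => Re (l t))).
  apply: is_derive_eq (is_deriveD (is_deriveM k1 l2) (is_deriveM k2 l1)) _.
  by rewrite cImD !cImM /GRing.scale /=; ring.
by apply/funext => u; rewrite cImM.
Qed.

Lemma curve_deriveV k t c : k t != 0 -> curve_derive k t c ->
  curve_derive (fun t => (k t)^-1) t (- c / (k t) ^+ 2).
Proof.
move=> k0 [k1 k2].
pose N := (fun t => Re (k t)) * (fun t => Re (k t)) +
          (fun t => Im (k t)) * (fun t => Im (k t)).
have Nt : N t != 0.
  by rewrite /N /= -!expr2 sqr_ReIm_eq0.
have dN := is_deriveD (is_deriveM k1 k1) (is_deriveM k2 k2).
have dV := @is_deriveV R N t _ 1 Nt dN.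
have e0 : Re (k t) ^+ 2 + Im (k t) ^+ 2 != 0 by rewrite sqr_ReIm_eq0.
have fld (a b x y : R) : a ^+ 2 + b ^+ 2 != 0 ->
   Re (- (Complex x y) / (Complex a b) ^+ 2) =
   (x * (b ^+ 2 - a ^+ 2) - y * (2 * a * b)) / (a ^+ 2 + b ^+ 2) ^+ 2 /\
   Im (- (Complex x y) / (Complex a b) ^+ 2) =
   (y * (b ^+ 2 - a ^+ 2) + x * (2 * a * b)) / (a ^+ 2 + b ^+ 2) ^+ 2.
  move=> ab; rewrite cReM cImM Re_inv Im_inv expr2 cReM cImM /=.
  have ab2 : (a * a - b * b) ^+ 2 + (a * b + b * a) ^+ 2 != 0.
    have -> : (a * a - b * b) ^+ 2 + (a * b + b * a) ^+ 2 = (a ^+ 2 + b ^+ 2) ^+ 2 by ring.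
    by rewrite expf_neq0.
  by split; field; rewrite ab ab2.
have [eR eI] := fld (Re (k t)) (Im (k t)) (Re c) (Im c) e0.
have ck : Complex (Re c) (Im c) = c by case: (c).
have kk : Complex (Re (k t)) (Im (k t)) = k t by case: (k t).
rewrite ck kk in eR eI.
split.
  rewrite (_ : (fun t => _) = (fun t => Re (k t)) * (fun t => (N t)^-1)).
    apply: is_derive_eq (is_deriveM k1 dV) _.
    rewrite eR /GRing.scale /= /N !fctE.
    by move: (Re (k t)) (Im (k t)) e0 (Re c) (Im c) => a b ab x y; field; rewrite -?expr2 ab.
  by apply/funext => u; rewrite Re_inv /N /= !expr2.
rewrite (_ : (fun t => _) = - ((fun t => Im (k t)) * (fun t => (N t)^-1))).
  apply: is_derive_eq (is_deriveN (is_deriveM k2 dV)) _.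
  rewrite eI /GRing.scale /= /N !fctE.
  by move: (Re (k t)) (Im (k t)) e0 (Re c) (Im c) => a b ab x y; field; rewrite -?expr2 ab.
by apply/funext => u; rewrite Im_inv /N /= !expr2.
Qed.

End ComplexCurves.

Lemma pair_continuous (S U V : topologicalType) (f : S -> U) (g : S -> V) x :
  {for x, continuous f} -> {for x, continuous g} ->
  {for x, continuous (fun x => (f x, g x))}.
Proof. by move=> cf cg; exact: (cvg_pair cf cg). Qed.

Section Rectangle.
Variable R : realType.
Local Notation mu := (@lebesgue_measure R).

Lemma continuous_pos_integrable (f : R -> R) (a b : R) : 0 < a ->
  (forall t, 0 < t -> {for t, continuous f}) ->
  mu.-integrable `[a, b] (EFin \o f).
Proof.
move=> a0 cf; apply: continuous_compact_integrable; first exact: segment_compact.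
apply: continuous_in_subspaceT => t; rewrite inE /= in_itv/= => /andP[h _].
by apply: cf; exact: lt_le_trans h.
Qed.

(** Green's formula on a rectangle, for a pair with D = dQ/dphi = d(tP)/dt:
    differentiate the integral over the ray in the angle and apply the
    fundamental theorem along the ray. *)
Lemma rectangle_green (Q P D : R -> R -> R) (u0 v0 phi0 phi1 a b M : R) :
  0 < a -> a < b -> u0 < phi0 -> phi0 <= phi1 -> phi1 < v0 ->
  (forall phi t : R, u0 < phi < v0 -> 0 < t -> is_derive phi 1 (Q^~ t) (D phi t)) ->
  (forall phi t : R, u0 < phi < v0 -> 0 < t ->
     is_derive t 1 (fun t => t * P phi t) (D phi t)) ->
  (forall phi t : R, u0 < phi < v0 -> 0 < t -> {for t, continuous (Q phi)}) ->
  (forall phi t : R, u0 < phi < v0 -> 0 < t ->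
     {for (phi, t), continuous (fun p : R * R => D p.1 p.2)}) ->
  (forall phi : R, phi0 <= phi <= phi1 -> `|b * P phi b - a * P phi a| <= M) ->
  `|\int[mu]_(t in `[a, b]) Q phi1 t - \int[mu]_(t in `[a, b]) Q phi0 t|
    <= M * (phi1 - phi0).
Proof.
move=> a0 ab uphi phi01 phiv dQ dP cQ cD hM.
pose u := (u0 + phi0) / 2; pose v := (phi1 + v0) / 2.
have uu : u0 < u by rewrite /u; lra.
have uphi0 : u < phi0 by rewrite /u; lra.
have vphi1 : phi1 < v by rewrite /v; lra.
have vv : v < v0 by rewrite /v; lra.
have b0 : 0 < b := lt_trans a0 ab.
have posB (t : R) : t \in `[a, b] -> 0 < t.
  by rewrite in_itv/= => /andP[h _]; exact: lt_le_trans h.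
have posB' (t : R) : [set` `[a, b]] t -> 0 < t by exact: posB.
have inI (phi : R) : u <= phi <= v -> u0 < phi < v0 by move=> /andP[? ?]; apply/andP; split; lra.
have Duncurry : {within `[u, v]%classic `*` `[a, b]%classic,
    continuous (fun p : R * R => `|D p.1 p.2|)}.
  apply: continuous_in_subspaceT => -[phi t]; rewrite inE /= => -[].
  rewrite /= in_itv/= => hphi /posB' t0.
  apply: (@continuous_comp _ _ _ (fun p : R * R => D p.1 p.2) Num.norm).
    exact: cD (inI _ hphi) t0.
  exact: norm_continuous.
have cpt : compact (`[u, v]%classic `*` `[a, b]%classic : set (R * R)).
  exact: (compact_setX (@segment_compact R u v) (@segment_compact R a b)).
have ne : (`[u, v]%classic `*` `[a, b]%classic : set (R * R)) !=set0.
  by exists (u, a); split; rewrite /= in_itv/=; apply/andP; split; lra.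
have [c _ hc] := compact_EVT_max ne cpt Duncurry.
set G := `|D c.1 c.2| in hc.
have Dbnd (phi t : R) : u <= phi <= v -> t \in `[a, b] -> `|D phi t| <= G.
  by move=> hphi ht; apply: (hc (phi, t)); rewrite inE; split; rewrite //= in_itv.
pose F phi := \int[mu]_(t in `[a, b]) Q phi t.
have intQ (phi : R) : u0 < phi < v0 -> mu.-integrable `[a, b] (EFin \o Q phi).
  by move=> hphi; apply: continuous_pos_integrable => // t; exact: cQ.
have itvI (phi : R) : [set` `]u, v[] phi -> u0 < phi < v0.
  by rewrite /= in_itv/= => /andP[h1 h2]; apply: inI; rewrite !ltW.
have d1 (phi t : R) : u0 < phi < v0 -> 0 < t -> partial1of2 Q phi t = D phi t.
  move=> hphi t0; have := dQ phi t hphi t0 => ?.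
  by rewrite partial1of2E derive_val.
have dF (phi : R) : u < phi < v -> is_derive phi 1 F (b * P phi b - a * P phi a).
  move=> hphi; have Iphi : [set` `]u, v[] phi by rewrite /= in_itv.
  have int' x : [set` `]u, v[] x -> mu.-integrable `[a, b] (EFin \o Q x).
    by move=> /itvI; exact: intQ.
  have der' x t : [set` `]u, v[] x -> [set` `[a, b]] t -> derivable (Q^~ t) x 1.
    by move=> /itvI hx /posB' t0; have [] := dQ x t hx t0.
  have intG : mu.-integrable `[a, b] (EFin \o (fun=> G)).
    by apply: continuous_pos_integrable => // t _; exact: cst_continuous.
  have bnd' x t : [set` `]u, v[] x -> [set` `[a, b]] t -> `|partial1of2 Q x t| <= G.
    move=> Ix It; rewrite d1; [|exact: itvI|exact: posB'].
    by apply: Dbnd => //; move: Ix; rewrite /= in_itv/= => /andP[/ltW -> /ltW ->].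
  have mB : measurable [set` `[a, b]] by exact: measurable_itv.
  have G0 : forall t : R, 0 <= (fun=> G) t by move=> t; exact: normr_ge0.
  apply: DeriveDef.
    have := @derivable_under_integral R _ _ mu Q _ mB phi u v Iphi int' der' (fun=> G) G0 intG bnd'.
    exact.
  rewrite -derive1E (_ : F^`()%classic phi =
      \int[mu]_(t in `[a, b]) (partial1of2 Q ^~ t) phi); last first.
    exact: (@differentiation_under_integral R _ _ mu Q _ mB phi u v Iphi int' der'
      (fun=> G) G0 intG bnd').
  rewrite (@eq_Rintegral _ _ _ mu _ (D phi)); last first.
    by move=> t; rewrite inE => /posB' t0; rewrite d1//; exact: itvI.
  have dP' (t : R) : 0 < t -> is_derive t 1 (fun t => t * P phi t) (D phi t).
    by move=> t0; apply: dP => //; exact: itvI.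
  have cD' (t : R) : 0 < t -> {for t, continuous (D phi)}.
    move=> t0.
    apply: (@continuous_comp _ _ _ (fun t => (phi, t)) (fun p : R * R => D p.1 p.2)).
      by apply: pair_continuous; [exact: cst_continuous|exact: cvg_id].
    by apply: cD => //; exact: itvI.
  by rewrite /Rintegral [X in fine X](FTC_pos a0 ab dP' cD').
have uv (phi : R) : phi0 <= phi <= phi1 -> u < phi < v.
  by move=> /andP[? ?]; apply/andP; split; lra.
have [|||c' hc' ->] := @MVT_segment R F (fun phi => b * P phi b - a * P phi a) phi0 phi1.
- exact: phi01.
- by move=> x /subset_itv_oo_cc; rewrite in_itv/= => hx; apply/dF/uv.
- apply: continuous_in_subspaceT => x; rewrite inE /= in_itv/= => /uv hx.
  apply/differentiable_continuous/derivable1_diffP.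
  by have [] := dF x hx.
rewrite normrM (ger0_norm (x := phi1 - phi0)) ?subr_ge0// ler_wpM2r ?subr_ge0//.
by apply: hM; move: hc'; rewrite in_itv.
Qed.

End Rectangle.

Section SectorCauchy.
Variable R : realType.
Local Notation mu := (@lebesgue_measure R).
Local Notation Re := complex.Re.
Local Notation Im := complex.Im.
Implicit Types (h k : R -> R -> R[i]) (t e : R) (c z w : R[i]).

Definition cis (phi : R) : R[i] := Complex (cos phi) (sin phi).

Definition polar (phi t : R) : R[i] := Complex (t * cos phi) (t * sin phi).

Definition complex_continuous h (phi t : R) :=
  {for (phi, t), continuous (fun p : R * R => Re (h p.1 p.2))} /\
  {for (phi, t), continuous (fun p : R * R => Im (h p.1 p.2))}.

(** Holomorphic functions of z = t e^(i phi) on the sector u < phi < v, given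
    in polar coordinates together with their complex derivative [h']: the two
    partial derivatives are h'(z) dz/dt and h'(z) dz/dphi. *)
Definition holomorphic (u v : R) h h' := forall phi t, u < phi < v -> 0 < t ->
  [/\ curve_derive (h phi) t (h' phi t * cis phi),
      curve_derive (h^~ t) phi (h' phi t * (Complex 0 t * cis phi)),
      complex_continuous h phi t & complex_continuous h' phi t].

Lemma complex_continuous_cst c phi t : complex_continuous (fun _ _ => c) phi t.
Proof. by split; exact: cst_continuous. Qed.

Lemma complex_continuousD h k phi t : complex_continuous h phi t ->
  complex_continuous k phi t -> complex_continuous (fun phi t => h phi t + k phi t) phi t.
Proof.
move=> [h1 h2] [k1 k2]; split.
  rewrite (_ : (fun p : R * R => _) =
    (fun p : R * R => Re (h p.1 p.2)) + (fun p : R * R => Re (k p.1 p.2))).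
    exact: cvgD.
  by apply/funext => p; rewrite cReD.
rewrite (_ : (fun p : R * R => _) =
    (fun p : R * R => Im (h p.1 p.2)) + (fun p : R * R => Im (k p.1 p.2))).
  exact: cvgD.
by apply/funext => p; rewrite cImD.
Qed.

Lemma complex_continuousM h k phi t : complex_continuous h phi t ->
  complex_continuous k phi t -> complex_continuous (fun phi t => h phi t * k phi t) phi t.
Proof.
move=> [h1 h2] [k1 k2]; split.
  rewrite (_ : (fun p : R * R => _) =
    (fun p : R * R => Re (h p.1 p.2) * Re (k p.1 p.2) - Im (h p.1 p.2) * Im (k p.1 p.2))).
    by apply: cvgB; apply: cvgM.
  by apply/funext => p; rewrite cReM.
rewrite (_ : (fun p : R * R => _) =
    (fun p : R * R => Re (h p.1 p.2) * Im (k p.1 p.2) + Im (h p.1 p.2) * Re (k p.1 p.2))).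
  by apply: cvgD; apply: cvgM.
by apply/funext => p; rewrite cImM.
Qed.

Lemma complex_continuousV h phi t : h phi t != 0 -> complex_continuous h phi t ->
  complex_continuous (fun phi t => (h phi t)^-1) phi t.
Proof.
move=> h0 [h1 h2].
have n0 : Re (h phi t) ^+ 2 + Im (h phi t) ^+ 2 != 0 by rewrite sqr_ReIm_eq0.
have cN : {for (phi, t), continuous (fun p : R * R =>
    (Re (h p.1 p.2) ^+ 2 + Im (h p.1 p.2) ^+ 2)^-1)}.
  apply: cvgV => //; apply: cvgD; [exact: (cvgM h1 h1)|exact: (cvgM h2 h2)].
split.
  rewrite (_ : (fun p : R * R => _) = (fun p : R * R => Re (h p.1 p.2) *
     (Re (h p.1 p.2) ^+ 2 + Im (h p.1 p.2) ^+ 2)^-1)); first exact: cvgM.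
  by apply/funext => p; rewrite Re_inv.
rewrite (_ : (fun p : R * R => _) = (fun p : R * R => - (Im (h p.1 p.2) *
     (Re (h p.1 p.2) ^+ 2 + Im (h p.1 p.2) ^+ 2)^-1))).
  by apply: cvgN; exact: cvgM.
by apply/funext => p; rewrite Im_inv.
Qed.

Lemma curve_derive_eq (k : R -> R[i]) t c c' : c = c' -> curve_derive k t c ->
  curve_derive k t c'.
Proof. by move=> ->. Qed.

Lemma holomorphic_cst u v c : holomorphic u v (fun _ _ => c) (fun _ _ => 0).
Proof.
move=> phi t _ _; rewrite !mul0r.
by split; try exact: curve_derive_cst; exact: complex_continuous_cst.
Qed.

Lemma holomorphicD u v h h' k k' : holomorphic u v h h' -> holomorphic u v k k' ->
  holomorphic u v (fun phi t => h phi t + k phi t) (fun phi t => h' phi t + k' phi t).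
Proof.
move=> hh hk phi t Iphi t0; have [h1 h2 h3 h4] := hh phi t Iphi t0.
have [k1 k2 k3 k4] := hk phi t Iphi t0.
by split; [rewrite mulrDl; exact: curve_deriveD|rewrite mulrDl; exact: curve_deriveD|
  exact: complex_continuousD|exact: complex_continuousD].
Qed.

Lemma holomorphicM u v h h' k k' : holomorphic u v h h' -> holomorphic u v k k' ->
  holomorphic u v (fun phi t => h phi t * k phi t)
    (fun phi t => h' phi t * k phi t + h phi t * k' phi t).
Proof.
move=> hh hk phi t Iphi t0; have [h1 h2 h3 h4] := hh phi t Iphi t0.
have [k1 k2 k3 k4] := hk phi t Iphi t0; split.
- by apply: curve_derive_eq (curve_deriveM h1 k1); ring.
- by apply: curve_derive_eq (curve_deriveM h2 k2); ring.
- exact: complex_continuousM.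
- by apply: complex_continuousD; exact: complex_continuousM.
Qed.

Lemma holomorphicV u v h h' :
  (forall phi t, u < phi < v -> 0 < t -> h phi t != 0) -> holomorphic u v h h' ->
  holomorphic u v (fun phi t => (h phi t)^-1)
    (fun phi t => - h' phi t * ((h phi t) ^-1 * (h phi t) ^-1)).
Proof.
move=> h0 hh phi t Iphi t0; have [h1 h2 h3 h4] := hh phi t Iphi t0.
have hn0 := h0 phi t Iphi t0; split.
- by apply: curve_derive_eq (curve_deriveV hn0 h1); field.
- by apply: curve_derive_eq (curve_deriveV hn0 h2); field.
- exact: complex_continuousV.
- apply: complex_continuousM; last by apply: complex_continuousM; exact: complex_continuousV.
  have := complex_continuousM (complex_continuous_cst (-1) phi t) h4.
  by congr complex_continuous; apply/funext => p; apply/funext => s; rewrite mulN1r.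
Qed.

Lemma holomorphic_sum u v I (r : seq I) (h h' : I -> R -> R -> R[i]) :
  (forall i, holomorphic u v (h i) (h' i)) ->
  holomorphic u v (fun phi t => \sum_(i <- r) h i phi t)
                  (fun phi t => \sum_(i <- r) h' i phi t).
Proof.
move=> hh; elim: r => [|i r IHr].
  rewrite (_ : (fun phi t => _) = (fun _ _ => 0)); last first.
    by apply/funext => p; apply/funext => s; rewrite big_nil.
  rewrite (_ : (fun phi t => \sum_(i <- [::]) h' i phi t) = (fun _ _ => 0)); last first.
    by apply/funext => p; apply/funext => s; rewrite big_nil.
  exact: holomorphic_cst.
have := holomorphicD (hh i) IHr.
by congr holomorphic; apply/funext => p; apply/funext => s; rewrite big_cons.
Qed.

Lemma curve_derive_cis phi : curve_derive cis phi (Complex 0 1 * cis phi).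
Proof.
split; rewrite /= ?mul0r ?mul1r ?sub0r ?add0r; first exact: is_derive_cos.
exact: is_derive_sin.
Qed.

Lemma continuous_fst_comp (f : R -> R) (p : R * R) : {for p.1, continuous f} ->
  {for p, continuous (fun p : R * R => f p.1)}.
Proof.
move=> cf; apply: (@continuous_comp _ _ _ (@fst R R) f p) cf.
by case: p => x y; exact: cvg_fst.
Qed.

Lemma continuous_snd_comp (f : R -> R) (p : R * R) : {for p.2, continuous f} ->
  {for p, continuous (fun p : R * R => f p.2)}.
Proof.
move=> cf; apply: (@continuous_comp _ _ _ (@snd R R) f p) cf.
by case: p => x y; exact: cvg_snd.
Qed.

Lemma holomorphic_id u v : holomorphic u v polar (fun _ _ => 1).
Proof.
move=> phi t _ _; split.
- rewrite mul1r; split; rewrite /polar /=.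
    by apply: is_derive_eq; rewrite scaler0 add0r /GRing.scale /= mulr1.
  by apply: is_derive_eq; rewrite scaler0 add0r /GRing.scale /= mulr1.
- have h1 := is_derive_cos phi; have h2 := is_derive_sin phi.
  split; rewrite /polar /= ?mul1r ?mul0r ?sub0r ?add0r ?subr0 ?addr0.
    by apply: (is_derive_eq (is_deriveZ t h1)); rewrite /GRing.scale /= mulrN.
  by apply: (is_derive_eq (is_deriveZ t h2)).
- by split; apply: cvgM; try exact: (@continuous_snd_comp id (phi, t)) (cvg_id);
   [apply: (@continuous_fst_comp _ (phi, t)); exact: continuous_cos|
    apply: (@continuous_fst_comp _ (phi, t)); exact: continuous_sin].
- exact: complex_continuous_cst.
Qed.

Definition ray_integral h (phi : R) : R :=
  \int[mu]_(t in half_line R) Im (h phi t * cis phi).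

Lemma complex_continuous_radial h phi t : complex_continuous h phi t ->
  {for t, continuous (fun t => Im (h phi t * cis phi))} /\
  {for t, continuous (fun t => Re (h phi t * cis phi))}.
Proof.
move=> [h1 h2].
have c1 : {for t, continuous (fun t => Re (h phi t))}.
  apply: (@continuous_comp _ _ _ (fun t : R => (phi, t)) (fun p : R * R => Re (h p.1 p.2))) => //.
  by apply: pair_continuous; [exact: cst_continuous|exact: cvg_id].
have c2 : {for t, continuous (fun t => Im (h phi t))}.
  apply: (@continuous_comp _ _ _ (fun t : R => (phi, t)) (fun p : R * R => Im (h p.1 p.2))) => //.
  by apply: pair_continuous; [exact: cst_continuous|exact: cvg_id].
split.
  rewrite (_ : (fun t => _) = (fun t => Re (h phi t) * sin phi + Im (h phi t) * cos phi)).
    by apply: cvgD; apply: cvgM => //; exact: cvg_cst.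
  by apply/funext => s; rewrite cImM.
rewrite (_ : (fun t => _) = (fun t => Re (h phi t) * cos phi - Im (h phi t) * sin phi)).
  by apply: cvgB; apply: cvgM => //; exact: cvg_cst.
by apply/funext => s; rewrite cReM.
Qed.

Lemma cis_bound z phi B : `|Re z| <= B -> `|Im z| <= B ->
  `|Im (z * cis phi)| <= 2 * B /\ `|Re (z * cis phi)| <= 2 * B.
Proof.
move=> h1 h2; rewrite cImM cReM /=.
have hc : `|cos phi| <= 1 := cos_max phi.
have hs : `|sin phi| <= 1 by rewrite ler_norml sin_geN1 sin_le1.
have bd x y : `|x| <= B -> `|y| <= 1 -> `|x * y| <= B.
  by move=> hx hy; rewrite normrM -[B]mulr1 ler_pM.
rewrite [2 * B]mulr_natl mulr2n; split.
  by apply: le_trans (ler_normD _ _) _; apply: lerD; exact: bd.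
by apply: le_trans (ler_normB _ _) _; apply: lerD; exact: bd.
Qed.

Lemma holomorphic_integrable u v h h' phi e C : holomorphic u v h h' ->
  u < phi < v -> 0 < e ->
  (forall t, 0 < t -> `|Re (h phi t)| <= C * weight e t /\ `|Im (h phi t)| <= C * weight e t) ->
  mu.-integrable (half_line R) (EFin \o (fun t => Im (h phi t * cis phi))).
Proof.
move=> hh Iphi e0 hC; apply: (@dominated_integrable_weight R e (2 * C)) => // t t0.
  by have [_ _ /complex_continuous_radial[? _] _] := hh phi t Iphi t0.
have [h1 h2] := hC t t0; rewrite -mulrA.
by have [] := cis_bound phi h1 h2.
Qed.

Lemma weight_vanishes e d : 0 < e -> 0 < d -> exists N, forall n, (N <= n)%N ->
  n.+1%:R * weight e n.+1%:R <= d /\ n.+1%:R^-1 * weight e n.+1%:R^-1 <= d :> R.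
Proof.
move=> e0 d0; pose d' := d `^ e^-1; have d'0 : 0 < d' by exact: powR_gt0.
have [N _ hN] := near_infty_natSinv_lt (PosNum d'0).
exists N => n Nn; have {}hN : n.+1%:R^-1 < d' by exact: hN.
set a := n.+1%:R^-1 : R; have a0 : 0 < a by rewrite invr_gt0.
have -> : n.+1%:R = a^-1 :> R by rewrite /a invrK.
have ae : a `^ e <= d.
  apply: (@le_trans _ _ (d' `^ e)); last first.
    by rewrite /d' -powRrM mulVf ?gt_eqF// powRr1// ltW.
  by apply: ge0_ler_powR; rewrite ?nnegrE ?ltW.
have pe0 : 0 < a `^ e by exact: powR_gt0.
have tw t : 0 < t -> t * weight e t = t `^ e / (1 + (t `^ e) ^+ 2).
  by move=> t0; rewrite /weight mulrC divfK// gt_eqF.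
rewrite !tw ?invr_gt0//; split; apply: le_trans ae.
  rewrite -(powR_inv1 (ltW a0)) -powRrM mulN1r powRN.
  rewrite ler_pdivrMr ?ltr_pwDl ?sqr_ge0// mulrDr mulr1 exprVn expr2 invfM mulrA.
  by rewrite divff ?gt_eqF// mul1r lerDr ltW.
rewrite ler_pdivrMr ?ltr_pwDl ?sqr_ge0//.
by rewrite mulrDr mulr1 lerDl mulr_ge0 ?sqr_ge0// ltW.
Qed.

(** Cauchy's theorem: the integral of Im (h dz) along a ray of the sector does
    not depend on the ray; arcs contribute nothing because t |h| tends to 0 at
    both ends. *)
Lemma sector_cauchy u v phi0 phi1 e C h h' : holomorphic u v h h' ->
  u < phi0 -> phi0 <= phi1 -> phi1 < v -> 0 < e -> 0 <= C ->
  (forall phi t, phi0 <= phi <= phi1 -> 0 < t ->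
     `|Re (h phi t)| <= C * weight e t /\ `|Im (h phi t)| <= C * weight e t) ->
  ray_integral h phi0 = ray_integral h phi1.
Proof.
move=> hh u0 phi01 v1 e0 C0 hC.
pose Q phi t := Im (h phi t * cis phi).
pose P phi t := Re (h phi t * cis phi).
pose Dc phi t : R[i] := h' phi t * (Complex 0 t * cis phi) * cis phi +
   h phi t * (Complex 0 1 * cis phi).
pose D phi t := Im (Dc phi t).
have inI phi : phi0 <= phi <= phi1 -> u < phi < v.
  by move=> /andP[? ?]; apply/andP; split; lra.
have I0 : phi0 <= phi0 <= phi1 by rewrite lexx.
have I1 : phi0 <= phi1 <= phi1 by rewrite lexx andbT.
have dQ (phi t : R) : u < phi < v -> 0 < t -> is_derive phi 1 (Q^~ t) (D phi t).
  move=> Iphi t0; have [_ h2 _ _] := hh phi t Iphi t0.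
  by have [] := curve_deriveM h2 (curve_derive_cis phi).
have dP (phi t : R) : u < phi < v -> 0 < t ->
    is_derive t 1 (fun t => t * P phi t) (D phi t).
  move=> Iphi t0; have [h1 _ _ _] := hh phi t Iphi t0.
  have dt : curve_derive (fun t => Complex t 0) t 1.
    by split; [exact: is_derive_id|exact: is_derive_cst].
  have [+ _] := curve_deriveM dt (curve_deriveM h1 (curve_derive_cst (cis phi) t)).
  rewrite (_ : (fun t => _) = (fun t => t * P phi t)); last first.
    by apply/funext => s; rewrite cReM /= mul0r subr0.
  move=> d1; apply: is_derive_eq d1 _; rewrite /D /Dc.
  move: (h phi t) (h' phi t) (cis phi) => [a b] [a' b'] [x y] /=.
  by ring.
have cQ (phi t : R) : u < phi < v -> 0 < t -> {for t, continuous (Q phi)}.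
  by move=> Iphi t0; have [_ _ /complex_continuous_radial[? _] _] := hh phi t Iphi t0.
have cD (phi t : R) : u < phi < v -> 0 < t ->
    {for (phi, t), continuous (fun p : R * R => D p.1 p.2)}.
  move=> Iphi t0; have [_ _ h3 h4] := hh phi t Iphi t0.
  have ccis : complex_continuous (fun phi _ => cis phi) phi t.
    split; apply: (@continuous_fst_comp _ (phi, t)); first exact: continuous_cos.
    exact: continuous_sin.
  have cit : complex_continuous (fun _ t => Complex 0 t) phi t.
    split; first exact: cst_continuous.
    exact: (@continuous_snd_comp id (phi, t)) (cvg_id).
  have [] // := complex_continuousD (complex_continuousM (complex_continuousM h4
    (complex_continuousM cit ccis)) ccis)
    (complex_continuousM h3 (complex_continuousM (complex_continuous_cst (Complex 0 1) phi t) ccis)).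
pose J (phi : R) n := \int[mu]_(t in exhaustion R n) Q phi t.
have bnd d : 0 < d -> \forall n \near \oo, `|J phi1 n - J phi0 n| <= d.
  move=> d0; pose k := 4 * (C + 1) * (phi1 - phi0 + 1).
  have k0 : 0 < k by rewrite !mulr_gt0// ?ltr_wpDl// subr_ge0.
  have [N hN] := weight_vanishes e0 (divr_gt0 d0 k0).
  exists (maxn N 1) => // n /=; rewrite geq_max => /andP[Nn n1].
  have [hb ha] := hN n Nn.
  have nn : n.+1%:R^-1 < n.+1%:R :> R.
    by apply: (@lt_trans _ _ 1); rewrite ?invf_lt1// ltr1n ltnS.
  have n0 : 0 < n.+1%:R^-1 :> R by rewrite invr_gt0.
  apply: le_trans (rectangle_green n0 nn u0 phi01 v1 dQ dP cQ cD
    (M := 4 * (C + 1) * (d / k)) _) _; last first.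
    have q0 : 0 <= 4 * (C + 1) * (d / k).
      by apply: mulr_ge0; [rewrite mulr_ge0// addr_ge0|rewrite divr_ge0// ltW].
    have dk : k * (d / k) = d by rewrite mulrC divfK ?gt_eqF.
    rewrite -[leRHS]dk -subr_ge0.
    have -> : k * (d / k) - 4 * (C + 1) * (d / k) * (phi1 - phi0) =
        4 * (C + 1) * (d / k) by rewrite {1}/k; ring.
    exact: q0.
  move=> phi Iphi; apply: le_trans (ler_normB _ _) _.
  have Pb t : 0 < t -> t * weight e t <= d / k -> `|t * P phi t| <= 2 * (C + 1) * (d / k).
    move=> t0 hw; have [h1 h2] := hC phi t Iphi t0.
    have [_ h3] := cis_bound phi h1 h2.
    rewrite normrM gtr0_norm//; apply: (@le_trans _ _ (2 * C * (t * weight e t))).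
      have -> : 2 * C * (t * weight e t) = t * (2 * (C * weight e t)) by ring.
      by rewrite ler_pM2l.
    apply: (@le_trans _ _ (2 * C * (d / k))); first by rewrite ler_wpM2l// mulr_ge0.
    by rewrite ler_wpM2r ?divr_ge0// ?(ltW d0) ?(ltW k0)// ler_pM2l// lerDl.
  have := Pb _ (ltr0Sn R n) hb; have := Pb _ n0 ha.
  move: (`|_|) (`|_|) (d / k) => x y z ? ?; lra.
have cvJ phi : phi0 <= phi <= phi1 -> J phi n @[n --> \oo] --> ray_integral h phi.
  move=> Iphi; apply: exhaustion_cvg.
  by apply: (holomorphic_integrable hh (inI _ Iphi) e0) => t; exact: hC.
apply/esym/eqP; rewrite -subr_eq0 -normr_eq0 eq_le normr_ge0 andbT.
apply/ler_addgt0Pr => d d0; rewrite add0r.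
apply: (cvgr_to_le _ (bnd d d0)); apply: cvg_norm; apply: cvgB; exact: cvJ.
Qed.

End SectorCauchy.

(** * Slice functions are holomorphic in polar coordinates *)

Section ChainRule.
Variable R : realType.
Implicit Types (f g rho : R -> R) (t : R) (p q : R * R).

Lemma quotE f t : (fun h : R => h^-1 *: ((f \o shift t) (h *: 1) - f t)) =
  (fun h => h^-1 * (f (h + t) - f t)).
Proof. by apply/funext => h; rewrite /= /GRing.scale /= mulr1. Qed.

Lemma is_derive_quot f t l :
  (h^-1 * (f (h + t) - f t) @[h --> 0^'] --> l) -> is_derive t 1 f l.
Proof.
rewrite -quotE => cv.
by apply: DeriveDef; [apply/cvg_ex; exists l|exact: cvg_lim cv].
Qed.

Lemma derive_quot f t l : is_derive t 1 f l ->
  h^-1 * (f (h + t) - f t) @[h --> 0^'] --> l.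
Proof. by move=> [df <-]; rewrite -quotE; exact: df. Qed.

Lemma shift_cvg0 t : (h + t) @[h --> (0 : R)] --> t.
Proof.
have : (h + t) @[h --> (0 : R)] --> 0 + t by apply: cvgD; [exact: cvg_id|exact: cvg_cst].
by rewrite add0r.
Qed.

Lemma shift_cvg rho t : {for t, continuous rho} ->
  rho (h + t) @[h --> 0^'] --> rho t.
Proof.
move=> crho; apply: cvg_within_filter => A /crho hA.
exact: shift_cvg0 hA.
Qed.

Lemma caratheodory_derive f g1 g2 rho1 rho2 t a b :
  (\forall s \near t, f s - f t = (g1 s - g1 t) * rho1 s + (g2 s - g2 t) * rho2 s) ->
  is_derive t 1 g1 a -> is_derive t 1 g2 b ->
  {for t, continuous rho1} -> {for t, continuous rho2} ->
  is_derive t 1 f (a * rho1 t + b * rho2 t).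
Proof.
move=> hf /derive_quot d1 /derive_quot d2 c1 c2; apply: is_derive_quot.
have cv : h^-1 * (g1 (h + t) - g1 t) * rho1 (h + t) +
   h^-1 * (g2 (h + t) - g2 t) * rho2 (h + t) @[h --> 0^'] -->
   a * rho1 t + b * rho2 t.
  by apply: cvgD; apply: cvgM => //; exact: shift_cvg.
apply: cvg_trans cv; apply: near_eq_cvg.
have near0 : \forall h \near 0^', f (h + t) - f t =
    (g1 (h + t) - g1 t) * rho1 (h + t) + (g2 (h + t) - g2 t) * rho2 (h + t).
  apply: nbhs_dnbhs.
  exact: (shift_cvg0 hf).
apply: filterS near0 => h ->; ring.
Qed.

Lemma mvt_between (f f' : R -> R) (a b : R) :
  (forall x, `|x - a| <= `|b - a| -> is_derive x 1 f (f' x)) ->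
  exists x, `|x - a| <= `|b - a| /\ f b - f a = f' x * (b - a).
Proof.
have wc (c d : R) : (forall x : R, x \in `[c, d] -> is_derive x 1 f (f' x)) ->
    {within `[c, d], continuous f}.
  move=> df; apply: continuous_in_subspaceT => x; rewrite inE /= => /df[dx _].
  exact/differentiable_continuous/derivable1_diffP.
move=> df; have [ab|/ltW ba] := lerP a b.
  have df' (x : R) : x \in `[a, b] -> is_derive x 1 f (f' x).
    rewrite in_itv/= => /andP[ax xb]; apply: df.
    by rewrite !ger0_norm ?subr_ge0// lerD2r.
  have [x hx ->] := MVT_segment ab (fun x hx => df' x (subset_itv_oo_cc hx)) (wc _ _ df').
  exists x; split=> //; move: hx; rewrite in_itv/= => /andP[ax xb].
  by rewrite !ger0_norm ?subr_ge0// lerD2r.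
have df' (x : R) : x \in `[b, a] -> is_derive x 1 f (f' x).
  rewrite in_itv/= => /andP[ax xb]; apply: df.
  by rewrite !ler0_norm ?subr_le0//; lra.
have [x hx e] := MVT_segment ba (fun x hx => df' x (subset_itv_oo_cc hx)) (wc _ _ df').
exists x; split; last by rewrite -opprB e -mulrN opprB.
move: hx; rewrite in_itv/= => /andP[ax xb].
by rewrite !ler0_norm ?subr_le0//; lra.
Qed.

Lemma prod_continuousP (F : R * R -> R) p : {for p, continuous F} <->
  forall e, 0 < e -> exists2 d, 0 < d & forall q,
    `|q.1 - p.1| < d -> `|q.2 - p.2| < d -> `|F q - F p| < e.
Proof.
split=> [/cvgrPdist_lt cF e e0|h].
  have /nbhs_ballP[d /= d0 hd] := cF e e0; exists d => // q q1 q2.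
  by rewrite distrC; apply: hd; split; rewrite -ball_normE /= distrC.
apply/cvgrPdist_lt => e e0; have [d d0 hd] := h e e0.
apply: (@filterS _ (nbhs p) _ (ball p d)) => [q [q1 q2]|]; last exact: nbhsx_ballx.
by rewrite /= distrC; apply: hd; rewrite distrC; [move: q1|move: q2]; rewrite -ball_normE.
Qed.

(** Hadamard's form of total differentiability: continuous partial derivatives
    near [p] give an increment factorization with continuous factors. *)
Lemma hadamard (g gx gy : R * R -> R) p :
  nbhs p [set q : R * R | is_derive q.1 1 (fun x : R => g (x, q.2)) (gx q) /\
     is_derive q.2 1 (fun y : R => g (q.1, y)) (gy q)] ->
  {for p, continuous gx} -> {for p, continuous gy} ->
  exists rho1 rho2 : R * R -> R, [/\ {for p, continuous rho1}, {for p, continuous rho2},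
    rho1 p = gx p, rho2 p = gy p & forall q,
     g q - g p = (q.1 - p.1) * rho1 q + (q.2 - p.2) * rho2 q].
Proof.
move=> /nbhs_ballP[d0 /= d00 hd0] /prod_continuousP cx /prod_continuousP cy.
have inB q : `|q.1 - p.1| < d0 -> `|q.2 - p.2| < d0 -> ball p d0 q.
  by move=> h1 h2; split; rewrite -ball_normE /= distrC.
pose rho1 q := if q.1 == p.1 then gx p else (g q - g (p.1, q.2)) / (q.1 - p.1).
pose rho2 q := if q.2 == p.2 then gy p else (g (p.1, q.2) - g p) / (q.2 - p.2).
exists rho1, rho2; split.
- apply/prod_continuousP => e e0; have [d d_0 hd] := cx e e0.
  exists (Num.min d d0); first by rewrite lt_min d_0.
  move=> q; rewrite !lt_min => /andP[h1 h1'] /andP[h2 h2'].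
  rewrite /rho1 eqxx; case: eqP => [_|/eqP ne]; first by rewrite subrr normr0.
  have [x|x [hx e1]] := @mvt_between (fun x => g (x, q.2)) (fun x => gx (x, q.2)) p.1 q.1.
    move=> hx; have [] // := hd0 (x, q.2) (inB (x, q.2) _ h2').
    exact: le_lt_trans hx h1'.
  have -> : g q = g (q.1, q.2) by case: (q).
  rewrite e1 mulfK ?subr_eq0//; apply: hd => //=.
  exact: le_lt_trans hx h1.
- apply/prod_continuousP => e e0; have [d d_0 hd] := cy e e0.
  exists (Num.min d d0); first by rewrite lt_min d_0.
  move=> q; rewrite !lt_min => /andP[h1 h1'] /andP[h2 h2'].
  rewrite /rho2 eqxx; case: eqP => [_|/eqP ne]; first by rewrite subrr normr0.
  have [y|y [hy e1]] := @mvt_between (fun y => g (p.1, y)) (fun y => gy (p.1, y)) p.2 q.2.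
    move=> hy; have [] // := hd0 (p.1, y) (inB (p.1, y) _ _).
      by rewrite subrr normr0.
    exact: le_lt_trans hy h2'.
  have -> : g p = g (p.1, p.2) by case: (p).
  rewrite e1 mulfK ?subr_eq0//; apply: hd => /=; first by rewrite subrr normr0.
  exact: le_lt_trans hy h2.
- by rewrite /rho1 eqxx.
- by rewrite /rho2 eqxx.
- move=> q; rewrite /rho1 /rho2.
  have [e1|n1] := eqVneq q.1 p.1; have [e2|n2] := eqVneq q.2 p.2.
  + have -> : q = p by case: q p e1 e2 {inB hd0 cx cy rho1 rho2} => [? ?] [? ?] /= -> ->.
    by rewrite !subrr !mul0r addr0.
  + have -> : g q = g (p.1, q.2) by rewrite -e1; case: (q).
    rewrite e1 subrr mul0r add0r. by field; rewrite subr_eq0.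
  + have -> : g (p.1, q.2) = g p by rewrite e2; case: (p).
    by rewrite e2 subrr mul0r addr0; field; rewrite subr_eq0.
  + by field; rewrite !subr_eq0 n1 n2.
Qed.

Lemma increment_continuous (g rho1 rho2 : R * R -> R) p :
  {for p, continuous rho1} -> {for p, continuous rho2} ->
  (forall q, g q - g p = (q.1 - p.1) * rho1 q + (q.2 - p.2) * rho2 q) ->
  {for p, continuous g}.
Proof.
move=> c1 c2 hr.
have cv : (q.1 - p.1) * rho1 q + (q.2 - p.2) * rho2 q + g p @[q --> p] -->
    (p.1 - p.1) * rho1 p + (p.2 - p.2) * rho2 p + g p.
  apply: cvgD; last exact: cvg_cst.
  apply: cvgD; apply: cvgM => //; apply: cvgB; try exact: cvg_cst.
    exact: cvg_fst.
  exact: cvg_snd.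
move: cv; rewrite -hr subrK /prop_for /continuous_at.
by under eq_fun do rewrite -hr subrK.
Qed.

End ChainRule.

Section SliceHolomorphic.
Variables (R : realType) (d : nat).
Local Notation Cl := (clifford R d).
Implicit Types (t phi theta : R) (p q : R * R) (A : {set 'I_d}).

Definition polar_pair phi t : R * R := (t * cos phi, t * sin phi).

Lemma coord_cvg (S : Type) (F : set_system S) {FF : Filter F} (u : S -> Cl) (l : Cl) A :
  u x @[x --> F] --> l -> u x A @[x --> F] --> l A.
Proof.
move=> /cvgrPdist_lt h; apply/cvgrPdist_lt => e e0.
apply: filterS (h e e0) => x; apply: le_lt_trans.
by have := cl_coord_norm (l - u x) A; rewrite !ffunE.
Qed.

Lemma coord_quot (f : R * R -> Cl) q (v : R * R) A (g : R -> R) (a : R) : derivable f q v ->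
  (forall h, f (h *: v + q) A = g (h + a)) -> f q A = g a ->
  is_derive a 1 g ('D_v f q A).
Proof.
move=> df hg ha; apply: is_derive_quot.
have E : (fun h : R => (h^-1 *: ((f \o shift q) (h *: v) - f q)) A) =
    (fun h => h^-1 * (g (h + a) - g a)).
  by apply/funext => h; rewrite !ffunE /= hg ha.
rewrite -E; exact: (coord_cvg (A := A) df).
Qed.

Lemma coord_derive_x (f : R * R -> Cl) q A : derivable f q (1, 0) ->
  is_derive q.1 1 (fun x : R => f (x, q.2) A) (dx f q A).
Proof.
move=> df; apply: (coord_quot df) => [h|]; last by case: (q).
case: (q) => x y; congr (f _ A); transitivity (h * 1 + x, h * 0 + y) => //.
by rewrite mulr1 mulr0 add0r.
Qed.

Lemma coord_derive_y (f : R * R -> Cl) q A : derivable f q (0, 1) ->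
  is_derive q.2 1 (fun y : R => f (q.1, y) A) (dy f q A).
Proof.
move=> df; apply: (coord_quot df) => [h|]; last by case: (q).
case: (q) => x y; congr (f _ A); transitivity (h * 0 + x, h * 1 + y) => //.
by rewrite mulr1 mulr0 add0r.
Qed.

Lemma continuous_polar_pair phi t :
  {for (phi, t), continuous (fun p : R * R => polar_pair p.1 p.2)}.
Proof.
have ct : {for (phi, t), continuous (fun p : R * R => p.2)}.
  exact: (@continuous_snd_comp R id (phi, t)) (cvg_id).
apply: pair_continuous.
  apply: cvgM; first exact: ct.
  by apply: (@continuous_fst_comp R _ (phi, t)); exact: continuous_cos.
apply: cvgM; first exact: ct.
by apply: (@continuous_fst_comp R _ (phi, t)); exact: continuous_sin.
Qed.

Lemma continuous_polar_comp (F : R * R -> R) phi t :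
  {for polar_pair phi t, continuous F} ->
  {for (phi, t), continuous (fun q : R * R => F (polar_pair q.1 q.2))}.
Proof. by move=> cF B /cF hB; exact: continuous_polar_pair hB. Qed.

Lemma polar_chain (g gx gy : R * R -> R) phi t :
  nbhs (polar_pair phi t)
    [set q : R * R | is_derive q.1 1 (fun x : R => g (x, q.2)) (gx q) /\
                     is_derive q.2 1 (fun y : R => g (q.1, y)) (gy q)] ->
  {for polar_pair phi t, continuous gx} -> {for polar_pair phi t, continuous gy} ->
  let p := polar_pair phi t in
  [/\ is_derive t 1 (fun t => g (polar_pair phi t)) (cos phi * gx p + sin phi * gy p),
      is_derive phi 1 (fun phi => g (polar_pair phi t))
        (- (t * sin phi) * gx p + t * cos phi * gy p) &
      {for (phi, t), continuous (fun q : R * R => g (polar_pair q.1 q.2))}].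
Proof.
move=> hg cx cy p; have [rho1 [rho2 [c1 c2 e1 e2 hr]]] := hadamard hg cx cy.
have cpair := @continuous_polar_pair phi t.
have cont_t (rho : R * R -> R) : {for p, continuous rho} ->
    {for t, continuous (fun t => rho (polar_pair phi t))}.
  move=> crho; apply: (@continuous_comp _ _ _ (fun t : R => (phi, t))
    (fun q : R * R => rho (polar_pair q.1 q.2))).
    by apply: pair_continuous; [exact: cst_continuous|exact: cvg_id].
  by apply: (@continuous_comp _ _ _ (fun q : R * R => polar_pair q.1 q.2)).
have cont_phi (rho : R * R -> R) : {for p, continuous rho} ->
    {for phi, continuous (fun phi => rho (polar_pair phi t))}.
  move=> crho; apply: (@continuous_comp _ _ _ (fun phi : R => (phi, t))
    (fun q : R * R => rho (polar_pair q.1 q.2))).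
    by apply: pair_continuous; [exact: cvg_id|exact: cst_continuous].
  by apply: (@continuous_comp _ _ _ (fun q : R * R => polar_pair q.1 q.2)).
have dlin (c s : R) : is_derive s 1 (fun s : R => s * c) c.
  by apply: is_derive_eq; rewrite scaler0 add0r /GRing.scale /= mulr1.
split.
- have := @caratheodory_derive R (fun t => g (polar_pair phi t)) (fun t => t * cos phi)
    (fun t => t * sin phi) (fun t => rho1 (polar_pair phi t))
    (fun t => rho2 (polar_pair phi t)) t _ _ _ (dlin _ _) (dlin _ _).
  rewrite e1 e2; apply; [|exact: cont_t|exact: cont_t].
  by apply: (@filterE _ (nbhs t)) => s; exact: hr.
- have h1 := is_deriveZ t (is_derive_cos phi); have h2 := is_deriveZ t (is_derive_sin phi).
  have := @caratheodory_derive R (fun phi => g (polar_pair phi t)) (fun phi => t * cos phi)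
    (fun phi => t * sin phi) (fun phi => rho1 (polar_pair phi t))
    (fun phi => rho2 (polar_pair phi t)) phi _ _ _ h1 h2.
  rewrite e1 e2 /GRing.scale /= mulrN; apply; [|exact: cont_phi|exact: cont_phi].
  by apply: (@filterE _ (nbhs phi)) => s; exact: hr.
- have cg : {for p, continuous g}.
    exact: increment_continuous c1 c2 hr.
  by apply: (@continuous_comp _ _ _ (fun q : R * R => polar_pair q.1 q.2)).
Qed.

(** Cartesian form of the double sector, from which its openness is read off. *)
Definition plane_sector theta : set (R * R) :=
  [set p | Num.sqrt (p.1 ^+ 2 + p.2 ^+ 2) * cos theta < `|p.1|].

Lemma plane_sector_open theta p : plane_sector theta p -> nbhs p (plane_sector theta).
Proof.
rewrite /plane_sector /= => hp.
pose F (q : R * R) := `|q.1| - Num.sqrt (q.1 ^+ 2 + q.2 ^+ 2) * cos theta.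
have cF : {for p, continuous F}.
  apply: cvgB.
    apply: (@continuous_comp _ _ _ (fun q : R * R => q.1) Num.norm); first exact: cvg_fst.
    exact: norm_continuous.
  apply: cvgM; last exact: cvg_cst.
  apply: (@continuous_comp _ _ _ (fun q : R * R => q.1 ^+ 2 + q.2 ^+ 2) Num.sqrt).
    apply: cvgD; [exact: (cvgM (cvg_fst) (cvg_fst))|exact: (cvgM (cvg_snd) (cvg_snd))].
  exact: sqrt_continuous.
have F0 : 0 < F p by rewrite /F subr_gt0.
have /cvgrPdist_lt/(_ _ F0) := cF.
apply: filterS => q /=; rewrite ltr_distlC subrr => /andP[h _].
by move: h; rewrite /F subr_gt0.
Qed.

Lemma slice_polar J phi t : slice_point J (polar_pair phi t) = iota_slice J (polar phi t) :> Cl.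
Proof. by []. Qed.

Lemma normc_polar phi t : 0 < t -> ComplexField.Normc.normc (polar phi t) = t.
Proof.
move=> t0; rewrite /= !exprMn -mulrDr cos2Dsin2 mulr1.
by rewrite sqrtr_sqr gtr0_norm.
Qed.

Lemma plane_sector_slice theta : 0 < theta < pi / 2 ->
  plane_sector theta `<=` slice_domain (D_ d theta).
Proof.
move=> theta2 p hp J SJ.
have eJ : slice_point J p = iota_slice J (Complex p.1 p.2) by [].
have n0 : 0 < `|iota_slice J (Complex p.1 p.2)|.
  rewrite norm_iota//= lt_neqAle sqrtr_ge0 andbT eq_sym; apply/eqP => e0.
  move: hp; rewrite /plane_sector /= e0 mul0r normr_gt0 => /eqP; apply.
  move/eqP: e0; rewrite sqrtr_eq0 => h.
  apply/eqP; rewrite -sqrf_eq0 eq_le sqr_ge0 andbT.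
  by apply: le_trans h; rewrite lerDl sqr_ge0.
rewrite eJ; apply/D_E => //; first exact: paravector_iota.
  by rewrite -normr_gt0.
by rewrite norm_iota// re_iota.
Qed.

Lemma plane_sector_polar theta phi t : 0 < t ->
  plane_sector theta (polar_pair phi t) <-> cos theta < `|cos phi|.
Proof.
move=> t0; rewrite /plane_sector /= !exprMn -mulrDr cos2Dsin2 mulr1.
by rewrite sqrtr_sqr normrM gtr0_norm// ltr_pM2l.
Qed.

Lemma cauchy_riemann_curve (F0 F1 : R -> R) (s a0 b0 a1 b1 x y : R) :
  is_derive s 1 F0 (x * a0 + y * b0) -> is_derive s 1 F1 (x * a1 + y * b1) ->
  a0 = b1 -> b0 = - a1 ->
  curve_derive (fun s => Complex (F0 s) (F1 s)) s (Complex a0 a1 * Complex x y).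
Proof.
move=> d0 d1 e1 e; split; rewrite ?cReM ?cImM /=.
  by apply: (is_derive_eq d0); rewrite e; ring.
by apply: (is_derive_eq d1); rewrite e1; ring.
Qed.

(** The system satisfied by a slice pair is the Cauchy-Riemann system of
    [f0 + i f1], coordinate by coordinate. *)
Definition slice_coord (f0 f1 : R * R -> Cl) A phi t : R[i] :=
  Complex (f0 (polar_pair phi t) A) (f1 (polar_pair phi t) A).

Lemma slice_pair_holomorphic (O : set (R * R)) f0 f1 A u v theta :
  slice_pair O f0 f1 -> plane_sector theta `<=` O ->
  (forall phi, u < phi < v -> cos theta < `|cos phi|) ->
  holomorphic u v (slice_coord f0 f1 A) (slice_coord (dx f0) (dx f1) A).
Proof.
move=> [C0 C1 CR] sub huv phi t Iphi t0.
set p := polar_pair phi t.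
have Sp : plane_sector theta p by apply/plane_sector_polar => //; exact: huv.
have nO : nbhs p O by apply: filterS (plane_sector_open Sp).
have Op : O p by exact: sub.
have nder f : C1_on O f -> nbhs p [set q : R * R |
    is_derive q.1 1 (fun x : R => f (x, q.2) A) (dx f q A) /\
    is_derive q.2 1 (fun y : R => f (q.1, y) A) (dy f q A)].
  move=> Cf; apply: filterS nO => q Oq; have [d1 d2 _ _] := Cf q Oq.
  by split; [exact: coord_derive_x|exact: coord_derive_y].
have cnt f : C1_on O f -> {for p, continuous (fun q => dx f q A)} /\
    {for p, continuous (fun q => dy f q A)}.
  move=> Cf; have [_ _ c1 c2] := Cf p Op.
  by split; [exact: (coord_cvg (A := A) c1)|exact: (coord_cvg (A := A) c2)].
have [cx0 cy0] := cnt _ C0; have [cx1 cy1] := cnt _ C1.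
have [t0' p0 c0] := polar_chain (g := fun q => f0 q A) (nder _ C0) cx0 cy0.
have [t1' p1 c1] := polar_chain (g := fun q => f1 q A) (nder _ C1) cx1 cy1.
have [_ _ e1 e2] := CR _ _ Op.
have e1A : dx f0 p A = dy f1 p A := congr1 (fun s : Cl => s A) e1.
have e2A : dy f0 p A = - dx f1 p A.
  by apply: etrans (congr1 (fun s : Cl => s A) e2) _; rewrite ffunE.
split.
- exact: (cauchy_riemann_curve t0' t1' e1A e2A).
- have := cauchy_riemann_curve p0 p1 e1A e2A; apply: curve_derive_eq.
  by congr (_ * _); rewrite /cis /=; apply: eq_ReIm; rewrite /= mul0r ?sub0r ?add0r.
- by split.
- by split; [exact: (continuous_polar_comp cx0)|exact: (continuous_polar_comp cx1)].
Qed.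

End SliceHolomorphic.

(** * Bochner integrals of norm-continuous operator families *)

Section Bochner.
Variables (R : realType) (d : nat) (W : hilbertType R).
Local Notation V := (cliffmod d W).
Local Notation ip := (@re_inner R d W).
Local Notation mu := (@lebesgue_measure R).
Local Notation hl := (half_line R).
Implicit Types (u v w : V) (A B : V -> V) (K : R -> V -> V) (h : opsimple d W)
  (t : R).

Let HV := module_hilbert d W.

Definition opnormR A : R := fine (opnorm A).

Lemma opnormRE A : bounded_linear A -> opnorm A = (opnormR A)%:E.
Proof.
move=> [lA [C C0 hC]]; rewrite fineK// ge0_fin_numE ?opnorm_ge0//.
by apply: le_lt_trans (opnorm_le C0 hC) _; rewrite ltry.
Qed.

Lemma opnormR_ge0 A : 0 <= opnormR A.
Proof. by rewrite fine_ge0// opnorm_ge0. Qed.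

Lemma opnormR_bound A : bounded_linear A -> bounded_by (opnormR A) A.
Proof. by move=> bA; apply: bounded_by_opnorm; [case: bA|rewrite opnormRE]. Qed.

Lemma opnormR_le A C : bounded_linear A -> 0 <= C -> bounded_by C A -> opnormR A <= C.
Proof. by move=> bA C0 hC; rewrite -lee_fin -opnormRE// opnorm_le. Qed.

Lemma bounded_linear0 : bounded_linear (0 : V -> V).
Proof.
split=> [a u v|]; first by rewrite scaler0 addr0.
by exists 0 => // v; rewrite normr0 mul0r.
Qed.

Lemma bounded_linearB A B : bounded_linear A -> bounded_linear B ->
  bounded_linear (A - B).
Proof.
move=> bA bB; have := bounded_linearZD (-1) bB bA; congr bounded_linear.
by apply/funext => v; rewrite scaleN1r addrC.
Qed.

Definition norm_continuous_family K := forall t, 0 < t -> forall e, 0 < e ->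
  exists2 r, 0 < r & forall s, 0 < s -> `|s - t| < r -> bounded_by e (K s - K t).

Lemma opnormR_continuous K B : (forall t, 0 < t -> bounded_linear (K t)) ->
  norm_continuous_family K -> bounded_linear B ->
  forall t, 0 < t -> {for t, continuous (fun t => opnormR (K t - B))}.
Proof.
move=> bK cK bB t t0.
have key s e : 0 < s -> 0 < t -> 0 <= e -> bounded_by e (K s - K t) ->
    opnormR (K s - B) <= opnormR (K t - B) + e.
  move=> s0 _ e0 hst; have bs := bounded_linearB (bK s s0) bB.
  have bt := bounded_linearB (bK t t0) bB.
  apply: opnormR_le => //; first by rewrite addr_ge0// opnormR_ge0.
  move=> v; have -> : (K s - B) v = (K t - B) v + (K s - K t) v.
    by rewrite !fctE [RHS]addrC addrA subrK.
  rewrite mulrDl; apply: le_trans (ler_normD _ _) _.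
  by apply: lerD; [exact: opnormR_bound|exact: hst].
apply/cvgrPdist_le => e e0; have [r r0 hr] := cK t t0 e e0.
have : nbhs t (ball t (Num.min r t)) by apply: nbhsx_ballx; rewrite lt_min r0.
apply: filterS => s; rewrite -ball_normE /= lt_min => /andP[h1 h2].
have s0 : 0 < s.
  by have := ler_norm (t - s); move: h2; lra.
have hst : bounded_by e (K s - K t) by apply: hr => //; rewrite distrC.
have hts : bounded_by e (K t - K s).
  by move=> v; have := hst v; rewrite !fctE -normrN opprB.
rewrite ler_distl; apply/andP; split.
  by rewrite lerBlDr; apply: key => //; exact: ltW.
have bs := bounded_linearB (bK s s0) bB; have bt := bounded_linearB (bK t t0) bB.
apply: opnormR_le => //; first by rewrite addr_ge0 ?opnormR_ge0// ltW.
move=> v; have -> : (K t - B) v = (K s - B) v + (K t - K s) v.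
  by rewrite !fctE [RHS]addrC addrA subrK.
rewrite mulrDl; apply: le_trans (ler_normD _ _) _.
by apply: lerD; [exact: opnormR_bound|exact: hts].
Qed.

Lemma weak_continuous K u v : norm_continuous_family K ->
  forall t, 0 < t -> {for t, continuous (fun t => ip u (K t v))}.
Proof.
move=> cK t t0; apply/cvgrPdist_le => e e0.
have k0 : 0 < `|u| * `|v| + 1 by rewrite ltr_wpDl// mulr_ge0.
have [r r0 hr] := cK t t0 (e / (`|u| * `|v| + 1)) (divr_gt0 e0 k0).
have : nbhs t (ball t (Num.min r t)) by apply: nbhsx_ballx; rewrite lt_min r0.
apply: filterS => s; rewrite -ball_normE /= lt_min => /andP[h1 h2].
have s0 : 0 < s.
  by have := ler_norm (t - s); move: h2; lra.
rewrite distrC -(ipBr HV); apply: le_trans (re_inner_CS _ _) _.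
have hv := hr s s0; rewrite distrC in h1; have {}hv := hv h1 v.
apply: (@le_trans _ _ (`|u| * (e / (`|u| * `|v| + 1) * `|v|))).
  by rewrite ler_wpM2l.
have -> : `|u| * (e / (`|u| * `|v| + 1) * `|v|) = e * (`|u| * `|v|) / (`|u| * `|v| + 1).
  by ring.
by rewrite ler_pdivrMr// ler_pM2l// lerDl.
Qed.

Section Simple.
Variable h : opsimple d W.
Hypothesis wf : opsimple_wf hl h.

Lemma indic_integrable (S : set R) : measurable S -> S `<=` hl -> (mu S < +oo)%E ->
  mu.-integrable hl (EFin \o \1_S).
Proof.
move=> mS sS fS; apply/integrableP; split.
  by apply/measurable_EFinP; exact: measurable_indic.
rewrite (_ : (\int[mu]_(x in hl) `|(EFin \o \1_S) x| =
    \int[mu]_(x in hl) (\1_S x)%:E)%E); last first.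
  by apply: eq_integral => x _; rewrite /= ger0_norm.
rewrite integral_indic//; last exact: measurable_half_line.
by rewrite (_ : S `&` hl = S)//; exact/setIidPl.
Qed.

Lemma simple_weak u v : integrable_pos (fun t => ip u (opsimple_fun h t v)) /\
  integral_pos (fun t => ip u (opsimple_fun h t v)) = ip u (opsimple_integral h v).
Proof.
have ipsum I (r : seq I) (F : I -> V) : ip u (\sum_(i <- r) F i) = \sum_(i <- r) ip u (F i).
  elim/big_rec2 : _ => [|i y z _ <-]; first exact: (ip0r HV).
  by rewrite (ipDr HV).
rewrite /opsimple_fun /opsimple_integral ipsum.
rewrite (_ : (fun t => ip u _) = fun t => \sum_i \1_(opsimple_set i) t *
    ip u (@opsimple_val R d W h i v)); last first.
  by apply/funext => t; rewrite ipsum; apply: eq_bigr => i _; rewrite (ipZr HV).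
apply: integrable_pos_sum => i; have [mS sS fS _] := wf i.
have iS := indic_integrable mS sS fS.
set c := ip u (opsimple_val i v).
rewrite (_ : (fun t => _) = fun t => c * \1_(opsimple_set i) t); last first.
  by apply/funext => t; rewrite mulrC.
have [h1 h2] := integrable_posZ c iS; split=> //.
rewrite h2 (ipZr HV) mulrC; congr (_ * _).
rewrite /integral_pos /Rintegral integral_indic//; last exact: measurable_half_line.
by congr (fine (_ _)); exact/setIidPl.
Qed.

End Simple.

Lemma bounded_linear_sum I (r : seq I) (c : I -> R) (A : I -> V -> V) :
  (forall i, bounded_linear (A i)) ->
  bounded_linear (fun v => \sum_(i <- r) c i *: A i v).
Proof.
move=> bA; elim: r => [|i r IH].
  rewrite (_ : (fun v => _) = (0 : V -> V)); first exact: bounded_linear0.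
  by apply/funext => v; rewrite big_nil.
have := bounded_linearZD (c i) (bA i) IH; congr bounded_linear.
by apply/funext => v; rewrite big_cons.
Qed.

Lemma opsimple_fun_bounded h t : opsimple_wf hl h -> bounded_linear (opsimple_fun h t).
Proof.
move=> wf; apply: bounded_linear_sum => i.
by have [_ _ _ /bounded_operatorP[]] := wf i.
Qed.

Section Family.
Variables (K : R -> V -> V) (e C : R).
Hypothesis e0 : 0 < e.
Hypothesis C0 : 0 <= C.
Hypothesis bK : forall t, 0 < t -> bounded_linear (K t).
Hypothesis rK : forall t, 0 < t -> right_homogeneous (K t).
Hypothesis cK : norm_continuous_family K.
Hypothesis hC : forall t, 0 < t -> bounded_by (C * weight e t) (K t).

Lemma weak_integrable u v : integrable_pos (fun t => ip u (K t v)).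
Proof.
apply: (@dominated_integrable_weight R e (`|u| * (C * `|v|))) => // t t0.
  exact: weak_continuous.
apply: le_trans (re_inner_CS _ _) _.
have -> : `|u| * (C * `|v|) * weight e t = `|u| * (C * weight e t * `|v|) by ring.
by rewrite ler_wpM2l// hC.
Qed.

Definition is_weak_integral (L : V -> V) :=
  bounded_linear L /\ forall u v, ip u (L v) = integral_pos (fun t => ip u (K t v)).

(** Integrating the matrix elements gives a bounded bilinear form, which is
    represented by an operator; it will be the limit of the simple integrals. *)
Lemma weak_integral_exists : exists2 L, is_weak_integral L & right_homogeneous L.
Proof.
pose M := C * integral_pos (weight e : R -> R).
have iw := weight_integrable e0.
have M0 : 0 <= M.
  rewrite mulr_ge0//; apply: Rintegral_ge0 => t; rewrite half_lineE; exact: weight_ge0.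
have [L [lL bL hL]] : exists L, [/\ real_linear L, bounded_by M L &
    forall u v, ip u (L v) = integral_pos (fun t => ip u (K t v))].
  apply: form_operator => // [a u u' v|a u v v'|u v].
  - have [h1 h2] := integrable_posZ a (weak_integrable u v).
    rewrite -h2; have [_ <-] := integrable_posD h1 (weak_integrable u' v).
    by apply: eq_integral_pos => t _; rewrite (ipDl HV) (ipZl HV).
  - have [h1 h2] := integrable_posZ a (weak_integrable u v).
    rewrite -h2; have [_ <-] := integrable_posD h1 (weak_integrable u v').
    apply: eq_integral_pos => t t0; have [lKt _] := bK t0.
    by rewrite lKt (ipDr HV) (ipZr HV).
  - have [h1 h2] := integrable_posZ (C * `|u| * `|v|) iw.
    have -> : M * `|u| * `|v| = integral_pos (fun t => C * `|u| * `|v| * weight e t).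
      by rewrite h2 /M; ring.
    apply: integral_pos_norm h1 _; first exact: weak_integrable.
    move=> t t0; apply: le_trans (re_inner_CS _ _) _.
    have -> : C * `|u| * `|v| * weight e t = `|u| * (C * weight e t * `|v|) by ring.
    by rewrite ler_wpM2l// hC.
exists L; first by split=> //; split=> //; exists M.
move=> v s; apply: (ip_ext HV) => u.
rewrite hL (ipC HV) ract_adjoint (ipC HV) hL.
apply: eq_integral_pos => t t0.
by rewrite rK// (ipC HV) ract_adjoint (ipC HV).
Qed.

Lemma simple_error L h (r : R) : is_weak_integral L -> opsimple_wf hl h ->
  measurable_fun hl (fun t => opnorm (K t - opsimple_fun h t)) ->
  (\int[mu]_(t in hl) opnorm (K t - opsimple_fun h t)%R <= r%:E)%E ->
  bounded_by r (L - opsimple_integral h).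
Proof.
move=> [bL hL] wf mF hr v.
pose F t := opnormR (K t - opsimple_fun h t).
have bD t : 0 < t -> bounded_linear (K t - opsimple_fun h t).
  by move=> t0; apply: bounded_linearB (bK t0) (opsimple_fun_bounded t wf).
have FE t : 0 < t -> opnorm (K t - opsimple_fun h t) = (F t)%:E.
  by move=> t0; rewrite opnormRE//; exact: bD.
have eI : (\int[mu]_(t in hl) opnorm (K t - opsimple_fun h t)%R =
    \int[mu]_(t in hl) (F t)%:E)%E.
  by apply: eq_integral => t; rewrite inE half_lineE => /FE.
have iF : integrable_pos F.
  apply/integrableP; split.
    by apply: eq_measurable_fun mF => t; rewrite inE half_lineE => /FE.
  rewrite (_ : (\int[mu]_(x in hl) `|(EFin \o F) x| = \int[mu]_(x in hl) (F x)%:E)%E).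
    by rewrite -eI; apply: le_lt_trans hr _; rewrite ltry.
  by apply: eq_integral => t _; rewrite /= ger0_norm// opnormR_ge0.
have hr' : integral_pos F <= r.
  rewrite -lee_fin /integral_pos /Rintegral fineK; first by rewrite -eI.
  by apply: integrable_fin_num => //; exact: measurable_half_line.
set w := (L - opsimple_integral h) v.
have [w0|w0] := eqVneq w 0.
  rewrite w0 normr0 mulr_ge0//; apply: le_trans hr'.
  by apply: Rintegral_ge0 => t _; exact: opnormR_ge0.
have nw : 0 < `|w| by rewrite normr_gt0.
rewrite -(ler_pM2l nw) -expr2 -re_inner_norm.
have [si se] := simple_weak wf w v.
have siN := integrable_posZ (-1) si.
have -> : ip w w = integral_pos (fun t => ip w ((K t - opsimple_fun h t) v)).
  rewrite {2}/w !fctE (ipBr HV) hL -se -mulN1r -siN.2.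
  have [_ <-] := integrable_posD (weak_integrable w v) siN.1.
  by apply: eq_integral_pos => t _; rewrite !fctE (ipBr HV) mulN1r.
have [h1 h2] := integrable_posZ (`|w| * `|v|) iF.
apply: le_trans (ler_norm _) _.
have -> : `|w| * (r * `|v|) = `|w| * `|v| * r by ring.
apply: (@le_trans _ _ (`|w| * `|v| * integral_pos F)); last first.
  by rewrite ler_wpM2l// mulr_ge0.
rewrite -h2; apply: integral_pos_norm h1 _.
  have [+ _] := integrable_posD (weak_integrable w v) siN.1.
  by apply: eq_integrable_pos => t _; rewrite !fctE (ipBr HV) mulN1r.
move=> t t0; apply: le_trans (re_inner_CS _ _) _.
by rewrite -mulrA ler_wpM2l// mulrC; apply: opnormR_bound; exact: bD.
Qed.

(** On a compact interval finitely many values of [K] approximate it in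
    operator norm; outside the weight makes the integral of the norm small. *)
Lemma simple_approximation (eta : R) : 0 < eta -> exists h,
  [/\ opsimple_wf hl h, measurable_fun hl (fun t => opnorm (K t - opsimple_fun h t)) &
      (\int[mu]_(t in hl) opnorm (K t - opsimple_fun h t)%R <= eta%:E)%E].
Proof.
move=> eta0; have iw := weight_integrable e0.
have mhl : measurable (hl : set R) := @measurable_half_line R.
have C1 : 0 < C + 1 by rewrite ltr_wpDl.
have d0 : 0 < eta / 2 / (C + 1) by rewrite !divr_gt0.
have [N hN] : exists N, integral_pos (weight e : R -> R) -
    \int[mu]_(t in exhaustion R N) weight e t <= eta / 2 / (C + 1).
  have /cvgrPdist_le/(_ _ d0)[N _ hN] := exhaustion_cvg iw.
  by exists N; apply: le_trans (ler_norm _) (hN N (leqnn _)).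
set J := exhaustion R N in hN.
have mJ : measurable (J : set R) by exact: measurable_itv.
have sJ : J `<=` hl by move=> t /exhaustion_pos; rewrite half_lineE.
have muJ : mu J = (N.+1%:R - N.+1%:R^-1)%:E.
  rewrite /J /exhaustion lebesgue_measure_itv /= lte_fin; case: ltP => //.
  have : N.+1%:R^-1 <= 1 :> R by rewrite invf_le1// ler1n.
  have : 1 <= N.+1%:R :> R by rewrite ler1n.
  move: (N.+1%:R^-1 : R) (N.+1%:R : R) => a b h1 h2 h3; congr EFin.
  by apply/eqP; rewrite eq_le; apply/andP; split; lra.
set lJ := N.+1%:R - N.+1%:R^-1 in muJ.
have lJ0 : 0 <= lJ by rewrite -lee_fin -muJ.
pose eps := eta / 2 / (lJ + 1).
have eps0 : 0 < eps by rewrite !divr_gt0// ltr_wpDl.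
have /choice[dl hdl] (t : R) : exists r, 0 < t -> 0 < r /\ forall s, 0 < s ->
    `|s - t| < r -> bounded_by eps (K s - K t).
  have [t0|] := boolP (0 < t); last by exists 0.
  by have [r r0 hr] := cK t0 eps0; exists r.
have [D' sD' cD'] : finite_subset_cover J (fun t : R => ball t (dl t)) J.
  have : cover_compact (J : set R) by rewrite -compact_cover; exact: segment_compact.
  apply; first by move=> t _; exact: ball_open.
  move=> t Jt; exists t => //; apply: ballxx.
  by have [] := hdl t (exhaustion_pos Jt).
pose s := finmap.enum_fset D'; pose n := size s.
pose c i := nth 0 s i.
pose F i := if (i < n)%N then J `&` ball (c i) (dl (c i)) else hl.
have mF i : measurable (F i : set R).
  by rewrite /F; case: ifP => // _; apply: measurableI => //; exact: measurable_ball.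
pose E := seqDU F.
have mE i : measurable (E i : set R).
  by apply: measurableD => //; exact: bigsetU_measurable.
have EF i : E i `<=` F i by exact: subDsetl.
have Ehl : \bigcup_i E i = hl.
  rewrite -seqDU_bigcup_eq; apply/seteqP; split=> [t [i _]|t ht].
    by rewrite /F; case: ifP => // _ [/sJ].
  by exists n => //; rewrite /F ltnn.
have cpos i : (i < n)%N -> 0 < c i.
  move=> hi; have /(_ (mem_nth 0 hi)) := sD' (c i).
  by rewrite inE => /exhaustion_pos.
pose hh : opsimple d W := @OpSimple R d W n (fun i => E i) (fun i => K (c i)).
have wf : opsimple_wf hl hh.
  move=> i; have hi : (i < n)%N := ltn_ord i.
  have EJ : E i `<=` J by move=> t /EF; rewrite /F hi => -[].
  split; [exact: mE|exact: subset_trans EJ sJ| |].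
    apply: (@le_lt_trans _ _ (mu J)); last by rewrite muJ ltry.
    by apply: le_measure => //; rewrite inE; [exact: mE|exact: mJ].
  by apply/bounded_operatorP; split; [apply: bK|apply: rK]; exact: cpos.
pose B i : V -> V := if (i < n)%N then K (c i) else 0.
have bB i : bounded_linear (B i).
  by rewrite /B; case: ifP => [/cpos/bK//|_]; exact: bounded_linear0.
have tE i t : E i t -> opsimple_fun hh t = B i.
  move=> Eit; apply/funext => v; rewrite /opsimple_fun /B /=.
  have dis j : E j t -> j = i.
    move=> Ejt; apply/eqP/negPn/negP => ji.
    have /trivIsetP/(_ j i I I ji) := @trivIset_seqDU _ F.
    by move/seteqP => -[/(_ t) + _]; apply.
  case: ifPn => hi; last first.
    apply: big1 => j _; rewrite indicE memNset ?scale0r// => /dis ji.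
    by move: hi; rewrite -ji ltn_ord.
  rewrite (bigD1 (Ordinal hi))//= indicE mem_set// scale1r big1 ?addr0// => j ji.
  rewrite indicE memNset ?scale0r// => /dis e1; move: ji.
  by rewrite -val_eqE /= e1 eqxx.
have posE i t : E i t -> 0 < t.
  by move=> Eit; rewrite -half_lineE -Ehl; exists i.
have bD t : 0 < t -> bounded_linear (K t - opsimple_fun hh t).
  by move=> t0; apply: bounded_linearB (bK t0) (opsimple_fun_bounded t wf).
have mO : measurable_fun hl (fun t => opnorm (K t - opsimple_fun hh t)).
  rewrite -Ehl; apply/measurable_fun_bigcup => // i.
  apply: (@eq_measurable_fun _ _ _ _ _ (EFin \o (fun t => opnormR (K t - B i)))).
    move=> t; rewrite inE => Eit; rewrite /= -(tE i t Eit) opnormRE//.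
    exact/bD/(posE i).
  apply/measurable_EFinP; apply: (@measurable_funS _ _ _ _ hl) => //.
    by move=> t /posE; rewrite half_lineE.
  by apply: continuous_pos_measurable => t; exact: opnormR_continuous.
exists hh; split=> //.
have le1 t : J t -> (opnorm (K t - opsimple_fun hh t)%R <= eps%:E)%E.
  move=> Jt; have t0 := exhaustion_pos Jt.
  have [i _ Eit] : (\bigcup_i E i) t by rewrite Ehl half_lineE.
  apply: opnorm_le; first exact: ltW.
  rewrite (tE i t Eit) /B; case: ifPn => hi.
    have := EF _ _ Eit; rewrite /F hi => -[_]; rewrite -ball_normE /= distrC => hb.
    by have [_] := hdl (c i) (cpos i hi); apply.
  exfalso; have [a aD' ha] := cD' t Jt.
  have [j hj ej] : exists2 j, (j < n)%N & c j = a.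
    by exists (index a s); [rewrite index_mem|exact: nth_index].
  case: Eit => _; apply; rewrite -bigcup_mkord; exists j.
    by apply: leq_trans hj _; rewrite leqNgt.
  by rewrite /F hj ej.
have le2 t : (hl `\` J) t -> (opnorm (K t - opsimple_fun hh t)%R <= (C * weight e t)%:E)%E.
  rewrite /= half_lineE => -[t0 nJt].
  have [i _ Eit] : (\bigcup_i E i) t by rewrite Ehl half_lineE.
  apply: opnorm_le; first by rewrite mulr_ge0// weight_ge0.
  rewrite (tE i t Eit) /B; case: ifPn => hi.
    by have := EF _ _ Eit; rewrite /F hi => -[].
  by rewrite subr0; exact: hC.
have hlJ : hl = J `|` (hl `\` J) by rewrite setDUK.
have mhJ : measurable (hl `\` J : set R) by exact: measurableD.
have dJ : [disjoint J & hl `\` J] by apply/disj_setPRL => t [].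
rewrite hlJ ge0_integral_setU//=; last 2 first.
  by rewrite -hlJ.
  by move=> t _; exact: opnorm_ge0.
apply: (@le_trans _ _ ((eta / 2)%:E + (eta / 2)%:E)%E); last first.
  by rewrite -EFinD -splitr.
apply: leeD.
  apply: (@le_trans _ _ (\int[mu]_(t in J) eps%:E)%E).
    apply: ge0_le_integral => //; [by move=> t _; exact: opnorm_ge0|
      exact: measurable_funS mO].
  rewrite integral_cst// [X in (_ * X)%E]muJ -EFinM lee_fin /eps.
  by rewrite mulrAC ler_pdivrMr ?ltr_wpDl// ler_wpM2l ?divr_ge0 ?ltW// ltrDl.
have iwJ : mu.-integrable (hl `\` J) (EFin \o (fun t => C * weight e t)).
  by apply: (integrableS _ _ _ (integrable_posZ C iw).1) => //; exact: subDsetl.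
apply: (@le_trans _ _ (\int[mu]_(t in hl `\` J) (C * weight e t)%:E)%E).
  apply: ge0_le_integral => //; [by move=> t _; exact: opnorm_ge0| |].
    by apply: measurable_funS mO => //; exact: subDsetl.
  exact: measurable_int iwJ.
have -> : (\int[mu]_(t in hl `\` J) (C * weight e t)%:E)%E =
    (\int[mu]_(t in hl `\` J) (C * weight e t))%:E.
  by rewrite /Rintegral fineK//; apply: integrable_fin_num => //.
rewrite lee_fin.
have iw' : mu.-integrable (hl `\` J) (EFin \o (weight e : R -> R)).
  by apply: (integrableS _ _ _ iw) => //; exact: subDsetl.
rewrite RintegralZl//.
have : integral_pos (weight e : R -> R) = \int[mu]_(t in J) weight e t +
    \int[mu]_(t in hl `\` J) weight e t.
  by rewrite -Rintegral_setU// -hlJ.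
move=> eI; have {}hN : \int[mu]_(t in hl `\` J) weight e t <= eta / 2 / (C + 1).
  by move: hN; rewrite eI addrAC subrr add0r.
apply: (@le_trans _ _ ((C + 1) * (eta / 2 / (C + 1)))).
  apply: ler_pM => //; last by rewrite lerDl.
  by apply: Rintegral_ge0 => t [+ _]; rewrite half_lineE; exact: weight_ge0.
by rewrite mulrC divfK// gt_eqF.
Qed.

Lemma bochner_exists : exists2 L, is_weak_integral L & is_bochner hl K L.
Proof.
have [L wL rL] := weak_integral_exists; have [bL _] := wL.
exists L => //; split; first exact/bounded_operatorP.
have /choice[h hh] (n : nat) : exists h, [/\ opsimple_wf hl h,
    measurable_fun hl (fun t => opnorm (K t - opsimple_fun h t)) &
    (\int[mu]_(t in hl) opnorm (K t - opsimple_fun h t)%R <= (n.+1%:R^-1)%:E)%E].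
  by apply: simple_approximation; rewrite invr_gt0.
have small : (n.+1%:R^-1)%:E @[n --> \oo] --> (0 : \bar R).
  by apply: cvg_EFin; [exact: nearW|exact: cvg_harmonic].
exists h; split.
- by move=> n; have [] := hh n.
- by move=> n; have [] := hh n.
- apply: (squeeze_cvge _ (cvg_cst 0%E) small); apply: nearW => n.
  have [_ _ ->] := hh n; rewrite andbT; apply: integral_ge0 => t _.
  exact: opnorm_ge0.
- apply: (squeeze_cvge _ (cvg_cst 0%E) small); apply: nearW => n.
  have [wf mh ih] := hh n; rewrite opnorm_ge0 /=.
  by apply: opnorm_le; [rewrite invr_ge0|exact: simple_error wL wf mh ih].
Qed.

Lemma bochner_weak : is_weak_integral (bochner hl K) /\ right_homogeneous (bochner hl K).
Proof.
have [L0 wL0 iL0] := bochner_exists; have [bL0 _] := wL0.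
have uniq L : is_bochner hl K L -> L = L0.
  move=> [/bounded_operatorP[bL _] [h [wf mh ih lh]]].
  apply/funext => v; apply/eqP; rewrite -subr_eq0 -normr_eq0 eq_le normr_ge0 andbT.
  apply/ler_addgt0Pr => a a0; rewrite add0r.
  pose k := 2 * (`|v| + 1); have k0 : 0 < k by rewrite mulr_gt0// ltr_wpDl.
  have ak : (0 < (a / k)%:E)%E by rewrite lte_fin divr_gt0.
  have nb : nbhs (0 : \bar R) [set x | (x < (a / k)%:E)%E].
    by apply: open_nbhs_nbhs; split; [exact: open_ereal_lt_ereal|].
  have [n1 _ hn1] := ih _ nb; have [n2 _ hn2] := lh _ nb.
  pose n := maxn n1 n2.
  have h1 := hn1 n (leq_maxl _ _); have h2 := hn2 n (leq_maxr _ _).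
  have b1 := simple_error wL0 (wf n) (mh n) (ltW h1) v.
  have bI : real_linear (L - opsimple_integral (h n)).
    apply: (bounded_linearB bL _).1; apply: bounded_linear_sum => i.
    by have [_ _ _ /bounded_operatorP[]] := wf n i.
  have b2 := bounded_by_opnorm bI (ltW h2) v.
  have -> : L v - L0 v = (L - opsimple_integral (h n)) v - (L0 - opsimple_integral (h n)) v.
    by rewrite !fctE opprB addrA subrK.
  apply: le_trans (ler_normB _ _) _; apply: le_trans (lerD b2 b1) _.
  have -> : a / k * `|v| + a / k * `|v| = a * (2 * `|v|) / k by ring.
  by rewrite ler_pdivrMr// ler_pM2l// ler_pM2l// lerDl.
have eL : bochner hl K = L0.
  by apply: uniq; rewrite /bochner; case: xgetP => [L -> //|/(_ L0)[]].
by rewrite eL; split=> //; have [/bounded_operatorP[]] := iL0.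
Qed.

End Family.
End Bochner.

(** * Resolvent families *)

Section CurveCaratheodory.
Variable R : realType.
Local Notation Re := complex.Re.
Local Notation Im := complex.Im.

Lemma curve_caratheodory (k gam rho : R -> R[i]) (t : R) (c : R[i]) :
  (\forall s \near t, k s - k t = (gam s - gam t) * rho s) ->
  curve_derive gam t c ->
  {for t, continuous (fun s => Re (rho s))} ->
  {for t, continuous (fun s => Im (rho s))} ->
  curve_derive k t (c * rho t).
Proof.
move=> hk [g1 g2] c1 c2.
have c2N : {for t, continuous (fun s => - Im (rho s))} by apply: cvgN.
split.
  have := caratheodory_derive _ g1 g2 c1 c2N; rewrite cReM mulrN; apply.
  apply: filterS hk => s e.
  have : Re (k s - k t) = Re ((gam s - gam t) * rho s) by rewrite e.
  by rewrite cReM !cReD !cImD !cReN !cImN => ->; ring.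
have := caratheodory_derive _ g1 g2 c2 c1; rewrite cImM; apply.
apply: filterS hk => s e.
have : Im (k s - k t) = Im ((gam s - gam t) * rho s) by rewrite e.
by rewrite cImM !cReD !cImD !cReN !cImN => ->.
Qed.

End CurveCaratheodory.

Section ResolventFamily.
Variables (R : realType) (d : nat) (W : hilbertType R).
Local Notation V := (cliffmod d W).
Local Notation ip := (@re_inner R d W).
Local Notation Re := complex.Re.
Local Notation Im := complex.Im.
Local Notation normc := ComplexField.Normc.normc.
Implicit Types (u v w : V) (z y : R[i]) (t phi : R).

Let HV := module_hilbert d W.

Definition outer_sector (omega : R) : set R[i] :=
  [set z | `|Re z| < cos omega * normc z].

(** Real and imaginary parts of (z - T)^(-1) on the complexification, for [z]
    in the complement of a double sector. *)
Record resolvent_family (omega : R) (A B : R[i] -> V -> V) : Prop := {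
  rf_linear : forall z, outer_sector omega z ->
    real_linear (A z) /\ real_linear (B z);
  rf_right : forall z, outer_sector omega z ->
    right_homogeneous (A z) /\ right_homogeneous (B z);
  rf_bound : forall psi, omega < psi < pi / 2 -> exists2 C, 0 <= C &
    forall z, 0 < normc z -> `|Re z| <= cos psi * normc z ->
      bounded_by (C / normc z) (A z) /\ bounded_by (C / normc z) (B z);
  rf_resolvent : forall z y v, outer_sector omega z -> outer_sector omega y ->
    A z v - A y v = Re (y - z) *: (A z (A y v) - B z (B y v)) -
                    Im (y - z) *: (A z (B y v) + B z (A y v)) /\
    B z v - B y v = Re (y - z) *: (A z (B y v) + B z (A y v)) +
                    Im (y - z) *: (A z (A y v) - B z (B y v));
  rf_conj : forall z, outer_sector omega z ->
    A (conjc z) = A z /\ B (conjc z) = - B z }.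

Section Family.
Variables (omega : R) (A B : R[i] -> V -> V).
Hypothesis omega2 : 0 < omega < pi / 2.
Hypothesis rf : resolvent_family omega A B.

Lemma omega_cos : 0 < cos omega.
Proof.
by apply: cos_gt0_pihalf; move/andP: omega2 => [? ?]; apply/andP; split; lra.
Qed.

Lemma outer_sector_polar phi t : omega < phi < pi - omega -> 0 < t ->
  outer_sector omega (polar phi t) /\ `|cos phi| < cos omega.
Proof.
move=> /andP[h1 h2] t0; move/andP: omega2 => [om1 om2].
have pi0 := pi_gt0 R.
have oi : omega \in `[0, pi] by rewrite in_itv/=; apply/andP; split; lra.
have pi_ : phi \in `[0, pi] by rewrite in_itv/=; apply/andP; split; lra.
have poi : pi - omega \in `[0, pi] by rewrite in_itv/=; apply/andP; split; lra.
have hc : `|cos phi| < cos omega.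
  rewrite ltr_norml (ltr_cos oi pi_) h1 andbT.
  have -> : - cos omega = cos (pi - omega).
    by rewrite cosB cospi sinpi mul0r addr0 mulN1r.
  by rewrite (ltr_cos pi_ poi).
split=> //; rewrite /outer_sector /mkset normc_polar//=.
by rewrite normrM gtr0_norm// mulrC ltr_pM2r.
Qed.

(** The bounds degenerate only at the boundary of the outer sector, so on a
    closed subsector one angle [psi] serves all rays. *)
Lemma rf_uniform phi0 phi1 : omega < phi0 -> phi1 < pi - omega ->
  exists2 C, 0 <= C & forall phi t, phi0 <= phi <= phi1 -> 0 < t ->
    bounded_by (C / t) (A (polar phi t)) /\ bounded_by (C / t) (B (polar phi t)).
Proof.
move=> h0 h1; move/andP: omega2 => [om1 om2].
pose psi := Num.min ((omega + pi / 2) / 2) (Num.min phi0 (pi - phi1)).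
have psi1 : omega < psi by rewrite !lt_min; apply/and3P; split; lra.
have psi2 : psi < pi / 2.
  by rewrite /psi gt_min; apply/orP; left; lra.
have p0 : psi <= phi0 by rewrite /psi ge_min; apply/orP; right; rewrite ge_min lexx.
have p1 : psi <= pi - phi1 by rewrite /psi ge_min; apply/orP; right; rewrite ge_min lexx orbT.
have [C C0 hC] := rf_bound rf (psi := psi) ltac:(by rewrite psi1).
exists C => // phi t /andP[q0 q1] t0.
have := hC (polar phi t); rewrite normc_polar//; apply=> //=.
rewrite normrM gtr0_norm// mulrC ler_pM2r//.
have pi0 := pi_gt0 R.
have ips : psi \in `[0, pi] by rewrite in_itv/=; apply/andP; split; lra.
have iphi : phi \in `[0, pi] by rewrite in_itv/=; apply/andP; split; lra.
have ipp : pi - psi \in `[0, pi] by rewrite in_itv/=; apply/andP; split; lra.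
have c1 : cos phi <= cos psi by rewrite leNgt (ltr_cos iphi ips) -leNgt; lra.
have c2 : - cos psi <= cos phi.
  have -> : - cos psi = cos (pi - psi) by rewrite cosB cospi sinpi mul0r addr0 mulN1r.
  by rewrite leNgt (ltr_cos ipp iphi) -leNgt; lra.
by rewrite ler_norml c2 c1.
Qed.

Lemma rf_lipschitz z y M : outer_sector omega z -> outer_sector omega y ->
  0 <= M -> bounded_by M (A z) -> bounded_by M (B z) ->
  bounded_by M (A y) -> bounded_by M (B y) ->
  let L := 2 * M ^+ 2 * (`|Re (y - z)| + `|Im (y - z)|) in
  bounded_by L (A z - A y) /\ bounded_by L (B z - B y).
Proof.
move=> oz oy M0 Az Bz Ay By L.
have bd (X Y : V -> V) v : bounded_by M X -> bounded_by M Y -> `|X (Y v)| <= M ^+ 2 * `|v|.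
  move=> hX hY; apply: le_trans (hX _) _; rewrite expr2 -mulrA ler_wpM2l//.
have bd2 (a b : R) (p q : V) (n : R) : `|p| <= n -> `|q| <= n ->
    `|a *: p| + `|b *: q| <= (`|a| + `|b|) * n.
  by move=> hp hq; rewrite !normrZ mulrDl lerD// ler_wpM2l.
split=> v; rewrite !fctE.
  rewrite (rf_resolvent rf v oz oy).1; apply: le_trans (ler_normB _ _) _.
  apply: (le_trans (@bd2 _ _ _ _ (2 * M ^+ 2 * `|v|) _ _)).
  - by apply: le_trans (ler_normB _ _) _; rewrite -mulrA mulr_natl mulr2n; exact: lerD (bd _ _ v Az Ay) (bd _ _ v Bz By).
  - by apply: le_trans (ler_normD _ _) _; rewrite -mulrA mulr_natl mulr2n; exact: lerD (bd _ _ v Az By) (bd _ _ v Bz Ay).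
  - by rewrite /L le_eqVlt; apply/orP; left; apply/eqP; ring.
rewrite (rf_resolvent rf v oz oy).2; apply: le_trans (ler_normD _ _) _.
apply: (le_trans (@bd2 _ _ _ _ (2 * M ^+ 2 * `|v|) _ _)).
- by apply: le_trans (ler_normD _ _) _; rewrite -mulrA mulr_natl mulr2n; exact: lerD (bd _ _ v Az By) (bd _ _ v Bz Ay).
- by apply: le_trans (ler_normB _ _) _; rewrite -mulrA mulr_natl mulr2n; exact: lerD (bd _ _ v Az Ay) (bd _ _ v Bz By).
- by rewrite /L le_eqVlt; apply/orP; left; apply/eqP; ring.
Qed.

(** A box in polar coordinates around a point, small enough to stay away from
    the origin and from the boundary of the outer sector. *)
Lemma rf_local phi t : omega < phi < pi - omega -> 0 < t ->
  exists r M, [/\ 0 < r, 0 <= M & forall psi s, `|psi - phi| < r -> `|s - t| < r ->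
    let z := polar psi s in [/\ 0 < s, outer_sector omega z,
      bounded_by M (A z) & bounded_by M (B z)]].
Proof.
move=> /andP[h1 h2] t0.
pose r := Num.min (t / 2) (Num.min ((phi - omega) / 2) ((pi - omega - phi) / 2)).
have r0 : 0 < r by rewrite !lt_min !divr_gt0// ?subr_gt0//.
have r1 : r <= t / 2 by rewrite /r ge_min lexx.
have r2 : r <= (phi - omega) / 2 by rewrite /r !ge_min lexx !orbT.
have r3 : r <= (pi - omega - phi) / 2 by rewrite /r !ge_min lexx !orbT.
have [C C0 hC] := @rf_uniform (phi - r) (phi + r) ltac:(lra) ltac:(lra).
exists r, (C / (t / 2)); split=> //.
  by rewrite divr_ge0// divr_ge0// ltW.
move=> psi s; rewrite !ltr_norml => /andP[p1 p2] /andP[s1 s2].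
have s0 : t / 2 < s by lra.
have s00 : 0 < s by lra.
have [bA bB] := hC psi s ltac:(by apply/andP; split; lra) s00.
have le : C / s <= C / (t / 2).
  by rewrite ler_wpM2l// lef_pV2 ?posrE ?ltW//; lra.
split=> //; first by apply: (outer_sector_polar _ _).1 => //; apply/andP; split; lra.
  by move=> v; apply: le_trans (bA v) _; rewrite ler_wpM2r.
by move=> v; apply: le_trans (bB v) _; rewrite ler_wpM2r.
Qed.

Lemma polar_lipschitz_continuous (G : R[i] -> R) phi t (L r : R) : 0 < r ->
  (forall psi s, `|psi - phi| < r -> `|s - t| < r ->
    `|G (polar psi s) - G (polar phi t)| <=
    L * (`|Re (polar psi s - polar phi t)| + `|Im (polar psi s - polar phi t)|)) ->
  {for (phi, t), continuous (fun p : R * R => G (polar p.1 p.2))}.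
Proof.
move=> r0 hG; apply/prod_continuousP => e e0.
have k0 : 0 < 2 * (`|L| + 1) by rewrite mulr_gt0// ltr_wpDl.
have /prod_continuousP cpr : {for (phi, t), continuous (fun p : R * R => p.2 * cos p.1)}.
  have ct := @continuous_polar_pair R phi t.
  exact: (cvg_comp _ _ ct (@cvg_fst _ _ _ _ _)).
have /prod_continuousP cpi : {for (phi, t), continuous (fun p : R * R => p.2 * sin p.1)}.
  have ct := @continuous_polar_pair R phi t.
  exact: (cvg_comp _ _ ct (@cvg_snd _ _ _ _ _)).
have [d1 d10 hd1] := cpr _ (divr_gt0 e0 k0); have [d2 d20 hd2] := cpi _ (divr_gt0 e0 k0).
exists (Num.min r (Num.min d1 d2)); first by rewrite !lt_min r0 d10.
move=> [psi s] /=; rewrite !lt_min => /and3P[q1 q2 q3] /and3P[s1 s2 s3].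
apply: le_lt_trans (hG _ _ q1 s1) _; rewrite /=.
have /= a1 := hd1 (psi, s) q2 s2; have /= a2 := hd2 (psi, s) q3 s3.
move: a1 a2; set x := `|_|; set y := `|_ - t * sin phi|; move=> a1 a2.
have x0 : 0 <= x by exact: normr_ge0.
have y0 : 0 <= y by exact: normr_ge0.
have L1 : L <= `|L| + 1 by have := ler_norm L; lra.
apply: (@le_lt_trans _ _ ((`|L| + 1) * (x + y))).
  by rewrite ler_wpM2r// addr_ge0.
have l0 : 0 < `|L| + 1 by rewrite ltr_wpDl.
apply: (@lt_le_trans _ _ ((`|L| + 1) * (e / (2 * (`|L| + 1)) + e / (2 * (`|L| + 1))))).
  by rewrite ltr_pM2l// ltrD.
have -> : (`|L| + 1) * (e / (2 * (`|L| + 1)) + e / (2 * (`|L| + 1))) = e; last exact: lexx.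
by field; rewrite gt_eqF.
Qed.

Definition scalar_resolvent u v z : R[i] := Complex (ip u (A z v)) (ip u (B z v)).

Definition scalar_resolvent2 u v z y : R[i] :=
  scalar_resolvent u (A y v) z + Complex 0 1 * scalar_resolvent u (B y v) z.

Lemma scalar_resolventE u v z y : outer_sector omega z -> outer_sector omega y ->
  scalar_resolvent u v z - scalar_resolvent u v y = (y - z) * scalar_resolvent2 u v z y.
Proof.
move=> oz oy; have [eA eB] := rf_resolvent rf v oz oy.
have pA : ip u (A z v) - ip u (A y v) = Re (y - z) * (ip u (A z (A y v)) - ip u (B z (B y v)))
    - Im (y - z) * (ip u (A z (B y v)) + ip u (B z (A y v))).
  by rewrite -(ipBr HV) eA (ipBr HV) !(ipZr HV) (ipBr HV) (ipDr HV).
have pB : ip u (B z v) - ip u (B y v) = Re (y - z) * (ip u (A z (B y v)) + ip u (B z (A y v)))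
    + Im (y - z) * (ip u (A z (A y v)) - ip u (B z (B y v))).
  by rewrite -(ipBr HV) eB (ipDr HV) !(ipZr HV) (ipBr HV) (ipDr HV).
apply: eq_ReIm.
  rewrite cReD cReN /= pA cReM cReD cImD /scalar_resolvent2 !cReD !cImD !cReM !cImM /=.
  by rewrite cReN cImN; ring.
rewrite cImD cImN /= pB cImM cReD cImD /scalar_resolvent2 !cReD !cImD !cReM !cImM /=.
by rewrite cReN cImN; ring.
Qed.

Lemma scalar_resolvent_continuous u v phi t : omega < phi < pi - omega -> 0 < t ->
  complex_continuous (fun phi t => scalar_resolvent u v (polar phi t)) phi t.
Proof.
move=> Iphi t0; have [r [M [r0 M0 hM]]] := rf_local Iphi t0.
have [_ o0 A0 B0] := hM phi t ltac:(by rewrite subrr normr0) ltac:(by rewrite subrr normr0).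
have key psi s : `|psi - phi| < r -> `|s - t| < r ->
    `|ip u (A (polar psi s) v) - ip u (A (polar phi t) v)| <= `|u| * (2 * M ^+ 2) * `|v| *
    (`|Re (polar psi s - polar phi t)| + `|Im (polar psi s - polar phi t)|) /\
    `|ip u (B (polar psi s) v) - ip u (B (polar phi t) v)| <= `|u| * (2 * M ^+ 2) * `|v| *
    (`|Re (polar psi s - polar phi t)| + `|Im (polar psi s - polar phi t)|).
  move=> h1 h2; have [_ o1 A1 B1] := hM psi s h1 h2.
  have [lA lB] := rf_lipschitz o0 o1 M0 A0 B0 A1 B1.
  set D := _ + _ in lA lB *.
  have fin (X Y : V) : `|X - Y| <= 2 * M ^+ 2 * D * `|v| -> 
      `|ip u Y - ip u X| <= `|u| * (2 * M ^+ 2) * `|v| * D.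
    move=> h; rewrite -(ipBr HV); apply: le_trans (re_inner_CS _ _) _.
    rewrite distrC; have -> : `|u| * (2 * M ^+ 2) * `|v| * D =
      `|u| * (2 * M ^+ 2 * D * `|v|) by ring.
    by rewrite ler_wpM2l.
  by split; apply: fin; [exact: lA|exact: lB].
split.
  apply: (@polar_lipschitz_continuous (fun z => ip u (A z v)) phi t
    (`|u| * (2 * M ^+ 2) * `|v|) r r0) => psi s h1 h2.
  by have [] := key psi s h1 h2.
apply: (@polar_lipschitz_continuous (fun z => ip u (B z v)) phi t
  (`|u| * (2 * M ^+ 2) * `|v|) r r0) => psi s h1 h2.
by have [] := key psi s h1 h2.
Qed.

Lemma scalar_resolvent_sqr_continuous u v phi t : omega < phi < pi - omega -> 0 < t ->
  complex_continuous (fun phi t => - scalar_resolvent2 u v (polar phi t) (polar phi t)) phi t.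
Proof.
move=> Iphi t0; have [r [M [r0 M0 hM]]] := rf_local Iphi t0.
have [_ o0 A0 B0] := hM phi t ltac:(by rewrite subrr normr0) ltac:(by rewrite subrr normr0).
set z0 := polar phi t in o0 A0 B0 *.
pose D psi s := `|Re (polar psi s - z0)| + `|Im (polar psi s - z0)|.
have D0 psi s : 0 <= D psi s by rewrite addr_ge0.
pose L := `|u| * (4 * M ^+ 3) * `|v|.
have key (X Y : R[i] -> V -> V) psi s : `|psi - phi| < r -> `|s - t| < r ->
    real_linear (X z0) ->
    (forall z, bounded_by M (A z) -> bounded_by M (B z) -> bounded_by M (X z)) ->
    (forall z, bounded_by M (A z) -> bounded_by M (B z) -> bounded_by M (Y z)) ->
    bounded_by (2 * M ^+ 2 * D psi s) (X z0 - X (polar psi s)) ->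
    bounded_by (2 * M ^+ 2 * D psi s) (Y z0 - Y (polar psi s)) ->
    `|ip u (X (polar psi s) (Y (polar psi s) v)) - ip u (X z0 (Y z0 v))| <= L * D psi s.
  move=> h1 h2 lX hX hY dX dY; have [_ o1 A1 B1] := hM psi s h1 h2.
  set z := polar psi s in o1 A1 B1 dX dY *.
  rewrite -(ipBr HV); apply: le_trans (re_inner_CS _ _) _.
  have -> : L * D psi s = `|u| * (4 * M ^+ 3 * D psi s * `|v|) by rewrite /L; ring.
  rewrite ler_wpM2l// distrC.
  have -> : X z0 (Y z0 v) - X z (Y z v) = X z0 ((Y z0 - Y z) v) + (X z0 - X z) (Y z v).
    by rewrite !fctE (real_linearB _ _ lX) addrA subrK.
  apply: le_trans (ler_normD _ _) _.
  have e1 : `|X z0 ((Y z0 - Y z) v)| <= M * (2 * M ^+ 2 * D psi s * `|v|).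
    by apply: le_trans (hX _ A0 B0 _) _; rewrite ler_wpM2l.
  have e2 : `|(X z0 - X z) (Y z v)| <= 2 * M ^+ 2 * D psi s * (M * `|v|).
    apply: le_trans (dX _) _; apply: ler_wpM2l; last exact: hY.
    by apply: mulr_ge0; [rewrite mulr_ge0// sqr_ge0|exact: D0].
  apply: le_trans (lerD e1 e2) _; rewrite le_eqVlt; apply/orP; left; apply/eqP; ring.
have [lA lB] := rf_linear rf o0.
have lip psi s : `|psi - phi| < r -> `|s - t| < r ->
    bounded_by (2 * M ^+ 2 * D psi s) (A z0 - A (polar psi s)) /\
    bounded_by (2 * M ^+ 2 * D psi s) (B z0 - B (polar psi s)).
  by move=> h1 h2; have [_ o1 A1 B1] := hM psi s h1 h2; exact: rf_lipschitz.
have cc (X Y : R[i] -> V -> V) : (X = A \/ X = B) -> (Y = A \/ Y = B) ->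
    {for (phi, t), continuous (fun p : R * R =>
       ip u (X (polar p.1 p.2) (Y (polar p.1 p.2) v)))}.
  move=> hX hY.
  apply: (@polar_lipschitz_continuous (fun z => ip u (X z (Y z v))) phi t L r r0).
  move=> psi s h1 h2; have [dA dB] := lip psi s h1 h2.
  apply: (key X Y) => //.
  - by case: hX => ->.
  - by move=> z ? ?; case: hX => ->.
  - by move=> z ? ?; case: hY => ->.
  - by case: hX => ->.
  - by case: hY => ->.
split.
  rewrite (_ : (fun p : R * R => _) = fun p : R * R =>
    ip u (B (polar p.1 p.2) (B (polar p.1 p.2) v)) -
    ip u (A (polar p.1 p.2) (A (polar p.1 p.2) v))).
    exact: (cvgB (cc B B (or_intror erefl) (or_intror erefl))
      (cc A A (or_introl erefl) (or_introl erefl))).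
  by apply/funext => p; rewrite cReN /scalar_resolvent2 cReD cReM /=; ring.
rewrite (_ : (fun p : R * R => _) = fun p : R * R =>
  - (ip u (B (polar p.1 p.2) (A (polar p.1 p.2) v)) +
     ip u (A (polar p.1 p.2) (B (polar p.1 p.2) v)))).
  exact: (cvgN (cvgD (cc B A (or_intror erefl) (or_introl erefl))
    (cc A B (or_introl erefl) (or_intror erefl)))).
by apply/funext => p; rewrite cImN /scalar_resolvent2 cImD cImM /=; ring.
Qed.

Lemma scalar_resolvent_holomorphic u v : holomorphic omega (pi - omega)
  (fun phi t => scalar_resolvent u v (polar phi t))
  (fun phi t => - scalar_resolvent2 u v (polar phi t) (polar phi t)).
Proof.
move=> phi t Iphi t0; have [r [M [r0 M0 hM]]] := rf_local Iphi t0.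
have [_ o0 _ _] := hM phi t ltac:(by rewrite subrr normr0) ltac:(by rewrite subrr normr0).
have [d1 d2 _ _] := @holomorphic_id R omega (pi - omega) phi t Iphi t0.
have cA := scalar_resolvent_continuous u (A (polar phi t) v) Iphi t0.
have cB := scalar_resolvent_continuous u (B (polar phi t) v) Iphi t0.
have [c1 c2] : complex_continuous (fun psi s =>
    - scalar_resolvent2 u v (polar psi s) (polar phi t)) phi t.
  have := complex_continuousM (complex_continuous_cst (-1) phi t)
    (complex_continuousD cA (complex_continuousM (complex_continuous_cst (Complex 0 1) phi t) cB)).
  by congr complex_continuous; apply/funext => p; apply/funext => s; rewrite mulN1r.
have eqn psi s : outer_sector omega (polar psi s) ->
    scalar_resolvent u v (polar psi s) - scalar_resolvent u v (polar phi t) =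
    (polar psi s - polar phi t) * - scalar_resolvent2 u v (polar psi s) (polar phi t).
  by move=> o1; rewrite (scalar_resolventE _ _ o1 o0); ring.
split.
- rewrite mul1r in d1; rewrite mulrC.
  apply: (@curve_caratheodory R _ (polar phi)
    (fun s => - scalar_resolvent2 u v (polar phi s) (polar phi t))) => //.
  + have : nbhs t (ball t r) by exact: nbhsx_ballx.
    apply: filterS => s; rewrite -ball_normE /= distrC => hs; apply: eqn.
    by have [] := hM phi s ltac:(by rewrite subrr normr0) hs.
  + apply: (@continuous_comp _ _ _ (fun s : R => (phi, s)) (fun p : R * R =>
      Re (- scalar_resolvent2 u v (polar p.1 p.2) (polar phi t)))) => //.
    by apply: pair_continuous; [exact: cst_continuous|exact: cvg_id].
  + apply: (@continuous_comp _ _ _ (fun s : R => (phi, s)) (fun p : R * R =>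
      Im (- scalar_resolvent2 u v (polar p.1 p.2) (polar phi t)))) => //.
    by apply: pair_continuous; [exact: cst_continuous|exact: cvg_id].
- rewrite mul1r in d2; apply: (curve_derive_eq (mulrC _ _)).
  refine (@curve_caratheodory R (fun psi => scalar_resolvent u v (polar psi t)) (fun x : R => polar x t)
    (fun psi => - scalar_resolvent2 u v (polar psi t) (polar phi t)) phi _ _ d2 _ _).
  + have : nbhs phi (ball phi r) by exact: nbhsx_ballx.
    apply: filterS => s; rewrite -ball_normE /= distrC => hs; apply: eqn.
    by have [] := hM s t hs ltac:(by rewrite subrr normr0).
  + apply: (@continuous_comp _ _ _ (fun psi : R => (psi, t)) (fun p : R * R =>
      Re (- scalar_resolvent2 u v (polar p.1 p.2) (polar phi t)))) => //.
    by apply: pair_continuous; [exact: cvg_id|exact: cst_continuous].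
  + apply: (@continuous_comp _ _ _ (fun psi : R => (psi, t)) (fun p : R * R =>
      Im (- scalar_resolvent2 u v (polar p.1 p.2) (polar phi t)))) => //.
    by apply: pair_continuous; [exact: cvg_id|exact: cst_continuous].
- exact: scalar_resolvent_continuous.
- exact: scalar_resolvent_sqr_continuous.
Qed.

End Family.
End ResolventFamily.

(** * The contour integral and the regularizer *)

Section LeftCalculus.
Variables (R : realType) (d : nat) (W : hilbertType R).
Local Notation V := (cliffmod d W).
Local Notation ip := (@re_inner R d W).
Local Notation Re := complex.Re.
Local Notation Im := complex.Im.
Local Notation normc := ComplexField.Normc.normc.
Implicit Types (u v w : V) (z y : R[i]) (t phi : R) (C : {set 'I_d}).

Let HV := module_hilbert d W.

Lemma Re_normc z : `|Re z| <= normc z.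
Proof.
rewrite -(@ler_pXn2r _ 2)// ?nnegrE ?normc_ge0// normc_sqr -normrX ger0_norm ?sqr_ge0//.
by rewrite lerDl sqr_ge0.
Qed.

Lemma Im_normc z : `|Im z| <= normc z.
Proof.
rewrite -(@ler_pXn2r _ 2)// ?nnegrE ?normc_ge0// normc_sqr -normrX ger0_norm ?sqr_ge0//.
by rewrite lerDr sqr_ge0.
Qed.

Lemma normc_le z : normc z <= `|Re z| + `|Im z|.
Proof.
rewrite -(@ler_pXn2r _ 2)// ?nnegrE ?normc_ge0// ?addr_ge0// normc_sqr sqrrD.
by rewrite !real_normK ?num_real// -addrA [_ *+ _ + _]addrC addrA lerDl mulrn_wge0// mulr_ge0.
Qed.

Definition two_sectors (theta phi : R) :=
  (- theta < phi < theta) || (pi - theta < phi < pi + theta).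

Lemma cos_two_sectors theta phi : 0 < theta < pi / 2 -> two_sectors theta phi ->
  cos theta < `|cos phi|.
Proof.
move=> /andP[th0 th2]; have pi0 := pi_gt0 R.
have key (psi : R) : - theta < psi < theta -> cos theta < cos psi.
  move=> /andP[h1 h2]; rewrite -(cos_norm psi).
  have hn : `|psi| < theta by rewrite ltr_norml h1.
  by rewrite ltr_cos// in_itv/=; apply/andP; split=> //; have := normr_ge0 psi; lra.
case/orP => [/key h|/andP[h1 h2]]; first exact: lt_le_trans h (ler_norm _).
have /key h : - theta < phi - pi < theta by apply/andP; split; lra.
rewrite -normrN; apply: lt_le_trans h _.
by rewrite cosB cospi sinpi mulr0 addr0 mulrN1 ler_norm.
Qed.

(** [|1 + z^2|^2 = (1 + t^2)^2 cos^2 phi + (1 - t^2)^2 sin^2 phi]. *)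
Lemma normc_1Dsqr phi t : 0 < t ->
  (1 + t ^+ 2) * `|cos phi| <= normc (1 + polar phi t ^+ 2).
Proof.
move=> t0; rewrite -(@ler_pXn2r _ 2)// ?nnegrE ?normc_ge0//; last first.
  by rewrite mulr_ge0// addr_ge0// sqr_ge0.
rewrite exprMn -normrX (ger0_norm (sqr_ge0 (cos phi))) normc_sqr [polar phi t ^+ 2]expr2.
rewrite cReD cImD cReM cImM /= -subr_ge0.
have := cos2Dsin2 phi; move: (cos phi) (sin phi) => c s h.
have -> : (1 + (t * c * (t * c) - t * s * (t * s))) ^+ 2 +
    (0 + (t * c * (t * s) + t * s * (t * c))) ^+ 2 - (1 + t * t) ^+ 2 * c ^+ 2 =
    s ^+ 2 * (1 - t ^+ 2) ^+ 2.
  have hs : s ^+ 2 = 1 - c ^+ 2 by lra.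
  have -> : (1 + (t * c * (t * c) - t * s * (t * s))) ^+ 2 +
    (0 + (t * c * (t * s) + t * s * (t * c))) ^+ 2 - (1 + t * t) ^+ 2 * c ^+ 2 =
    (1 + t ^+ 2 * (c ^+ 2 - s ^+ 2)) ^+ 2 + 4 * t ^+ 4 * c ^+ 2 * s ^+ 2 -
    (1 + t ^+ 2) ^+ 2 * c ^+ 2 by ring.
  by rewrite hs; ring.
by rewrite mulr_ge0// sqr_ge0.
Qed.

Definition damping phi t : R[i] := (1 + polar phi t ^+ 2)^-1.

Definition reg_polar phi t : R[i] := polar phi t * damping phi t.

Lemma one_sqr_neq0 theta phi t : 0 < theta < pi / 2 -> two_sectors theta phi -> 0 < t ->
  1 + polar phi t ^+ 2 != 0.
Proof.
move=> th /(cos_two_sectors th) hc t0; apply/eqP => e.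
have := normc_1Dsqr phi t0; rewrite e ComplexField.Normc.normc0 leNgt => /negP; apply.
rewrite mulr_gt0//; first by rewrite ltr_pwDl// sqr_ge0.
apply: le_lt_trans hc; apply/ltW/cos_gt0_pihalf.
by move/andP: th => [? ?]; apply/andP; split; lra.
Qed.

Lemma damping_normc theta phi t : 0 < theta < pi / 2 -> two_sectors theta phi -> 0 < t ->
  normc (damping phi t) <= (cos theta)^-1 / (1 + t ^+ 2) /\
  normc (reg_polar phi t) <= (cos theta)^-1 * (t / (1 + t ^+ 2)).
Proof.
move=> th hs t0; have hc := cos_two_sectors th hs.
have c0 : 0 < cos theta.
  by apply/cos_gt0_pihalf; move/andP: th => [? ?]; apply/andP; split; lra.
have t2 : 0 < 1 + t ^+ 2 by rewrite ltr_pwDl// sqr_ge0.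
have hd : normc (damping phi t) <= (cos theta)^-1 / (1 + t ^+ 2).
  rewrite /damping ComplexField.Normc.normcV -invfM lef_pV2 ?posrE.
  - apply: le_trans (normc_1Dsqr phi t0); rewrite mulrC ler_pM2l//; exact: ltW.
  - by apply: lt_le_trans (normc_1Dsqr phi t0); rewrite mulr_gt0// (lt_trans c0).
  - by rewrite mulr_gt0.
split=> //; rewrite /reg_polar ComplexField.Normc.normcM normc_polar//.
have -> : (cos theta)^-1 * (t / (1 + t ^+ 2)) = t * ((cos theta)^-1 / (1 + t ^+ 2)) by ring.
by rewrite ler_pM2l.
Qed.

Lemma holomorphicS (a b a' b' : R) (h h' : R -> R -> R[i]) : a <= a' -> b' <= b ->
  holomorphic a b h h' -> holomorphic a' b' h h'.
Proof.
move=> ha hb hh phi t /andP[h1 h2] t0; apply: hh => //.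
by rewrite (le_lt_trans ha h1) (lt_le_trans h2 hb).
Qed.

Definition holomorphic_on (h : R -> R -> R[i]) (a b : R) :=
  exists h', holomorphic a b h h'.

Lemma holomorphic_onM h k a b : holomorphic_on h a b -> holomorphic_on k a b ->
  holomorphic_on (fun phi t => h phi t * k phi t) a b.
Proof. by move=> [h' hh] [k' hk]; eexists; exact: (holomorphicM hh hk). Qed.

Lemma holomorphic_damping theta a b : 0 < theta < pi / 2 ->
  (forall phi, a < phi < b -> two_sectors theta phi) ->
  holomorphic_on damping a b /\ holomorphic_on reg_polar a b.
Proof.
move=> th hab.
have hid := @holomorphic_id R a b.
have h1 := holomorphicD (@holomorphic_cst R a b 1) (holomorphicM hid hid).
have hd : holomorphic_on damping a b.
  eexists; apply: (holomorphicV _ h1) => phi t Iphi t0.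
  exact: (one_sqr_neq0 th (hab _ Iphi) t0).
split=> //; apply: holomorphic_onM hd; by eexists; exact: hid.
Qed.

(** The coordinates of a slice function in a decaying class. The imaginary part
    of a slice pair is odd in [y], whence the reality on the real axis; together
    with the decay it makes the integrals over closed contours vanish. *)
Record sector_function (theta : R) (g : {set 'I_d} -> R -> R -> R[i]) : Prop := {
  sf_right_half : forall C, holomorphic_on (g C) (- theta) theta;
  sf_left_half : forall C, holomorphic_on (g C) (pi - theta) (pi + theta);
  sf_decay : exists e K, [/\ 0 < e, 0 <= K & forall C phi t,
    two_sectors theta phi -> 0 < t -> normc (g C phi t) <= K * (t * weight e t)];
  sf_real : forall C t, 0 < t -> Im (g C 0 t) = 0 /\ Im (g C pi t) = 0 }.

Lemma two_sectors_right theta phi : - theta < phi < theta -> two_sectors theta phi.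
Proof. by move=> h; rewrite /two_sectors h. Qed.

Lemma two_sectors_left theta phi : pi - theta < phi < pi + theta -> two_sectors theta phi.
Proof. by move=> h; rewrite /two_sectors h orbT. Qed.

Lemma polar_real t : Im (polar 0 t) = 0 /\ Im (polar pi t) = 0.
Proof. by rewrite /polar /= sin0 sinpi mulr0. Qed.

Lemma Im_mul_real z y : Im z = 0 -> Im y = 0 -> Im (z * y) = 0.
Proof. by move=> hz hy; rewrite cImM hz hy mulr0 mul0r addr0. Qed.

Lemma Im_inv_real z : Im z = 0 -> Im z^-1 = 0.
Proof. by move=> hz; rewrite Im_inv hz mul0r oppr0. Qed.

Lemma reg_real t : [/\ Im (reg_polar 0 t) = 0, Im (reg_polar pi t) = 0,
  Im (damping 0 t) = 0 & Im (damping pi t) = 0].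
Proof.
have [p0 p1] := polar_real t.
have d0 : Im (damping 0 t) = 0.
  by apply: Im_inv_real; rewrite cImD expr2 (Im_mul_real p0 p0) addr0.
have d1 : Im (damping pi t) = 0.
  by apply: Im_inv_real; rewrite cImD expr2 (Im_mul_real p1 p1) addr0.
by split=> //; apply: Im_mul_real.
Qed.

Definition reg_mul (g : {set 'I_d} -> R -> R -> R[i]) C phi t : R[i] :=
  reg_polar phi t * g C phi t.

Lemma half_le1 t : 0 < t -> t / (1 + t ^+ 2) <= 1 /\ t * t / (1 + t ^+ 2) <= 1.
Proof.
move=> t0; have t2 : 0 < 1 + t ^+ 2 by rewrite ltr_pwDl// sqr_ge0.
split; rewrite ler_pdivrMr// mul1r; last by rewrite -expr2 lerDr.
have := sqr_ge0 (t - 1); rewrite sqrrB; nra.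
Qed.

Lemma reg_mul_sector theta g : 0 < theta < pi / 2 ->
  sector_function theta g -> sector_function theta (reg_mul g).
Proof.
move=> th [gr gl [e [K [e0 K0 hK]]] gR].
have c0 : 0 < cos theta.
  by apply/cos_gt0_pihalf; move/andP: th => [? ?]; apply/andP; split; lra.
split.
- move=> C; apply: holomorphic_onM (gr C).
  by have [] := holomorphic_damping th (@two_sectors_right theta).
- move=> C; apply: holomorphic_onM (gl C).
  by have [] := holomorphic_damping th (@two_sectors_left theta).
- exists e, ((cos theta)^-1 * K); split=> // [|C phi t hs t0].
    by rewrite mulr_ge0// invr_ge0 ltW.
  rewrite /reg_mul ComplexField.Normc.normcM -mulrA.
  apply: ler_pM; rewrite ?normc_ge0//; last exact: hK.
  have [_ hr] := damping_normc th hs t0; apply: le_trans hr _.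
  by rewrite ler_piMr ?invr_ge0 ?(ltW c0)//; have [] := half_le1 t0.
- move=> C t t0; have [r0 r1 _ _] := reg_real t; have [g0 g1] := gR C t t0.
  by split; exact: Im_mul_real.
Qed.

(** The closed contour around each half of the double sector: the integral over
    a ray of the upper half plane can be rotated to the real axis, where the
    integrand is real. *)
Lemma ray_integral_vanish theta phi (h : R -> R -> R[i]) e K :
  0 < theta < pi / 2 -> 0 < phi < theta -> 0 < e -> 0 <= K ->
  holomorphic_on h (- theta) theta -> holomorphic_on h (pi - theta) (pi + theta) ->
  (forall psi t, two_sectors theta psi -> 0 < t -> normc (h psi t) <= K * weight e t) ->
  (forall t, 0 < t -> Im (h 0 t) = 0 /\ Im (h pi t) = 0) ->
  ray_integral h phi = 0 /\ ray_integral h (pi - phi) = 0.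
Proof.
move=> /andP[th0 th2] /andP[phi0 phith] e0 K0 [h1 hh1] [h2 hh2] hK hR.
have bnd psi t : two_sectors theta psi -> 0 < t ->
    `|Re (h psi t)| <= K * weight e t /\ `|Im (h psi t)| <= K * weight e t.
  move=> hs t0; have hb := hK psi t hs t0.
  by split; apply: le_trans hb; [exact: Re_normc|exact: Im_normc].
have zero psi : (forall t, 0 < t -> Im (h psi t * cis psi) = 0) -> ray_integral h psi = 0.
  move=> h0; rewrite -(@integrable_pos0 R).2; apply: eq_integral_pos => t t0.
  exact: h0.
split.
  rewrite -(@sector_cauchy R (- theta) theta 0 phi e K h h1)//; try lra.
    by apply: zero => t t0; rewrite cImM /= sin0 mulr0 add0r (hR t t0).1 mul0r.
  move=> psi t /andP[q0 q1] t0; apply: bnd => //.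
  by apply: two_sectors_right; apply/andP; split; lra.
rewrite (@sector_cauchy R (pi - theta) (pi + theta) (pi - phi) pi e K h h2)//; try lra.
  by apply: zero => t t0; rewrite cImM /= sinpi mulr0 add0r (hR t t0).2 mul0r.
move=> psi t /andP[q0 q1] t0; apply: bnd => //.
by apply: two_sectors_left; apply/andP; split; lra.
Qed.

Section Family.
Variables (omega : R) (A B : R[i] -> V -> V).
Hypothesis omega2 : 0 < omega < pi / 2.
Hypothesis rf : resolvent_family omega A B.
Local Notation rs := (scalar_resolvent A B).

(** The slope of a point of the outer sector leaves room for an angle [psi]
    strictly above [omega], to which the hypothesis on bounds applies. *)
Lemma rf_bounded_linear z : outer_sector omega z ->
  bounded_linear (A z) /\ bounded_linear (B z).
Proof.
move=> oz; have [lA lB] := rf_linear rf oz; case/andP: (omega2) => om0 om2.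
have z0 : 0 < normc z.
  rewrite lt_def normc_ge0 andbT; apply/eqP => e.
  by move: oz; rewrite /outer_sector /mkset e mulr0 ltNge normr_ge0.
pose c := `|Re z| / normc z; have c0 : 0 <= c by rewrite divr_ge0// normc_ge0.
have c1 : c < cos omega by rewrite ltr_pdivrMr.
have cm1 : -1 <= c <= 1.
  by rewrite (le_trans _ c0) ?lerN10//= (le_trans (ltW c1))// cos_le1.
have pi0 := pi_gt0 R.
have om_itv : omega \in `[0, pi] by rewrite in_itv/=; apply/andP; split; lra.
have a_itv : acos c \in `[0, pi] by rewrite in_itv/= acos_ge0// acos_lepi.
have h1 : omega < acos c by rewrite -(ltr_cos om_itv a_itv) acosK ?in_itv.
have h_itv : pi / 2 \in `[0, pi : R] by rewrite in_itv/=; apply/andP; split; lra.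
have h2 : acos c <= pi / 2.
  by rewrite leNgt -(ltr_cos h_itv a_itv) acosK ?in_itv// cos_pihalf -leNgt.
pose psi := (omega + acos c) / 2.
have p_itv : psi \in `[0, pi] by rewrite in_itv/= /psi; apply/andP; split; lra.
have cp : c <= cos psi.
  by rewrite -[c]acosK ?in_itv// leNgt (ltr_cos a_itv p_itv) -leNgt /psi; lra.
have [K K0 hK] := rf_bound rf (psi := psi) ltac:(by rewrite /psi; apply/andP; split; lra).
have [bA bB] := hK z z0 ltac:(by rewrite -ler_pdivrMr).
by split; split=> //; exists (K / normc z) => //; rewrite divr_ge0// normc_ge0.
Qed.

(** The bilinear form of [u] and the vectors [e_C v] weighted by the complex
    numbers [g C]: all the noncommutativity is in the vectors. *)
Definition left_form (g : {set 'I_d} -> R -> R -> R[i]) u v phi t : R[i] :=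
  \sum_C rs u (lact (cl_basis R C) v) (polar phi t) * g C phi t.

Lemma normc_sum I (r : seq I) (F : I -> R[i]) (b : I -> R) :
  (forall i, normc (F i) <= b i) -> normc (\sum_(i <- r) F i) <= \sum_(i <- r) b i.
Proof.
move=> hb; elim: r => [|i r IH].
  by rewrite !big_nil ComplexField.Normc.normc0.
by rewrite !big_cons; apply: le_trans (le_normcD _ _) _; apply: lerD.
Qed.

Lemma left_form_bound theta g phi0 phi1 : sector_function theta g ->
  omega < phi0 -> phi1 < pi - omega ->
  exists e K, [/\ 0 < e, 0 <= K & forall u v phi t, phi0 <= phi <= phi1 ->
    two_sectors theta phi -> 0 < t ->
    normc (left_form g u v phi t) <= K * `|u| * `|v| * weight e t].
Proof.
move=> [_ _ [e [K [e0 K0 hK]]] _] h0 h1.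
have [M M0 hM] := rf_uniform omega2 rf h0 h1.
exists e, (#|{set 'I_d}|%:R * (2 * M * K)); split=> //.
  by rewrite !mulr_ge0.
move=> u v phi t Iphi hs t0; have [bA bB] := hM phi t Iphi t0.
apply: (@le_trans _ _ (\sum_(C : {set 'I_d}) 2 * M * K * `|u| * `|v| * weight e t)).
  apply: normc_sum => C; rewrite ComplexField.Normc.normcM.
  have -> : 2 * M * K * `|u| * `|v| * weight e t =
     (2 * `|u| * (M / t * `|v|)) * (K * (t * weight e t)) by field; rewrite gt_eqF.
  apply: ler_pM; rewrite ?normc_ge0//; last exact: hK.
  apply: le_trans (normc_le _) _; rewrite /= -mulrA mulr_natl mulr2n.
  apply: lerD; apply: le_trans (re_inner_CS _ _) _; rewrite ler_wpM2l//.
    by apply: le_trans (bA _) _; rewrite lact_basis_norm.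
  by apply: le_trans (bB _) _; rewrite lact_basis_norm.
by rewrite sumr_const -[_ *+ _]mulr_natl le_eqVlt; apply/orP; left; apply/eqP; ring.
Qed.

Lemma holomorphic_on_sum I (r : seq I) (h : I -> R -> R -> R[i]) a b :
  (forall i, holomorphic_on (h i) a b) ->
  holomorphic_on (fun phi t => \sum_(i <- r) h i phi t) a b.
Proof.
move=> /choice[h' hh]; exists (fun phi t => \sum_(i <- r) h' i phi t).
exact: holomorphic_sum.
Qed.

Lemma left_form_holomorphic g u v a b : omega <= a -> b <= pi - omega ->
  (forall C, holomorphic_on (g C) a b) -> holomorphic_on (left_form g u v) a b.
Proof.
move=> ha hb hg; apply: holomorphic_on_sum => C; apply: holomorphic_onM (hg C).
have := scalar_resolvent_holomorphic omega2 rf u (lact (cl_basis R C) v).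
by move=> /(holomorphicS ha hb) hs; eexists; exact: hs.
Qed.

Lemma left_form_rays theta g u v phi psi : omega < theta -> theta < pi / 2 ->
  sector_function theta g ->
  omega < phi -> phi <= psi -> psi < theta ->
  ray_integral (left_form g u v) phi = ray_integral (left_form g u v) psi /\
  ray_integral (left_form g u v) (pi - phi) = ray_integral (left_form g u v) (pi - psi).
Proof.
move=> omth th2 sg omphi phipsi psith.
have om0 : 0 < omega by case/andP: omega2.
have key a b p0 p1 : omega <= a -> b <= pi - omega -> a < p0 -> p0 <= p1 -> p1 < b ->
    (forall q, a < q < b -> two_sectors theta q) ->
    (forall C, holomorphic_on (g C) a b) ->
    ray_integral (left_form g u v) p0 = ray_integral (left_form g u v) p1.
  move=> ha hb ap p01 pb hs hg.
  have [h' hh] := left_form_holomorphic u v ha hb hg.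
  have [e [K [e0 K0 hK]]] := left_form_bound (phi0 := p0) (phi1 := p1) sg
    (le_lt_trans ha ap) (lt_le_trans pb hb).
  apply: (@sector_cauchy R a b p0 p1 e (K * `|u| * `|v|) _ h') => //.
    by rewrite !mulr_ge0.
  move=> q t Iq t0; have Iq' : a < q < b.
    by move/andP: Iq => [? ?]; apply/andP; split; lra.
  have hb' := hK u v q t Iq (hs q Iq') t0.
  by split; apply: le_trans hb'; [exact: Re_normc|exact: Im_normc].
split.
  apply: (key omega theta); try lra.
    by move=> q /andP[? ?]; apply: two_sectors_right; apply/andP; split; lra.
  move=> C; have [h' hh] := sf_right_half sg C; exists h'.
  by apply: holomorphicS hh; lra.
apply/esym/(key (pi - theta) (pi - omega)); try lra.
  by move=> q /andP[? ?]; apply: two_sectors_left; apply/andP; split; lra.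
move=> C; have [h' hh] := sf_left_half sg C; exists h'.
by apply: holomorphicS hh; lra.
Qed.

Lemma outer_sector_i : outer_sector omega (Complex 0 1).
Proof.
rewrite /outer_sector /mkset /= normr0 expr0n /= add0r expr1n sqrtr1 mulr1.
exact: omega_cos.
Qed.

Lemma left_form_integrable theta g u v phi : omega < theta -> theta < pi / 2 ->
  sector_function theta g ->
  (omega < phi < theta) || (pi - theta < phi < pi - omega) ->
  integrable_pos (fun t => Im (left_form g u v phi t * cis phi)).
Proof.
move=> omth th2 sg hphi; have om0 : 0 < omega by case/andP: omega2.
have [a [b [aphi ha hb hs hg]]] : exists a b, [/\ a < phi < b, omega <= a, b <= pi - omega,
    (forall q, a < q < b -> two_sectors theta q) & forall C, holomorphic_on (g C) a b].
  case/orP: hphi => hphi; [exists omega, theta|exists (pi - theta), (pi - omega)].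
    split=> // [|q /andP[? ?]|C]; first lra.
      by apply: two_sectors_right; apply/andP; split; lra.
    by have [h' hh] := sf_right_half sg C; exists h'; apply: holomorphicS hh; lra.
  split=> // [|q /andP[? ?]|C]; first lra.
    by apply: two_sectors_left; apply/andP; split; lra.
  by have [h' hh] := sf_left_half sg C; exists h'; apply: holomorphicS hh; lra.
have [h' hh] := left_form_holomorphic u v ha hb hg.
have [e [K [e0 K0 hK]]] := @left_form_bound theta g phi phi sg ltac:(by case/andP: aphi => ? ?; lra)
  ltac:(by case/andP: aphi => ? ?; lra).
apply: (holomorphic_integrable (C := K * `|u| * `|v|) hh aphi e0) => t t0.
have hb' := hK u v phi t ltac:(by rewrite lexx) (hs _ aphi) t0.
by split; apply: le_trans hb'; [exact: Re_normc|exact: Im_normc].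
Qed.

(** The resolvent identity at i and -i, combined by the partial fractions
    z / (1 + z^2) = (1 / (z - i) + 1 / (z + i)) / 2. *)
Lemma resolvent_partial_fractions u v z : outer_sector omega z -> 1 + z ^+ 2 != 0 ->
  rs u v z * (z * (1 + z ^+ 2)^-1) =
  Complex (ip u (A (Complex 0 1) v)) 0 * (z * (1 + z ^+ 2)^-1) -
  Complex (ip u (B (Complex 0 1) v)) 0 * (1 + z ^+ 2)^-1 -
  rs (adj (A (Complex 0 1)) u) v z.
Proof.
move=> oz z0; have oi := outer_sector_i.
have [bA bB] := rf_bounded_linear oi.
have [cA cB] := rf_conj rf oi; have oiN : outer_sector omega (Complex 0 (-1)).
  by move: oi; rewrite /outer_sector /mkset /= sqrrN.
have eqi := scalar_resolventE rf u v oi oz.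
have eqiN := scalar_resolventE rf u v oiN oz.
set X := rs u v z in eqi eqiN *.
pose Y := rs (adj (A (Complex 0 1)) u) v z.
pose Z := rs (adj (B (Complex 0 1)) u) v z.
pose a := ip u (A (Complex 0 1) v); pose b := ip u (B (Complex 0 1) v).
rewrite -/Y -/a -/b.
have s2i : scalar_resolvent2 A B u v (Complex 0 1) z = Y + Complex 0 1 * Z.
  rewrite /scalar_resolvent2 /Y /Z /scalar_resolvent !adjE//.
  by apply: eq_ReIm; rewrite ?cReD ?cReM ?cImD ?cImM /=; ring.
have s2iN : scalar_resolvent2 A B u v (Complex 0 (-1)) z = Y - Complex 0 1 * Z.
  rewrite /scalar_resolvent2 /Y /Z /scalar_resolvent !adjE//.
  rewrite -[Complex 0 (-1)]/(conjc (Complex 0 1 : R[i])) cA cB.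
  by apply: eq_ReIm; rewrite ?cReD ?cReM ?cImD ?cImM ?cReN ?cImN ?cReM ?cImM /= ?(ipNr HV); ring.
rewrite s2i in eqi; rewrite s2iN in eqiN.
have i2 : Complex 0 1 * Complex 0 1 = - 1 :> R[i] by apply: eq_ReIm => /=; ring.
have eab : rs u v (Complex 0 1) = Complex a 0 + Complex 0 1 * Complex b 0.
  by apply: eq_ReIm; rewrite ?cReD ?cReM ?cImD ?cImM /= /scalar_resolvent /= /a /b; ring.
have eabN : rs u v (Complex 0 (-1)) = Complex a 0 - Complex 0 1 * Complex b 0.
  rewrite -[Complex 0 (-1)]/(conjc (Complex 0 1 : R[i])) /scalar_resolvent cA cB.
  by apply: eq_ReIm; rewrite ?cReD ?cImD ?cReN ?cImN ?cReM ?cImM /= ?(ipNr HV) /a /b; ring.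
rewrite eab in eqi; rewrite eabN in eqiN.
have iN : Complex 0 (-1) = - Complex 0 1 :> R[i] by apply: eq_ReIm => /=; ring.
rewrite iN in eqiN.
clear s2i s2iN eab eabN iN; clearbody X Y Z; clear cA cB oi oiN bA bB oz.
move: (Complex a 0) (Complex b 0) (Complex 0 1) i2 eqi eqiN => aa bb j j2 eqi eqiN.
have zz : 1 + z ^+ 2 = (z - j) * (z + j) by rewrite -[1]opprK -j2; ring.
have key : X * z - (aa * z - bb - Y * (1 + z ^+ 2)) = 0.
  have two : (2 : R[i]) != 0 by rewrite pnatr_eq0.
  apply: (mulfI two); rewrite mulr0.
  have -> : 2 * (X * z - (aa * z - bb - Y * (1 + z ^+ 2))) =
     - ((aa + j * bb - X) - (z - j) * (Y + j * Z)) * (z + j)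
     - ((aa - j * bb - X) - (z - - j) * (Y - j * Z)) * (z - j)
     + 2 * (1 + j * j) * (bb + Y) by ring.
  by rewrite eqi eqiN j2 !(subrr, oppr0, mul0r, mulr0, addr0).
move/eqP: key; rewrite subr_eq0 => /eqP key.
by rewrite mulrA key; field.
Qed.

End Family.
End LeftCalculus.

(** * Change of ray and of regularizer *)

Section LeftValue.
Variables (R : realType) (d : nat) (W : hilbertType R).
Local Notation V := (cliffmod d W).
Local Notation ip := (@re_inner R d W).
Local Notation Re := complex.Re.
Local Notation Im := complex.Im.
Local Notation normc := ComplexField.Normc.normc.
Implicit Types (u v w : V) (z y : R[i]) (t phi : R) (C : {set 'I_d}).
Implicit Types (g : {set 'I_d} -> R -> R -> R[i]).

Let HV := module_hilbert d W.

Lemma Im_sum I (r : seq I) (F : I -> R[i]) : Im (\sum_(i <- r) F i) = \sum_(i <- r) Im (F i).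
Proof. exact: (big_morph _ (@cImD R) erefl). Qed.

Lemma sector_integrable theta (h : R -> R -> R[i]) e K phi : 0 < e ->
  holomorphic_on h (- theta) theta -> holomorphic_on h (pi - theta) (pi + theta) ->
  (forall psi t, two_sectors theta psi -> 0 < t -> normc (h psi t) <= K * weight e t) ->
  two_sectors theta phi -> integrable_pos (fun t => Im (h phi t * cis phi)).
Proof.
move=> e0 [h1 hh1] [h2 hh2] hK hs.
have bnd t : 0 < t -> `|Re (h phi t)| <= K * weight e t /\ `|Im (h phi t)| <= K * weight e t.
  move=> t0; have hb := hK phi t hs t0.
  by split; apply: le_trans hb; [exact: Re_normc|exact: Im_normc].
case/orP: hs => Iphi; first exact: (holomorphic_integrable hh1 Iphi e0 bnd).
exact: (holomorphic_integrable hh2 Iphi e0 bnd).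
Qed.

(** The factors [z / (1 + z^2)] and [1 / (1 + z^2)] absorb the factor [t] by
    which [g] alone misses the integrable weight. *)
Lemma damped_sector_bound theta g : 0 < theta < pi / 2 -> sector_function theta g ->
  exists e K, [/\ 0 < e, 0 <= K & forall C phi t, two_sectors theta phi -> 0 < t ->
    normc (reg_polar phi t * g C phi t) <= K * weight e t /\
    normc (damping phi t * g C phi t) <= K * weight e t].
Proof.
move=> th [_ _ [e [K [e0 K0 hK]]] _].
have c0 : 0 < cos theta.
  by apply/cos_gt0_pihalf; move/andP: th => [? ?]; apply/andP; split; lra.
exists e, ((cos theta)^-1 * K); split=> // [|C phi t hs t0].
  by rewrite mulr_ge0// invr_ge0 ltW.
have [hd hr] := damping_normc th hs t0; have hg := hK C phi t hs t0.
have [l1 l2] := half_le1 t0; have w0 := weight_ge0 e t0.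
have q0 : 0 <= (cos theta)^-1 * K * weight e t.
  apply: mulr_ge0 => //; apply: mulr_ge0 => //; rewrite invr_ge0; exact: ltW.
rewrite !(ComplexField.Normc.normcM _ (g C phi t)); split.
  apply: le_trans (ler_pM (normc_ge0 _) (normc_ge0 _) hr hg) _.
  have -> : (cos theta)^-1 * (t / (1 + t ^+ 2)) * (K * (t * weight e t)) =
    (t * t / (1 + t ^+ 2)) * ((cos theta)^-1 * K * weight e t) by ring.
  by rewrite ler_piMl.
apply: le_trans (ler_pM (normc_ge0 _) (normc_ge0 _) hd hg) _.
have -> : (cos theta)^-1 / (1 + t ^+ 2) * (K * (t * weight e t)) =
  (t / (1 + t ^+ 2)) * ((cos theta)^-1 * K * weight e t) by ring.
by rewrite ler_piMl.
Qed.

Lemma damped_rays theta g phi C : 0 < theta < pi / 2 -> 0 < phi < theta ->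
  sector_function theta g ->
  forall (h : R -> R -> R[i]), h = (fun phi t => reg_polar phi t * g C phi t) \/
    h = (fun phi t => damping phi t * g C phi t) ->
  forall q, q = phi \/ q = pi - phi ->
    integrable_pos (fun t => Im (h q t * cis q)) /\ ray_integral h q = 0.
Proof.
move=> th hphi sg h hh q hq.
have [e [K [e0 K0 hK]]] := damped_sector_bound th sg.
have hb psi t : two_sectors theta psi -> 0 < t -> normc (h psi t) <= K * weight e t.
  by move=> hs t0; have [] := hK C psi t hs t0; case: hh => ->.
have h1 : holomorphic_on h (- theta) theta.
  have [? ?] := holomorphic_damping th (@two_sectors_right R theta).
  by case: hh => ->; apply: holomorphic_onM (sf_right_half sg C).
have h2 : holomorphic_on h (pi - theta) (pi + theta).
  have [? ?] := holomorphic_damping th (@two_sectors_left R theta).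
  by case: hh => ->; apply: holomorphic_onM (sf_left_half sg C).
have hR t : 0 < t -> Im (h 0 t) = 0 /\ Im (h pi t) = 0.
  move=> t0; have [r0 r1 d0 d1] := reg_real t; have [g0 g1] := sf_real sg C t0.
  by case: hh => ->; split; apply: Im_mul_real.
have [z1 z2] := ray_integral_vanish th hphi e0 K0 h1 h2 hb hR.
have hs : two_sectors theta q.
  case/andP: hphi => p0 p1; case: hq => ->.
    by apply: two_sectors_right; apply/andP; split; lra.
  by apply: two_sectors_left; apply/andP; split; lra.
split; first exact: (sector_integrable e0 h1 h2 hb hs).
by case: hq => ->.
Qed.

Section Family.
Variables (omega : R) (A B : R[i] -> V -> V).
Hypothesis omega2 : 0 < omega < pi / 2.
Hypothesis rf : resolvent_family omega A B.
Local Notation i := (Complex 0 1 : R[i]).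

Definition left_value g phi u v : R :=
  - pi^-1 * (ray_integral (left_form A B g u v) phi -
             ray_integral (left_form A B g u v) (pi - phi)).

(** The weak form of the integral of [S_L^(-1) ds_J g] over the boundary of the
    double sector of angle [phi], where [g] has the coordinates [g C]. *)
Definition is_left_value g phi (L : V -> V) := forall u v, ip u (L v) = left_value g phi u v.

Lemma left_value_uniq theta g phi psi L M : omega < theta -> theta < pi / 2 ->
  sector_function theta g -> omega < phi < theta -> omega < psi < theta ->
  is_left_value g phi L -> is_left_value g psi M -> L = M.
Proof.
move=> omth th2 sg hphi hpsi hL hM; apply/funext => v; apply: (ip_ext HV) => u.
rewrite hL hM /left_value; congr (_ * _).
wlog le : phi psi hphi hpsi {hL hM} / phi <= psi.
  move=> hw; case: (leP phi psi) => [|/ltW] le; first exact: hw.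
  exact/esym/hw.
case/andP: hphi => p0 p1; case/andP: hpsi => q0 q1.
by have [-> ->] := left_form_rays omega2 rf u v omth th2 sg p0 le q1.
Qed.

(** Multiplying the integrand by [z / (1 + z^2)] multiplies the integral by
    [T (1 + T^2)^(-1) = - A i]: in the partial fractions of the resolvent, the
    terms in which the resolvent is evaluated at [i] only are integrals of
    holomorphic functions, and vanish by Cauchy's theorem. *)
Lemma left_value_reg_mul theta g phi u v : omega < theta -> theta < pi / 2 ->
  sector_function theta g -> omega < phi < theta ->
  left_value (reg_mul g) phi u v = - left_value g phi (adj (A i) u) v.
Proof.
move=> omth th2 sg hphi; have [om0 om2] := andP omega2; have [p0 p1] := andP hphi.
have th : 0 < theta < pi / 2 by apply/andP; split; lra.
suff ray q : q = phi \/ q = pi - phi ->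
    ray_integral (left_form A B (reg_mul g) u v) q =
    - ray_integral (left_form A B g (adj (A i) u) v) q.
  by rewrite /left_value !ray ?(or_introl erefl) ?(or_intror erefl)//; [ring|right|left].
move=> hq.
have dr C := damped_rays (C := C) th (phi := phi) ltac:(by apply/andP; split; lra) sg.
pose a C := ip u (A i (lact (cl_basis R C) v)).
pose b C := ip u (B i (lact (cl_basis R C) v)).
have hq1 : (omega < q < theta) || (pi - theta < q < pi - omega).
  by case: hq => ->; [rewrite hphi|apply/orP; right; apply/andP; split; lra].
have hs : two_sectors theta q.
  case: hq => ->; first by apply: two_sectors_right; apply/andP; split; lra.
  by apply: two_sectors_left; apply/andP; split; lra.
have ho : omega < q < pi - omega by case/orP: hq1 => /andP[? ?]; apply/andP; split; lra.
have iL := left_form_integrable omega2 rf (adj (A i) u) v omth th2 sg hq1.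
have [iZ eZ] := integrable_posZ (-1) iL.
have iS C : integrable_pos (fun t => a C * Im (reg_polar q t * g C q t * cis q) +
      (- b C) * Im (damping q t * g C q t * cis q)) /\
    integral_pos (fun t => a C * Im (reg_polar q t * g C q t * cis q) +
      (- b C) * Im (damping q t * g C q t * cis q)) = 0.
  have [i1 e1] := dr C _ (or_introl erefl) q hq.
  have [i2 e2] := dr C _ (or_intror erefl) q hq.
  have [j1 k1] := integrable_posZ (a C) i1; have [j2 k2] := integrable_posZ (- b C) i2.
  have [j3 k3] := integrable_posD j1 j2; split=> //.
  by rewrite k3 k1 k2; rewrite /ray_integral in e1 e2; rewrite /integral_pos e1 e2 !mulr0 addr0.
have [iSS eS] := integrable_pos_sum (index_enum {set 'I_d}) iS.
have [_ eD] := integrable_posD iSS iZ.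
rewrite eS eZ big1// add0r mulN1r in eD; rewrite -[RHS]eD.
apply: eq_integral_pos => t t0.
have [oz _] := outer_sector_polar omega2 ho t0.
rewrite mulN1r -cImN -mulNr.
transitivity (Im ((\sum_C (Complex (a C) 0 * (reg_polar q t * g C q t) -
     Complex (b C) 0 * (damping q t * g C q t)) - left_form A B g (adj (A i) u) v q t) * cis q)).
  congr (Im (_ * cis q)); rewrite /left_form -sumrB; apply: eq_bigr => C _.
  rewrite /reg_mul mulrA (resolvent_partial_fractions omega2 rf u _ oz (one_sqr_neq0 th hs t0)).
  by rewrite -/(a C) -/(b C) -/(damping q t) -/(reg_polar q t); ring.
rewrite mulrDl cImD; congr (_ + _); rewrite mulr_suml Im_sum; apply: eq_bigr => C _.
rewrite mulrDl cImD mulNr cImN -[Complex _ _ * _ * _]mulrA -[Complex (b C) _ * _ * _]mulrA.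
by rewrite [in LHS]cImM [X in _ - X]cImM /= !mul0r !addr0 mulNr.
Qed.

Definition reg_operator v := - A i v.

Lemma left_value_step theta g phi L : omega < theta -> theta < pi / 2 ->
  sector_function theta g -> omega < phi < theta -> is_left_value g phi L ->
  is_left_value (reg_mul g) phi (reg_operator \o L).
Proof.
move=> omth th2 sg hphi hL u v.
have [bA _] := rf_bounded_linear omega2 rf (outer_sector_i omega2).
by rewrite (left_value_reg_mul _ _ omth) // -hL adjE// (ipNr HV).
Qed.

Lemma iter_reg_mul_sector theta g k : 0 < theta < pi / 2 ->
  sector_function theta g -> sector_function theta (iter k (@reg_mul R d) g).
Proof. by move=> th sg; elim: k => //= k IH; exact: reg_mul_sector. Qed.

Lemma left_value_iter theta g phi L k : omega < theta -> theta < pi / 2 ->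
  sector_function theta g -> omega < phi < theta -> is_left_value g phi L ->
  is_left_value (iter k (@reg_mul R d) g) phi (iter k reg_operator \o L).
Proof.
move=> omth th2 sg hphi hL; elim: k => //= k IH.
apply: (@left_value_step theta) => //; apply: iter_reg_mul_sector => //.
by rewrite th2 andbT (lt_trans _ omth)//; case/andP: omega2.
Qed.

(** Raising the power of the regularizer composes both sides with the same
    injective operator, so the relation does not see it. *)
Theorem regularizer_independence theta (o F : {set 'I_d} -> R -> R -> R[i]) phi psi m n
    (Lo Lf Mo Mf : V -> V) v w :
  omega < theta -> theta < pi / 2 -> injective reg_operator ->
  omega < phi < theta -> omega < psi < theta ->
  sector_function theta (iter m (@reg_mul R d) o) ->
  sector_function theta (iter n (@reg_mul R d) o) ->
  sector_function theta (iter m (@reg_mul R d) F) ->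
  sector_function theta (iter n (@reg_mul R d) F) ->
  is_left_value (iter m (@reg_mul R d) o) phi Lo ->
  is_left_value (iter m (@reg_mul R d) F) phi Lf ->
  is_left_value (iter n (@reg_mul R d) o) psi Mo ->
  is_left_value (iter n (@reg_mul R d) F) psi Mf ->
  Lo v = Lf w <-> Mo v = Mf w.
Proof.
move=> omth th2 iE hphi hpsi; wlog le : phi psi hphi hpsi m n Lo Lf Mo Mf / (m <= n)%N.
  move=> hw; case: (leqP m n) => [|/ltnW] le som son sfm sfn ho hf ho' hf'.
    exact: (hw phi psi _ _ m n).
  by apply: iff_sym; apply: (hw psi phi _ _ n m).
move=> som son sfm sfn ho hf ho' hf'.
have key g L M : sector_function theta (iter m (@reg_mul R d) g) ->
    sector_function theta (iter n (@reg_mul R d) g) ->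
    is_left_value (iter m (@reg_mul R d) g) phi L ->
    is_left_value (iter n (@reg_mul R d) g) psi M -> M = iter (n - m) reg_operator \o L.
  move=> sm sn hL hM.
  have := left_value_iter (n - m) omth th2 sm hphi hL; rewrite -iterD subnK// => hL'.
  exact: (left_value_uniq omth th2 sn hpsi hphi hM hL').
rewrite (key _ _ _ som son ho ho') (key _ _ _ sfm sfn hf hf') /=.
by split=> [->//|]; elim: (n - m)%N => //= k IH /iE.
Qed.

End Family.
End LeftValue.

(** * The resolvent family of a bisectorial operator *)

Section AdjointFamily.
Variables (R : realType) (d : nat) (W : hilbertType R).
Local Notation V := (cliffmod d W).
Local Notation ip := (@re_inner R d W).
Implicit Types (A B : R[i] -> V -> V) (z y : R[i]) (u v w : V).

Let HV := module_hilbert d W.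

(** Taking adjoints reverses products; the resolvent identity at [(y, z)] thus
    becomes the one at [(z, y)] for the adjoints. *)
Lemma rf_adjoint omega A B : 0 < omega < pi / 2 -> resolvent_family omega A B ->
  resolvent_family omega (fun z => adj (A z)) (fun z => adj (B z)).
Proof.
move=> om rf; have bl := rf_bounded_linear om rf.
split.
- move=> z /bl[bA bB].
  by split; [have [] := adj_bounded_linear bA|have [] := adj_bounded_linear bB].
- by move=> z oz; have [bA bB] := bl z oz; have [? ?] := rf_right rf oz; split; exact: adj_right.
- move=> psi hpsi; have [C C0 hC] := rf_bound rf hpsi; exists C => // z z0 hz.
  have oz : outer_sector omega z.
    rewrite /outer_sector /mkset; apply: le_lt_trans hz _; rewrite ltr_pM2r//.
    have pi0 := pi_gt0 R; case/andP: hpsi => ? ?; case/andP: om => ? ?.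
    by rewrite ltr_cos// in_itv/=; apply/andP; split; lra.
  have [lA lB] := rf_linear rf oz; have [bA bB] := hC z z0 hz.
  have c0 : 0 <= C / ComplexField.Normc.normc z by rewrite divr_ge0// ltW.
  by split; exact: adj_bounded_by.
- move=> z y v oz oy; have [Az Bz] := bl z oz; have [Ay By] := bl y oy.
  have rid u := rf_resolvent rf u oy oz.
  split; apply: (ip_ext HV) => u; rewrite !(ipDr HV, ipBr HV, ipZr HV, ipNr HV) !adjEr//.
    have := congr1 (ip ^~ v) (rid u).1; rewrite /= !(ipDl HV, ipBl HV, ipZl HV, ipNl HV).
    by rewrite !(cReD, cReN, cImD, cImN); lra.
  have := congr1 (ip ^~ v) (rid u).2; rewrite /= !(ipDl HV, ipBl HV, ipZl HV, ipNl HV).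
  by rewrite !(cReD, cReN, cImD, cImN); lra.
- move=> z oz; have [cA cB] := rf_conj rf oz; have [_ bB] := bl z oz.
  split; first by rewrite cA.
  rewrite cB; have [lB [C C0 hC]] := bB.
  apply: adj_uniq.
    split=> [a u v|]; first by rewrite !fctE lB opprD scalerN.
    by exists C => // v; rewrite !fctE normrN.
  by move=> u v; rewrite !fctE (ipNl HV) (ipNr HV) adjE.
Qed.

End AdjointFamily.

Section Quadratic.
Variables (R : realType) (d : nat) (W : hilbertType R).
Local Notation V := (cliffmod d W).
Local Notation Cl := (clifford R d).
Local Notation ip := (@re_inner R d W).
Local Notation Re := complex.Re.
Local Notation Im := complex.Im.
Local Notation normc := ComplexField.Normc.normc.
Implicit Types (T : set (V * V)) (q n m : V -> V) (x r : R) (u v w p a b : V).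
Implicit Types (z y : R[i]) (s J : Cl) (A B : R[i] -> V -> V).

Let HV := module_hilbert d W.

Lemma right_linearP T c p a p' a' : right_linear T -> T (p, a) -> T (p', a') ->
  T (c *: p + p', c *: a + a').
Proof.
move=> [_ hD hR] h h'; have h1 := hR _ (c *: (1 : Cl)) h; rewrite /= !ract_real in h1.
exact: hD h1 h'.
Qed.

(** The bounded inverse [q] of [T^2 - 2 x T + r], with [n = T q], [m = T^2 q]. *)
Record quadratic_resolvent T x r q n m : Prop := {
  qr_q : forall v, T (q v, n v);
  qr_n : forall v, T (n v, m v);
  qr_m : forall v, m v - (2 * x) *: n v + r *: q v = v;
  qr_inv : forall p a b, T (p, a) -> T (a, b) -> q (b - (2 * x) *: a + r *: p) = p }.

(** The operator [q] commutes with [T]: as [m p] is a combination of [q p],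
    [n p] and [p], the vector [n p] has two further images under [T], and the
    quadratic expression of [n p] comes out as [a]. *)
Lemma qr_domain T x r q n m p a : right_linear T -> single_valued T ->
  quadratic_resolvent T x r q n m -> T (p, a) -> q a = n p /\ n a = m p.
Proof.
move=> rT sT qr Tp.
pose k := a + (2 * x) *: m p - r *: n p.
have em : m p = - r *: q p + ((2 * x) *: n p + p).
  apply: (ip_ext HV) => u; have := congr1 (ip u) (qr_m qr p).
  by rewrite !(ipDr HV, ipBr HV, ipZr HV, ipNr HV); lra.
have Tm : T (m p, k).
  have h := right_linearP (- r) rT (qr_q qr p) (right_linearP (2 * x) rT (qr_n qr p) Tp).
  rewrite -em in h; suff -> : k = - r *: n p + ((2 * x) *: m p + a) by [].
  by apply: (ip_ext HV) => u; rewrite /k !(ipDr HV, ipBr HV, ipZr HV, ipNr HV); ring.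
have hq : q a = n p.
  rewrite -[RHS](qr_inv qr (qr_n qr p) Tm) /k; congr q.
  by apply: (ip_ext HV) => u; rewrite !(ipDr HV, ipBr HV, ipZr HV, ipNr HV); ring.
split=> //; apply: sT (qr_n qr p); rewrite -hq; exact: (qr_q qr).
Qed.

(** The relations of [T] with [q], [n], [m] are transposed one by one; they are
    relations between graphs, so that [adjoint T] may be multivalued. *)
Lemma quadratic_adjoint T x r q n m : right_linear T -> single_valued T ->
  bounded_linear q -> bounded_linear n -> bounded_linear m ->
  quadratic_resolvent T x r q n m ->
  quadratic_resolvent (adjoint T) x r (adj q) (adj n) (adj m).
Proof.
move=> rT sT bq bn bm qr; have dom := qr_domain rT sT qr.
rewrite adjointE//; split.
- by move=> v [p a] /= Tp; rewrite !adjE// (dom _ _ Tp).1.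
- by move=> v [p a] /= Tp; rewrite !adjE// (dom _ _ Tp).2.
- move=> v; apply: (ip_ext HV) => u; rewrite !(ipDr HV, ipBr HV, ipZr HV, ipNr HV) !adjEr//.
  by rewrite -[in RHS](qr_m qr u) !(ipDl HV, ipBl HV, ipZl HV, ipNl HV).
- move=> p a b /= Tp Ta; apply: (ip_ext HV) => u; rewrite adjEr//.
  rewrite !(ipDr HV, ipBr HV, ipZr HV, ipNr HV).
  have := Ta _ (qr_q qr u); have := Ta _ (qr_n qr u); have := Tp _ (qr_q qr u).
  have := Tp _ (qr_n qr u); rewrite /= !(ipC HV a) !(ipC HV b) !(ipC HV p) => e1 e2 e3 e4.
  rewrite e4 e1 e2 -[in RHS](qr_m qr u) !(ipDl HV, ipBl HV, ipZl HV, ipNl HV).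
  by [].
Qed.

Lemma quadratic_inverse T s q n m :
  quadratic_resolvent T (cl_re s) (`|s| ^+ 2) q n m -> rel_inv (Q_ s T) = opgraph q.
Proof.
move=> qr; apply/seteqP; split=> -[v p]; rewrite /rel_inv /opgraph /Q_ /mkset /=.
  by move=> [a [b [Tp Ta ->]]]; rewrite (qr_inv qr).
move=> ->; exists (n v), (m v); split; [exact: (qr_q qr)|exact: (qr_n qr)|].
by rewrite (qr_m qr).
Qed.

Lemma appE T v w : T (v, w) -> (forall w', T (v, w') -> w' = w) -> app T v = w.
Proof. by move=> h1 h2; apply: xget_unique. Qed.

Lemma app_opgraph (q : V -> V) v : app (opgraph q) v = q v.
Proof. by apply: appE. Qed.

Lemma SL_quadratic T s q n m v : single_valued T ->
  quadratic_resolvent T (cl_re s) (`|s| ^+ 2) q n m ->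
  SL s T v = q (lact (cl_conj s) v) - n v.
Proof.
move=> sT qr; apply: appE; rewrite /SL_rel (quadratic_inverse qr) /rel_sub /rel_comp /opgraph /mkset /=.
  exists (q (lact (cl_conj s) v)), (n v); split=> //; first by eexists.
  by exists (q v) => //; exact: (qr_q qr).
move=> w [a [b [[u -> ->] [p -> Tp] ->]]]; congr (_ - _).
by apply: sT Tp _; exact: (qr_q qr).
Qed.

Lemma SR_quadratic T s q n m v : single_valued T ->
  quadratic_resolvent T (cl_re s) (`|s| ^+ 2) q n m ->
  SR s T v = lact (cl_conj s) (q v) - n v.
Proof.
move=> sT qr; apply: appE; rewrite /SR_rel (quadratic_inverse qr) /rel_sub /rel_comp /opgraph /mkset /=.
  exists (q v) => //; exists (lact (cl_conj s) (q v)), (n v); split=> //; exact: (qr_q qr).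
move=> w [p -> [a [b [-> Tp ->]]]]; congr (_ - _).
by apply: sT Tp _; exact: (qr_q qr).
Qed.

Lemma quadratic_of_resolvent T s : closed_operator T -> resolvent_set T s ->
  exists q n m, [/\ quadratic_resolvent T (cl_re s) (`|s| ^+ 2) q n m,
    bounded_linear q, right_homogeneous q, real_linear n & right_homogeneous n].
Proof.
move=> [rT sT _] [_ [q /bounded_operatorP[bq rq] hq]].
have /choice[nm hnm] : forall v, exists nm : V * V,
    [/\ T (q v, nm.1), T (nm.1, nm.2) & v = nm.2 - (2 * cl_re s) *: nm.1 + (`|s| ^+ 2) *: q v].
  move=> v; have : opgraph q (v, q v) by [].
  by rewrite -hq => -[u [w [h1 h2 h3]]]; exists (u, w).
have T1 v : T (q v, (nm v).1) by case: (hnm v).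
exists q, (fun v => (nm v).1), (fun v => (nm v).2); split=> //.
- split=> //; try by move=> v; case: (hnm v).
  move=> p a b Tp Ta; apply/esym.
  have : rel_inv (Q_ s T) (b - (2 * cl_re s) *: a + (`|s| ^+ 2) *: p, p) by exists a, b.
  by rewrite hq.
- move=> c u v; have [lq _] := bq; apply: sT (T1 _) _; rewrite lq.
  exact: right_linearP.
- move=> v t; apply: sT (T1 _) _; rewrite rq; have [_ _ hR] := rT.
  exact: (hR _ t (T1 v)).
Qed.

Lemma quadratic_slice T z J q n m v : single_valued T -> sphere J -> real_linear q ->
  quadratic_resolvent T (Re z) (normc z ^+ 2) q n m ->
  SL (iota_slice J z) T v = Re z *: q v - n v + (- Im z) *: q (lact J v) /\
  SR (iota_slice J z) T v = Re z *: q v - n v + lact J ((- Im z) *: q v).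
Proof.
move=> sT SJ lq qr.
have qr' : quadratic_resolvent T (cl_re (iota_slice J z)) (`|iota_slice J z| ^+ 2) q n m.
  by rewrite re_iota// norm_iota.
rewrite (SL_quadratic _ sT qr') (SR_quadratic _ sT qr') iota_conj//; case: (z) => x y /=.
rewrite !iotaE /= !lactDl !lactZl !lact1 lactZr; split; last by rewrite addrAC.
by rewrite (real_linearD _ _ lq) !(real_linearZ _ _ lq) addrAC.
Qed.

Definition quadratic_family omega T A B := forall z, outer_sector omega z ->
  exists q n m, [/\ quadratic_resolvent T (Re z) (normc z ^+ 2) q n m,
    forall v, A z v = Re z *: q v - n v, forall v, B z v = - Im z *: q v &
    [/\ bounded_linear q, bounded_linear n & bounded_linear m]].

Lemma quadratic_family_adjoint omega T A B : right_linear T -> single_valued T ->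
  quadratic_family omega T A B ->
  quadratic_family omega (adjoint T) (fun z => adj (A z)) (fun z => adj (B z)).
Proof.
move=> rT sT qf z oz; have [q [n [m [qr hA hB [bq bn bm]]]]] := qf z oz.
exists (adj q), (adj n), (adj m); split; first exact: quadratic_adjoint.
- move=> v; apply: (ip_ext HV) => u.
  have bA : bounded_linear (A z).
    have -> : A z = (fun v => Re z *: q v + (- 1) *: n v + 0).
      by apply/funext => w; rewrite hA scaleN1r addr0.
    have b0 : bounded_linear (fun _ : V => 0 : V).
      by split=> [c w w'|]; [rewrite scaler0 addr0|exists 0 => // w; rewrite normr0 mul0r].
    have := bounded_linearZD (Re z) bq (bounded_linearZD (-1) bn b0).
    by congr bounded_linear; apply/funext => w; rewrite addrA.
  by rewrite adjEr// hA !(ipBr HV, ipBl HV, ipZr HV, ipZl HV) !adjEr.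
- move=> v; apply: (ip_ext HV) => u.
  have bB : bounded_linear (B z).
    have b0 : bounded_linear (fun _ : V => 0 : V).
      by split=> [c w w'|]; [rewrite scaler0 addr0|exists 0 => // w; rewrite normr0 mul0r].
    have := bounded_linearZD (- Im z) bq b0.
    by congr bounded_linear; apply/funext => w; rewrite addr0 hB.
  by rewrite adjEr// hB (ipZr HV) (ipZl HV) adjEr.
- by split; exact: adj_bounded_linear.
Qed.

Lemma SL_family omega T A B z J v : single_valued T -> quadratic_family omega T A B ->
  sphere J -> outer_sector omega z ->
  SL (iota_slice J z) T v = A z v + B z (lact J v) /\
  SR (iota_slice J z) T v = A z v + lact J (B z v).
Proof.
move=> sT qf SJ oz; have [q [n [m [qr hA hB [[lq _] _ _]]]]] := qf z oz.
by have [-> ->] := quadratic_slice v sT SJ lq qr; rewrite hA !hB.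
Qed.

End Quadratic.

Section Bisectorial.
Variables (R : realType) (d : nat) (W : hilbertType R).
Local Notation V := (cliffmod d W).
Local Notation Cl := (clifford R d).
Local Notation ip := (@re_inner R d W).
Local Notation Re := complex.Re.
Local Notation Im := complex.Im.
Local Notation normc := ComplexField.Normc.normc.
Implicit Types (T : set (V * V)) (q n m : V -> V) (x r : R) (u v w p a b : V).
Implicit Types (z y : R[i]) (s J : Cl) (A B : R[i] -> V -> V).

Let HV := module_hilbert d W.

Lemma Q_ext T s s' : cl_re s = cl_re s' -> `|s| = `|s'| -> Q_ s T = Q_ s' T.
Proof. by rewrite /Q_ => -> ->. Qed.

(** [(z - T)^(-1) - (y - T)^(-1) = (y - z) (z - T)^(-1) (y - T)^(-1)], separated
    into real and imaginary parts. Since [T] moves through [q], both sides are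
    combinations of the four vectors [q (q' v)], [n (q' v)], [q' v], [n' v]. *)
Lemma quadratic_resolvent_identity T z y (q n m q' n' m' A B A' B' : V -> V) v :
  right_linear T -> single_valued T -> real_linear q -> real_linear n ->
  quadratic_resolvent T (Re z) (normc z ^+ 2) q n m ->
  quadratic_resolvent T (Re y) (normc y ^+ 2) q' n' m' ->
  (forall v, A v = Re z *: q v - n v) -> (forall v, B v = - Im z *: q v) ->
  (forall v, A' v = Re y *: q' v - n' v) -> (forall v, B' v = - Im y *: q' v) ->
  A v - A' v = Re (y - z) *: (A (A' v) - B (B' v)) - Im (y - z) *: (A (B' v) + B (A' v)) /\
  B v - B' v = Re (y - z) *: (A (B' v) + B (A' v)) + Im (y - z) *: (A (A' v) - B (B' v)).
Proof.
move=> rT sT lq ln qr qr' hA hB hA' hB'.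
have [f1 g1] := qr_domain rT sT qr (qr_q qr' v).
have [f2 g2] := qr_domain rT sT qr (qr_n qr' v).
have em w : m w = w + (2 * Re z) *: n w - (normc z ^+ 2) *: q w.
  apply: (ip_ext HV) => u; have := congr1 (ip u) (qr_m qr w).
  by rewrite !(ipDr HV, ipBr HV, ipZr HV, ipNr HV); lra.
have qv : q v = q (m' v) - (2 * Re y) *: q (n' v) + (normc y ^+ 2) *: q (q' v).
  by rewrite -(real_linearZ _ _ lq) -(real_linearB _ _ lq) -(real_linearZ _ _ lq)
             -(real_linearD _ _ lq) (qr_m qr').
have nv : n v = n (m' v) - (2 * Re y) *: n (n' v) + (normc y ^+ 2) *: n (q' v).
  by rewrite -(real_linearZ _ _ ln) -(real_linearB _ _ ln) -(real_linearZ _ _ ln)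
             -(real_linearD _ _ ln) (qr_m qr').
rewrite !hA !hB !hA' !hB' qv nv.
rewrite !(real_linearB _ _ lq, real_linearB _ _ ln, real_linearZ _ _ lq, real_linearZ _ _ ln).
rewrite f2 g2 f1 g1 !em f1 g1 !em !normc_sqr !(cReD, cReN, cImD, cImN).
move: (q (q' v)) (n (q' v)) (q' v) (n' v) => P N p a.
by split; apply: (ip_ext HV) => u; rewrite !(ipDr HV, ipBr HV, ipZr HV, ipNr HV); ring.
Qed.

(** A point of the outer sector has a positive distance from the double sector,
    so it is outside the closure that contains the spectrum. *)
Lemma outer_resolvent omega T J z : bisectorial omega T -> sphere J ->
  outer_sector omega z -> resolvent_set T (iota_slice J z).
Proof.
move=> [_ om hS _] SJ oz; apply: contrapT => nr.
have c1 : cos omega <= 1 by exact: cos_le1.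
have c0 : 0 < cos omega by exact: omega_cos.
pose e := (cos omega * normc z - `|Re z|) / 2.
have e0 : 0 < e by rewrite divr_gt0// subr_gt0.
have [s' [[ps' s0' Ds'] bs']] : D_ d omega `&` ball (iota_slice J z) e !=set0.
  by apply: hS (nbhsx_ballx _ _ e0); split=> //; exact: paravector_iota.
have := (D_E om ps' s0').1 (And3 ps' s0' Ds').
move: bs'; rewrite -ball_normE /= => bs'.
have h1 : `|Re z| >= `|cl_re s'| - e.
  rewrite -(re_iota z SJ).
  have h := cl_re_le_norm (iota_slice J z - s').
  have -> : cl_re s' = cl_re (iota_slice J z) - cl_re (iota_slice J z - s').
    by rewrite /cl_re !ffunE; ring.
  have := ler_normB (cl_re (iota_slice J z)) (cl_re (iota_slice J z - s')).
  by have := ltW bs'; lra.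
have h2 : normc z - e <= `|s'|.
  rewrite -(norm_iota z SJ).
  have := ler_normD s' (iota_slice J z - s'); rewrite addrC subrK.
  by have := ltW bs'; lra.
rewrite ltNge => /negP; apply.
have h3 : (normc z - e) * cos omega <= `|s'| * cos omega by rewrite ler_pM2r.
have h4 : e * cos omega <= e by rewrite ler_piMr// ltW.
by apply: le_trans h3; rewrite mulrBl; move: h1 h4; rewrite /e; lra.
Qed.

(** The values of the S-resolvent at the conjugate points [x + J y], [x - J y]
    determine [A] and [B], and so their bounds. *)
Lemma bisectorial_family omega T J : bisectorial omega T -> sphere J ->
  exists A B, resolvent_family omega A B /\ quadratic_family omega T A B.
Proof.
move=> bT SJ; have [cT om _ hb] := bT; have [rT sT _] := cT.
pose q z := app (rel_inv (Q_ (iota_slice J z) T)); pose n z v := app T (q z v).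
pose A z v := Re z *: q z v - n z v; pose B z v := - Im z *: q z v.
have data z : outer_sector omega z -> exists m,
    [/\ quadratic_resolvent T (Re z) (normc z ^+ 2) (q z) (n z) m,
      bounded_linear (q z), right_homogeneous (q z), real_linear (n z) &
      right_homogeneous (n z)].
  move=> oz; have [q' [n' [m' [qr bq rq ln rn]]]] :=
    quadratic_of_resolvent cT (outer_resolvent bT SJ oz).
  have eq : q z = q'.
    by apply/funext => v; rewrite /q (quadratic_inverse qr) app_opgraph.
  have en : n z = n'.
    apply/funext => v; rewrite /n eq; apply: appE; first exact: (qr_q qr).
    by move=> w Tw; apply: sT Tw _; exact: (qr_q qr).
  by exists m'; rewrite eq en; move: qr; rewrite re_iota// norm_iota.
have rf : resolvent_family omega A B.
  split.
  - move=> z /data[m [_ [lq _] _ ln _]]; split=> c u v; rewrite /A /B lq ?ln.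
      by apply: (ip_ext HV) => w; rewrite !(ipDr HV, ipBr HV, ipZr HV, ipNr HV); ring.
    by apply: (ip_ext HV) => w; rewrite !(ipDr HV, ipBr HV, ipZr HV, ipNr HV); ring.
  - move=> z /data[m [_ _ rq _ rn]]; split=> v s; rewrite /A /B rq ?rn.
      by rewrite -ractZl -[- ract _ _]scaleN1r -ractZl -ractDl scaleN1r.
    by rewrite -ractZl.
  - move=> psi hpsi; have [C C0 hC] := hb psi hpsi; have [om0 om2] := andP om.
    have psi2 : 0 < psi < pi / 2 by case/andP: hpsi => ? ?; apply/andP; split; lra.
    have pi0 := pi_gt0 R.
    exists (C * (1 + #|{set 'I_d}|%:R)); first by rewrite mulr_ge0// addr_ge0.
    move=> z z0 hz; have oz : outer_sector omega z.
      rewrite /outer_sector /mkset; apply: le_lt_trans hz _; rewrite ltr_pM2r//.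
      by case/andP: hpsi => ? ?; rewrite ltr_cos// in_itv/=; apply/andP; split; lra.
    have [m [qr [lq _] _ ln _]] := data z oz.
    have SLb J' v : sphere J' -> `|A z v + - Im z *: q z (lact J' v)| <= C / normc z * `|v|.
      move=> SJ'; have [<- _] := quadratic_slice v sT SJ' lq qr.
      apply: (bounded_by_opnorm (A := SL (iota_slice J' z) T)).
        move=> c u w; rewrite !(quadratic_slice _ sT SJ' lq qr).1 lactDr lactZr !lq ln.
        by apply: (ip_ext HV) => t; rewrite !(ipDr HV, ipBr HV, ipZr HV, ipNr HV); ring.
      have := hC (iota_slice J' z); rewrite norm_iota//; apply.
      - exact: paravector_iota.
      - by rewrite -normr_gt0 norm_iota.
      - move=> hD; have := (D_E psi2 (paravector_iota z SJ') _).1 hD.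
        rewrite norm_iota// re_iota// ltNge mulrC hz => hh; apply: notF; apply: hh.
        by rewrite -normr_gt0 norm_iota.
    have SN := sphereN SJ; set N := #|{set 'I_d}|%:R : R.
    have N0 : 0 <= N by rewrite /N.
    have k0 : 0 <= C / normc z by rewrite divr_ge0// ltW.
    have jn v : `|lact J v| <= N * `|v|.
      by apply: le_trans (lact_norm _ _) _; case: SJ => _ _ ->; rewrite mulr1.
    have halfb (X Y Z : V) (c : R) : Z = 2^-1 *: (X + Y) -> `|X| <= c -> `|Y| <= c -> `|Z| <= c.
      move=> -> hX hY; rewrite normrZ ger0_norm ?invr_ge0//.
      by have := ler_normD X Y; lra.
    have eN v : lact (- J) v = - lact J v by exact: lactNl.
    split=> v.
      (* 2 A v = S_L(x + J y) v + S_L(x - J y) v *)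
      apply: (@le_trans _ _ (C / normc z * `|v|)); last first.
        have -> : C * (1 + N) / normc z * `|v| = (1 + N) * (C / normc z * `|v|) by ring.
        by apply: ler_peMl; [exact: mulr_ge0|lra].
      apply: (halfb _ _ _ _ _ (SLb J v SJ) (SLb (- J) v SN)).
      rewrite eN (real_linearN _ lq).
      by apply: (ip_ext HV) => t; rewrite !(ipDr HV, ipBr HV, ipZr HV, ipNr HV); field.
    (* 2 B v = S_L(x - J y) (J v) - S_L(x + J y) (J v) *)
    apply: (@le_trans _ _ (C / normc z * (N * `|v|))); last first.
      have -> : C * (1 + N) / normc z * `|v| = C / normc z * ((1 + N) * `|v|) by ring.
      by rewrite ler_wpM2l// ler_wpM2r//; lra.
    have s1 := SLb (- J) (lact J v) SN; have s2 := SLb J (lact J v) SJ.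
    have JJ : lact J (lact J v) = - v by rewrite lactA (sphere_sqr SJ) lactNl lact1.
    have le := ler_wpM2l k0 (jn v).
    rewrite -normrN in s2.
    apply: (halfb _ _ _ _ _ (le_trans s1 le) (le_trans s2 le)).
    rewrite eN JJ opprK (real_linearN _ lq) /B.
    by apply: (ip_ext HV) => t; rewrite !(ipDr HV, ipBr HV, ipZr HV, ipNr HV); field.
  - move=> z y v oz oy; have [m [qr [lq _] _ ln _]] := data z oz.
    have [m' [qr' _ _ _ _]] := data y oy.
    exact: (quadratic_resolvent_identity v rT sT lq ln qr qr').
  - move=> z oz; have eQ : Q_ (iota_slice J (conjc z)) T = Q_ (iota_slice J z) T.
      have nc : normc (conjc z) = normc z by case: (z) => x y /=; rewrite sqrrN.
      have rc : Re (conjc z) = Re z by case: (z).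
      apply: Q_ext; first by rewrite (re_iota _ SJ) (re_iota _ SJ) rc.
      by rewrite (norm_iota _ SJ) (norm_iota _ SJ) nc.
    have eqq : q (conjc z) = q z by rewrite /q eQ.
    split; apply/funext => v; rewrite /A /B ?fctE /n eqq.
      by case: (z) => x y.
    have -> : Im (conjc z) = - Im z by case: (z).
    by rewrite !scaleNr.
exists A, B; split=> // z oz; have [m [qr bq _ ln _]] := data z oz.
have [bA _] := rf_bounded_linear om rf oz.
have bn : bounded_linear (n z).
  have b0 : bounded_linear (fun _ : V => 0 : V).
    by split=> [c w w'|]; [rewrite scaler0 addr0|exists 0 => // w; rewrite normr0 mul0r].
  have := bounded_linearZD (Re z) bq (bounded_linearZD (-1) bA b0).
  congr bounded_linear; apply/funext => v; rewrite /A.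
  by apply: (ip_ext HV) => t; rewrite !(ipDr HV, ipBr HV, ipZr HV, ipNr HV, ip0r HV); ring.
exists (q z), (n z), m; split=> //; split=> //.
have bi : bounded_linear (fun v : V => v).
  by split=> //; exists 1 => // v; rewrite mul1r.
have := bounded_linearZD (2 * Re z) bn (bounded_linearZD (- normc z ^+ 2) bq bi).
congr bounded_linear; apply/funext => v; apply: (ip_ext HV) => t.
have := congr1 (ip t) (qr_m qr v); rewrite !(ipDr HV, ipBr HV, ipZr HV, ipNr HV); lra.
Qed.

End Bisectorial.

Section Density.
Variables (R : realType) (d : nat) (W : hilbertType R).
Local Notation V := (cliffmod d W).
Local Notation ip := (@re_inner R d W).
Local Notation normc := ComplexField.Normc.normc.
Implicit Types (u v w p a b : V) (t : R).

Variables (T : set (V * V)) (omega : R) (A B : R[i] -> V -> V).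
Hypothesis omega2 : 0 < omega < pi / 2.
Hypothesis rf : resolvent_family omega A B.
Hypothesis qf : quadratic_family omega T A B.
Hypothesis rT : right_linear T.
Hypothesis sT : single_valued T.
Hypothesis iT : injective_rel T.

Let HV := module_hilbert d W.

Lemma imaginary_resolvents : exists2 C, 0 <= C & forall t, 0 < t -> exists q n m,
  [/\ quadratic_resolvent T 0 (t ^+ 2) q n m, [/\ bounded_linear q, bounded_linear n & bounded_linear m],
    (forall v, A (Complex 0 t) v = - n v),
    (forall v, `|n v| <= C / t * `|v|) & (forall v, t ^+ 2 * `|q v| <= C * `|v|)].
Proof.
have [om0 om2] := andP omega2; have pi0 := pi_gt0 R.
pose psi := (omega + pi / 2) / 2.
have [C C0 hC] := rf_bound rf (psi := psi) ltac:(by rewrite /psi; apply/andP; split; lra).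
exists C => // t t0.
have nt : normc (Complex 0 t : R[i]) = t by rewrite /= expr0n /= add0r sqrtr_sqr gtr0_norm.
have cpsi : 0 <= cos psi * t.
  by rewrite mulr_ge0 ?(ltW t0)//; apply/ltW/cos_gt0_pihalf; rewrite /psi; apply/andP; split; lra.
have oz : outer_sector omega (Complex 0 t).
  by rewrite /outer_sector /mkset nt /= normr0 mulr_gt0// omega_cos.
have [bA bB] := hC (Complex 0 t) ltac:(by rewrite nt) ltac:(by rewrite nt /= normr0).
have [q [n [m [qr hA hB bnd]]]] := qf oz; rewrite nt /= in qr hA hB bA bB.
have hA' v : A (Complex 0 t) v = - n v by rewrite hA scale0r add0r.
exists q, n, m; split=> // v; first by rewrite -normrN -hA'.
have := bB v; rewrite hB normrZ normrN gtr0_norm// => h.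
rewrite expr2 -mulrA; apply: le_trans (ler_wpM2l (ltW t0) h) _.
by rewrite mulrA [t * _]mulrC divfK// gt_eqF.
Qed.

Lemma reg_operator_eq0 v : reg_operator A v = 0 -> v = 0.
Proof.
have [C _ hC] := imaginary_resolvents; have [q [n [m [qr _ hA _ _]]]] := hC 1 ltr01.
rewrite /reg_operator hA opprK => n0; have [T0 _ _] := rT.
have q0 : q v = 0 by apply: iT T0; rewrite -n0; exact: (qr_q qr).
have m0 : m v = 0 by apply: sT T0; rewrite -{1}n0; exact: (qr_n qr).
by rewrite -(qr_m qr v) q0 n0 m0 !scaler0 subr0 addr0.
Qed.

Lemma reg_operator_inj : injective (reg_operator A).
Proof.
have [bA _] := rf_bounded_linear omega2 rf (outer_sector_i omega2); have [lA _] := bA.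
move=> u v h; apply/eqP; rewrite -subr_eq0; apply/eqP/reg_operator_eq0.
by rewrite /reg_operator (real_linearB _ _ lA) opprB -[A _ v]opprK addrC -/(reg_operator A v) -h subrr.
Qed.

(** [T (1 + T^2)^(-1)] has dense range: on a vector [w] the operators
    [t^2 (t^2 + T^2)^(-1) T^2 (t^(-2) + T^2)^(-1)] take values in that range,
    stay bounded by bisectoriality, and tend to [w] after applying the
    injective operator itself. *)
Lemma reg_operator_dense w : (forall v, ip w (reg_operator A v) = 0) -> w = 0.
Proof.
move=> hw; have [C C0 hC] := imaginary_resolvents.
have [q1 [n1 [m1 [qr1 [bq1 bn1 bm1] hA1 nb1 qb1]]]] := hC 1 ltr01.
have hE v : reg_operator A v = n1 v by rewrite /reg_operator hA1 opprK.
have [ln1 _] := bn1; rewrite expr1n in qr1.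
(* The rate of convergence is K / t. *)
pose K := C * C * `|w| + (1 + C) * C * ((1 + C) * `|w|).
have K0 : 0 <= K by rewrite addr_ge0// !mulr_ge0// addr_ge0.
apply: (@orthogonal_weak_limit _ _ _ n1 (range n1) w (C * ((1 + C) * `|w|)) bn1).
- by move=> v; rewrite -hE; exact: reg_operator_eq0.
- by move=> _ [v _ <-]; rewrite -hE.
move=> e e0.
pose t := (K + 1) / e.
have t0 : 0 < t by rewrite divr_gt0// ltr_wpDl.
have [q [n [m [qr [bq bn bm] _ nb qb]]]] := hC t t0.
have ti0 : 0 < t^-1 by rewrite invr_gt0.
have [q' [n' [m' [qr' [bq' bn' bm'] _ nb' qb']]]] := hC t^-1 ti0.
have dom := qr_domain rT sT qr; have dom1 := qr_domain rT sT qr1.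
set c := m' w.
have ec : c = w - (t^-1 ^+ 2) *: q' w.
  by rewrite -{1}(qr_m qr' w) mulr0 scale0r subr0 addrK.
have cb : `|c| <= (1 + C) * `|w|.
  rewrite ec; apply: le_trans (ler_normB _ _) _; rewrite mulrDl mul1r lerD2l.
  by rewrite normrZ ger0_norm ?sqr_ge0.
have [qc nc] := dom _ _ (qr_n qr' w).
exists ((t ^+ 2) *: q c); split.
- pose X := m (n' w) + q (n' w).
  exists ((t ^+ 2) *: X) => //; rewrite (real_linearZ _ _ ln1); congr (_ *: _).
  have qX : q1 X = q (n' w).
    by rewrite -[RHS](qr_inv qr1 (qr_q qr (n' w)) (qr_n qr (n' w))) mulr0 scale0r subr0 scale1r.
  rewrite qc; apply: sT (qr_q qr (n' w)); rewrite -qX; exact: (qr_q qr1).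
- rewrite normrZ ger0_norm ?sqr_ge0//; apply: le_trans (qb c) _.
  exact: ler_wpM2l.
have -> : n1 ((t ^+ 2) *: q c) - n1 w =
    - ((t^-1 ^+ 2) *: q1 (n' w)) - m1 (n c).
  rewrite (dom1 _ _ (qr_q qr' w)).1 -(dom1 _ _ (qr_n qr c)).2.
  have -> : (t ^+ 2) *: q c = c - m c.
    by rewrite -{2}(qr_m qr c) mulr0 scale0r subr0 addrAC subrr add0r.
  have nce : n1 c = n1 w - (t^-1 ^+ 2) *: n1 (q' w).
    by rewrite {1}ec (real_linearB _ _ ln1) (real_linearZ _ _ ln1).
  rewrite (real_linearB _ _ ln1) nce.
  by apply: (ip_ext HV) => u; rewrite !(ipDr HV, ipBr HV, ipZr HV, ipNr HV); ring.
have b1 : `|(t^-1 ^+ 2) *: q1 (n' w)| <= t^-1 * (C * C * `|w|).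
  rewrite normrZ ger0_norm ?sqr_ge0//.
  have h1 := qb1 (n' w); rewrite expr1n mul1r in h1.
  have h2 := nb' w; rewrite invrK in h2.
  have h3 : `|q1 (n' w)| <= C * (C * t * `|w|) by apply: le_trans h1 _; exact: ler_wpM2l.
  apply: le_trans (ler_wpM2l (sqr_ge0 _) h3) _.
  by rewrite le_eqVlt; apply/orP; left; apply/eqP; field; rewrite gt_eqF.
have b2 : `|m1 (n c)| <= t^-1 * ((1 + C) * C * ((1 + C) * `|w|)).
  have -> : m1 (n c) = n c - q1 (n c).
    by rewrite -{2}(qr_m qr1 (n c)) mulr0 scale0r subr0 scale1r addrK.
  have h1 := qb1 (n c); rewrite expr1n mul1r in h1.
  have h2 : `|n c| <= C / t * ((1 + C) * `|w|).
    by apply: le_trans (nb c) _; apply: ler_wpM2l => //; rewrite divr_ge0// ltW.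
  apply: (@le_trans _ _ ((1 + C) * `|n c|)).
    by apply: le_trans (ler_normB _ _) _; rewrite mulrDl mul1r lerD2l.
  apply: le_trans (ler_wpM2l _ h2) _; first exact: addr_ge0.
  by rewrite le_eqVlt; apply/orP; left; apply/eqP; ring.
apply: le_lt_trans (ler_normB _ _) _; rewrite normrN.
apply: le_lt_trans (lerD b1 b2) _; rewrite -mulrDr -/K /t invf_div -mulrAC.
by rewrite ltr_pdivrMr ?ltr_wpDl// ltr_pM2l// ltrDl.
Qed.

(** The values of [T (1 + T^2)^(-1)] lie in the domain of [T], which is
    therefore dense. *)
Lemma adjoint_single_valued : single_valued (adjoint T).
Proof.
move=> w b b'; rewrite adjointE// /mkset /= => h h'.
apply/eqP; rewrite -subr_eq0; apply/eqP/reg_operator_dense => v.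
have [C _ hC] := imaginary_resolvents; have [q [n [m [qr _ hA _ _]]]] := hC 1 ltr01.
rewrite /reg_operator hA opprK (ipBl HV).
by have /= -> := h _ (qr_n qr v); have /= -> := h' _ (qr_n qr v); rewrite subrr.
Qed.

Lemma adjoint_reg_operator_inj : injective (reg_operator (fun z => adj (A z))).
Proof.
have [bA _] := rf_bounded_linear omega2 rf (outer_sector_i omega2).
have [ladj _] := adj_bounded_linear bA.
move=> u v h; apply/eqP; rewrite -subr_eq0; apply/eqP/reg_operator_dense => w.
rewrite /reg_operator (ipNr HV) -adjE// (real_linearB _ _ ladj).
by have /oppr_inj -> := h; rewrite subrr (ip0l HV) oppr0.
Qed.

End Density.

(** * The functional calculus on a contour *)

Section OperatorFamilies.
Variables (R : realType) (d : nat) (W : hilbertType R).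
Local Notation V := (cliffmod d W).
Local Notation Cl := (clifford R d).
Local Notation ip := (@re_inner R d W).
Implicit Types (P Q : R -> V -> V) (b : R -> R) (t e K omega phi : R) (s J : Cl).

Let HV := module_hilbert d W.

(** Integrands on a ray; the bound [b] is carried along so that the integrable
    weight is compared with a product only at the end. *)
Record operator_family b P : Prop := {
  of_linear : forall t, 0 < t -> bounded_linear (P t);
  of_right : forall t, 0 < t -> right_homogeneous (P t);
  of_cont : norm_continuous_family P;
  of_bound : forall t, 0 < t -> 0 <= b t /\ bounded_by (b t) (P t) }.

Lemma of_eq b P Q : operator_family b P -> (forall t v, 0 < t -> P t v = Q t v) ->
  operator_family b Q.
Proof.
move=> [lP rP cP bP] e.
have e' t : 0 < t -> Q t = P t by move=> t0; apply/funext => v; rewrite e.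
split=> t t0; rewrite ?e'//; [exact: lP|exact: rP| |exact: bP].
by move=> eps /(cP _ t0)[r r0 hr]; exists r => // s s0 hs; rewrite e'//; exact: hr.
Qed.

Lemma of_add b b' P Q : operator_family b P -> operator_family b' Q ->
  operator_family (fun t => b t + b' t) (fun t v => P t v + Q t v).
Proof.
move=> [lP rP cP bP] [lQ rQ cQ bQ]; split=> t t0.
- have := bounded_linearZD 1 (lP t t0) (lQ t t0); congr bounded_linear.
  by apply/funext => v; rewrite scale1r.
- by move=> v s; rewrite rP// rQ// ractDl.
- move=> e e0; have e2 : 0 < e / 2 by rewrite divr_gt0.
  have [r1 r10 h1] := cP t t0 _ e2; have [r2 r20 h2] := cQ t t0 _ e2.
  exists (Num.min r1 r2); first by rewrite lt_min r10.
  move=> s s0; rewrite lt_min => /andP[/(h1 _ s0) k1 /(h2 _ s0) k2] v.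
  rewrite !fctE opprD addrACA; apply: le_trans (ler_normD _ _) _.
  by rewrite [e]splitr mulrDl; exact: lerD (k1 v) (k2 v).
- have [b1 h1] := bP t t0; have [b2 h2] := bQ t t0; split; first exact: addr_ge0.
  by move=> v; apply: le_trans (ler_normD _ _) _; rewrite mulrDl; exact: lerD.
Qed.

Lemma of_comp b b' P Q : operator_family b P -> operator_family b' Q ->
  operator_family (fun t => b t * b' t) (fun t v => P t (Q t v)).
Proof.
move=> [lP rP cP bP] [lQ rQ cQ bQ]; split=> t t0.
- exact: bounded_linear_comp (lP t t0) (lQ t t0).
- by move=> v s; rewrite rQ// rP.
- move=> e e0; have [b1 h1] := bP t t0; have [b2 h2] := bQ t t0.
  have k0 : 0 < b t + b' t + 1 by rewrite ltr_wpDl// addr_ge0.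
  have e2 : 0 < e / (b t + b' t + 1) by rewrite divr_gt0.
  have [r1 r10 q1] := cP t t0 _ e2; have [r2 r20 q2] := cQ t t0 _ e2.
  have [r3 r30 q3] := cQ t t0 _ ltr01.
  exists (Num.min r1 (Num.min r2 r3)); first by rewrite !lt_min r10 r20.
  move=> s s0; rewrite !lt_min => /and3P[/(q1 _ s0) k1 /(q2 _ s0) k2 /(q3 _ s0) k3] v.
  have -> : ((fun v => P s (Q s v)) - (fun v => P t (Q t v))) v =
      (P s - P t) (Q s v) + P t ((Q s - Q t) v).
    by have [lPt _] := lP t t0; rewrite !fctE (real_linearB _ _ lPt) addrA subrK.
  have n1 : `|Q s v| <= (b' t + 1) * `|v|.
    have -> : Q s v = Q t v + (Q s - Q t) v by rewrite !fctE addrCA subrr addr0.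
    by apply: le_trans (ler_normD _ _) _; rewrite mulrDl; exact: lerD.
  have n2 : `|(P s - P t) (Q s v)| <= e / (b t + b' t + 1) * ((b' t + 1) * `|v|).
    by apply: le_trans (k1 _) _; apply: ler_wpM2l => //; exact: ltW.
  have n3 : `|P t ((Q s - Q t) v)| <= b t * (e / (b t + b' t + 1) * `|v|).
    by apply: le_trans (h1 _) _; apply: ler_wpM2l => //; exact: k2.
  apply: le_trans (ler_normD _ _) _; apply: le_trans (lerD n2 n3) _.
  by rewrite le_eqVlt; apply/orP; left; apply/eqP; field; rewrite gt_eqF.
- have [b1 h1] := bP t t0; have [b2 h2] := bQ t t0; split; first exact: mulr_ge0.
  by move=> v; apply: le_trans (h1 _) _; rewrite -mulrA; exact: ler_wpM2l.
Qed.

Lemma of_scal b (a : R -> R) s : (forall t, 0 < t -> {for t, continuous a}) ->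
  (forall t, 0 < t -> `|a t| <= b t) ->
  operator_family (fun t => #|{set 'I_d}|%:R * `|s| * b t) (fun t v => a t *: lact s v).
Proof.
move=> ca hb; pose N := #|{set 'I_d}|%:R * `|s| : R; have N0 : 0 <= N by exact: mulr_ge0.
have bs : bounded_by N (lact s : V -> V) by move=> v; exact: lact_norm.
split=> t t0.
- have := bounded_linearZD (a t) (bounded_linear_lact W s) (@bounded_linear0 R d W).
  by congr bounded_linear; apply/funext => v; rewrite addr0.
- by move=> v s'; rewrite ractZl ract_lact.
- move=> e e0; have e1 : 0 < e / (N + 1) by rewrite divr_gt0// ltr_wpDl.
  have : \forall x \near t, `|a t - a x| < e / (N + 1).
    by have /cvgrPdist_lt := ca t t0; apply.
  move=> /nbhs_ballP[r r0 hr]; exists r => // x x0 hx v.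
  have : `|a t - a x| < e / (N + 1) by apply: hr; rewrite -ball_normE /= distrC.
  rewrite !fctE -scalerBl normrZ distrC => h.
  apply: le_trans (ler_pM (normr_ge0 _) (normr_ge0 _) (ltW h) (bs v)) _.
  rewrite mulrA ler_wpM2r// -mulrA ger_pMr// mulrC ler_pdivrMr ?mul1r ?lerDl//.
  by rewrite ltr_wpDl.
- have b0 : 0 <= b t by exact: le_trans (hb t t0).
  split=> [|v]; first exact: mulr_ge0.
  rewrite normrZ -/N (_ : N * b t * `|v| = b t * (N * `|v|)); last by ring.
  exact: ler_pM (normr_ge0 _) (normr_ge0 _) (hb t t0) (bs v).
Qed.

Lemma of_lact b (c : R -> Cl) :
  (forall t A, 0 < t -> {for t, continuous (fun t => c t A)}) ->
  (forall t A, 0 < t -> `|c t A| <= b t) ->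
  operator_family (fun t => #|{set 'I_d}|%:R * b t) (fun t v => lact (c t) v).
Proof.
move=> cc hb.
have key (r : seq {set 'I_d}) : exists b', operator_family b'
    (fun t v => \sum_(A <- r) c t A *: lact (cl_basis R A) v).
  elim: r => [|A r [b' IH]].
    have h0 : operator_family (fun=> #|{set 'I_d}|%:R * `|0 : Cl| * 0)
        (fun _ v => (0 : R) *: lact (0 : Cl) v).
      by apply: (@of_scal (fun=> 0) (fun=> 0)) => t t0; [exact: cst_continuous|rewrite normr0].
    by eexists; apply: of_eq h0 _ => t v t0; rewrite big_nil scale0r.
  have h1 := @of_scal b (fun t => c t A) (cl_basis R A) (fun t => cc t A) (fun t => hb t A).
  eexists; apply: of_eq (of_add h1 IH) _ => t v t0; by rewrite big_cons.
have [b' h] := key (index_enum {set 'I_d}).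
have [lP rP cP _] : operator_family b' (fun t v => lact (c t) v).
  by apply: of_eq h _ => t v t0; rewrite [RHS]lact_sum.
split=> // t t0; have b0 : 0 <= b t by exact: le_trans (hb t finset.set0 t0).
split=> [|v]; first exact: mulr_ge0.
rewrite lact_sum; apply: le_trans (ler_norm_sum _ _ _) _.
apply: (@le_trans _ _ (\sum_(A : {set 'I_d}) b t * `|v|)).
  by apply: ler_sum => A _; rewrite normrZ lact_basis_norm; apply: ler_wpM2r => //; exact: hb.
by rewrite sumr_const -[_ *+ _]mulr_natl mulrA.
Qed.

Lemma of_lact_const J : operator_family (fun=> #|{set 'I_d}|%:R * `|J|) (fun _ v => lact J v).
Proof.
apply: (@of_lact (fun=> `|J|) (fun=> J)) => t A _; first exact: cst_continuous.
exact: cl_coord_norm.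
Qed.

Lemma of_bochner b P e K : 0 < e -> 0 <= K -> operator_family b P ->
  (forall t, 0 < t -> b t <= K * weight e t) ->
  is_weak_integral P (bochner (half_line R) P) /\
  right_homogeneous (bochner (half_line R) P) /\
  forall u v, integrable_pos (fun t => ip u (P t v)).
Proof.
move=> e0 K0 [lP rP cP bP] hb.
have hP t : 0 < t -> bounded_by (K * weight e t) (P t).
  move=> t0 v; have [_ h] := bP t t0; apply: le_trans (h v) _.
  by apply: ler_wpM2r => //; exact: hb.
have [w r] := bochner_weak e0 K0 lP rP cP hP; split=> //; split=> // u v.
exact: (weak_integrable e0 cP hP).
Qed.

Lemma rf_family omega A B phi : 0 < omega < pi / 2 -> resolvent_family omega A B ->
  omega < phi < pi - omega -> exists2 M, 0 <= M &
  operator_family (fun t => M / t) (fun t => A (polar phi t)) /\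
  operator_family (fun t => M / t) (fun t => B (polar phi t)).
Proof.
move=> om rf hphi; have [h1 h2] := andP hphi.
have [M M0 hM] := rf_uniform om rf h1 h2; exists M => //.
have lr t : 0 < t -> [/\ bounded_linear (A (polar phi t)), bounded_linear (B (polar phi t)),
    right_homogeneous (A (polar phi t)) & right_homogeneous (B (polar phi t))].
  move=> t0; have [oz _] := outer_sector_polar om hphi t0.
  by have [? ?] := rf_bounded_linear om rf oz; have [? ?] := rf_right rf oz.
have cont t e : 0 < t -> 0 < e -> exists2 r : R, 0 < r & forall s : R, 0 < s -> `|s - t| < r ->
    bounded_by e (A (polar phi s) - A (polar phi t)) /\
    bounded_by e (B (polar phi s) - B (polar phi t)).
  move=> t0 e0; have [r [K [r0 K0 hr]]] := rf_local om rf hphi t0.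
  have k0 : 0 < 4 * K ^+ 2 + 1 by rewrite ltr_wpDl// mulr_ge0// sqr_ge0.
  exists (Num.min r (e / (4 * K ^+ 2 + 1))); first by rewrite lt_min r0 divr_gt0.
  move=> s s0; rewrite lt_min => /andP[hs he].
  have pp : `|phi - phi| < r by rewrite subrr normr0.
  have [_ os As Bs] := hr phi s pp hs.
  have [_ ot At Bt] := hr phi t pp ltac:(by rewrite subrr normr0).
  have [lA lB] := rf_lipschitz rf os ot K0 As Bs At Bt.
  have le : 2 * K ^+ 2 * (`|complex.Re (polar phi t - polar phi s)| +
      `|complex.Im (polar phi t - polar phi s)|) <= e.
    have eR : `|complex.Re (polar phi t - polar phi s)| <= `|s - t|.
      rewrite cReD cReN /= -mulrBl normrM distrC ler_piMr//.
      by rewrite ler_norml cos_geN1 cos_le1.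
    have eI : `|complex.Im (polar phi t - polar phi s)| <= `|s - t|.
      rewrite cImD cImN /= -mulrBl normrM distrC ler_piMr//.
      by rewrite ler_norml sin_geN1 sin_le1.
    apply: (@le_trans _ _ ((4 * K ^+ 2 + 1) * `|s - t|)).
      have -> : (4 * K ^+ 2 + 1) * `|s - t| =
        2 * K ^+ 2 * (`|s - t| + `|s - t|) + `|s - t| by ring.
      apply: ler_wpDr => //; apply: ler_wpM2l; last exact: lerD.
      by rewrite mulr_ge0// sqr_ge0.
    by rewrite mulrC -ler_pdivlMr// ltW.
  by split=> v; [apply: le_trans (lA v) _|apply: le_trans (lB v) _]; exact: ler_wpM2r.
split; split=> t t0.
- by have [] := lr t t0.
- by have [] := lr t t0.
- by move=> e e0; have [r r0 hr] := cont t e t0 e0; exists r => // s s0 hs; have [] := hr s s0 hs.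
- by split; [rewrite divr_ge0// ltW|have [] := hM phi t ltac:(by rewrite lexx) t0].
- by have [] := lr t t0.
- by have [] := lr t t0.
- by move=> e e0; have [r r0 hr] := cont t e t0 e0; exists r => // s s0 hs; have [] := hr s s0 hs.
- by split; [rewrite divr_ge0// ltW|have [] := hM phi t ltac:(by rewrite lexx) t0].
Qed.

End OperatorFamilies.

Section Contour.
Variables (R : realType) (d : nat) (W : hilbertType R).
Local Notation V := (cliffmod d W).
Local Notation Cl := (clifford R d).
Local Notation ip := (@re_inner R d W).
Local Notation Re := complex.Re.
Local Notation Im := complex.Im.
Local Notation normc := ComplexField.Normc.normc.
Local Notation "'N" := (#|{set 'I_d}|%:R : R).
Implicit Types (u v w : V) (z : R[i]) (t phi psi sg : R) (C : {set 'I_d}) (J K : Cl).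
Implicit Types (g : Cl -> Cl) (gc : {set 'I_d} -> R -> R -> R[i]).

Let HV := module_hilbert d W.

Definition coords (h : {set 'I_d} -> R) : Cl := [ffun C => h C].

Definition left_coords theta gc g := forall K phi t, sphere K -> two_sectors theta phi -> 0 < t ->
  g (iota_slice K (polar phi t)) =
    coords (fun C => Re (gc C phi t)) + K * coords (fun C => Im (gc C phi t)).

Definition right_coords theta gc g := forall K phi t, sphere K -> two_sectors theta phi -> 0 < t ->
  g (iota_slice K (polar phi t)) =
    coords (fun C => Re (gc C phi t)) + coords (fun C => Im (gc C phi t)) * K.

(** On the ray of angle [phi] the path element is [e^(i phi) dt], so the product
    [g e^(i phi)] is what gets integrated. *)
Definition ray_re gc phi t : Cl := coords (fun C => Re (gc C phi t * cis phi)).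
Definition ray_im gc phi t : Cl := coords (fun C => Im (gc C phi t * cis phi)).

Lemma ray_re_im gc phi t :
  let G0 := coords (fun C => Re (gc C phi t)) in let G1 := coords (fun C => Im (gc C phi t)) in
  ray_re gc phi t = cos phi *: G0 - sin phi *: G1 /\
  ray_im gc phi t = sin phi *: G0 + cos phi *: G1.
Proof.
by split; apply/ffunP => C; rewrite !ffunE ?cReM ?cImM /= /GRing.scale /=;
  [rewrite mulrC [sin _ * _]mulrC | rewrite mulrC [cos _ * _]mulrC].
Qed.

Lemma left_coefficient theta gc g K phi t : left_coords theta gc g -> sphere K ->
  two_sectors theta phi -> 0 < t ->
  K * iota_slice K (cis phi) * g (iota_slice K (polar phi t)) = K * ray_re gc phi t - ray_im gc phi t.
Proof.
move=> hg SK hs t0; rewrite hg//; have [-> ->] := ray_re_im gc phi t.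
set G0 := coords _; set G1 := coords _; have KK := sphere_sqr SK.
have e : K * iota_slice K (cis phi) = cos phi *: K - sin phi *: (1 : Cl).
  by rewrite iotaE /= mulrDr -!cl_scalerAr KK mulr1 scalerN.
have e2 : K * (K * G1) = - G1 by rewrite mulrA KK mulN1r.
rewrite e mulrBl !mulrDr mulrN -!cl_scalerAl -!cl_scalerAr e2 !mul1r.
move: (K * G0) (K * G1) => p q.
by apply/ffunP => C; rewrite !ffunE /GRing.scale /=; ring.
Qed.

Lemma right_coefficient theta gc g K phi t : right_coords theta gc g -> sphere K ->
  two_sectors theta phi -> 0 < t ->
  g (iota_slice K (polar phi t)) * (K * iota_slice K (cis phi)) = ray_re gc phi t * K - ray_im gc phi t.
Proof.
move=> hg SK hs t0; rewrite hg//; have [-> ->] := ray_re_im gc phi t.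
set G0 := coords _; set G1 := coords _; have KK := sphere_sqr SK.
have e : K * iota_slice K (cis phi) = cos phi *: K - sin phi *: (1 : Cl).
  by rewrite iotaE /= mulrDr -!cl_scalerAr KK mulr1 scalerN.
have e2 : G1 * K * K = - G1 by rewrite -mulrA KK mulrN1.
rewrite e mulrBr !mulrDl mulNr -!cl_scalerAl -!cl_scalerAr e2 !mulr1.
move: (G0 * K) (G1 * K) => p q.
by apply/ffunP => C; rewrite !ffunE /GRing.scale /=; ring.
Qed.

Lemma normc_cis phi : normc (cis phi) = 1.
Proof. by rewrite /= cos2Dsin2 sqrtr1. Qed.

Lemma of_ray theta gc phi : sector_function theta gc -> two_sectors theta phi ->
  exists e k, [/\ 0 < e, 0 <= k,
    @operator_family R d W (fun t => 'N * (k * (t * weight e t))) (fun t v => lact (ray_re gc phi t) v) &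
    @operator_family R d W (fun t => 'N * (k * (t * weight e t))) (fun t v => lact (- ray_im gc phi t) v)].
Proof.
move=> [gr gl [e [k [e0 k0 hk]]] _] hs; exists e, k.
have hc t C : 0 < t -> {for t, continuous (fun t => Im (gc C phi t * cis phi))} /\
    {for t, continuous (fun t => Re (gc C phi t * cis phi))}.
  move=> t0; have [h' hh] := gr C; have [h2' hh2] := gl C.
  by case/orP: hs => Iphi; [have [_ _ cc _] := hh _ _ Iphi t0|have [_ _ cc _] := hh2 _ _ Iphi t0];
    exact: complex_continuous_radial cc.
have hb t C : 0 < t -> normc (gc C phi t * cis phi) <= k * (t * weight e t).
  by move=> t0; rewrite ComplexField.Normc.normcM normc_cis mulr1; exact: hk.
split=> //; apply: of_lact => t C t0.
- rewrite (_ : (fun t => _) = (fun t => Re (gc C phi t * cis phi))); first exact: (hc t C t0).2.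
  by apply/funext => s; rewrite ffunE.
- by rewrite ffunE; apply: le_trans (Re_normc _) (hb t C t0).
- rewrite (_ : (fun t => _) = (fun t => - Im (gc C phi t * cis phi))).
    by apply: cvgN; exact: (hc t C t0).1.
  by apply/funext => s; rewrite !ffunE.
- by rewrite !ffunE normrN; apply: le_trans (Im_normc _) (hb t C t0).
Qed.

(** The integral over a ray, up to the sign [sg] that comes from the orientation
    and from replacing [J] by [- J]. *)
Definition ray_value (L : V -> V) (k : R -> V -> V) sg :=
  [/\ bounded_linear L, right_homogeneous L, forall u v, integrable_pos (fun t => ip u (k t v)) &
      forall u v, ip u (L v) = sg * integral_pos (fun t => ip u (k t v))].

Lemma bochner_ray b (P k : R -> V -> V) e c sg : 0 < e -> 0 <= c -> sg * sg = 1 ->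
  operator_family b k -> (forall t, 0 < t -> b t <= c * weight e t) ->
  (forall t v, 0 < t -> P t v = sg *: k t v) -> ray_value (bochner (half_line R) P) k sg.
Proof.
move=> e0 c0 ss hk hb hP.
have h1 : operator_family (fun t => 'N * `|sg *: (1 : Cl)| * b t) P.
  by apply: of_eq (of_comp (of_lact_const W (sg *: (1 : Cl))) hk) _ => t v t0; rewrite lact_real hP.
have h2 t : 0 < t -> 'N * `|sg *: (1 : Cl)| * b t <= 'N * `|sg *: (1 : Cl)| * c * weight e t.
  by move=> t0; rewrite -[leRHS]mulrA; apply: ler_wpM2l; [exact: mulr_ge0|exact: hb].
have [[bL hL] [rL iL]] := of_bochner e0 (mulr_ge0 (mulr_ge0 (ler0n _ _) (normr_ge0 _)) c0) h1 h2.
have ik u v : integrable_pos (fun t => ip u (k t v)).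
  apply: (eq_integrable_pos _ (integrable_posZ sg (iL u v)).1) => t t0.
  by rewrite hP// (ipZr HV) mulrA ss mul1r.
split=> // u v; rewrite hL -(integrable_posZ sg (ik u v)).2; apply: eq_integral_pos => t t0.
by rewrite hP// (ipZr HV).
Qed.

(** The four rays are grouped in two conjugate pairs, the directions [phi] and
    [pi - phi] taken once with [J] and once with [- J]. *)
Lemma contour_value (ray : R -> V -> V) (k : Cl -> R -> R -> V -> V) J phi
    (h : R -> V -> V -> R -> R) :
  ray_value (ray phi) (k J phi) (-1) -> ray_value (ray (- phi)) (k (- J) phi) 1 ->
  ray_value (ray (pi + phi)) (k (- J) (pi - phi)) 1 ->
  ray_value (ray (pi - phi)) (k J (pi - phi)) (-1) ->
  (forall psi u v t, 0 < t ->  psi = phi \/ psi = pi - phi ->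
     ip u (k J psi t v) + ip u (k (- J) psi t v) = - 2 * h psi u v t) ->
  let L := (2 * pi)^-1 *: contour ray phi in
  [/\ bounded_linear L, right_homogeneous L & forall u v,
    ip u (L v) = - pi^-1 * (integral_pos (h phi u v) - integral_pos (h (pi - phi) u v))].
Proof.
move=> [b1 r1 i1 e1] [b2 r2 i2 e2] [b3 r3 i3 e3] [b4 r4 i4 e4] hp L.
have pi0 := pi_gt0 R.
have LE v : L v = (2 * pi)^-1 *: (- ray phi v + ray (- phi) v - ray (pi + phi) v + ray (pi - phi) v).
  by rewrite /L /contour.
split.
- split=> [a u v|].
    rewrite !LE (proj1 b1) (proj1 b2) (proj1 b3) (proj1 b4).
    by apply: (ip_ext HV) => w; rewrite !(ipDr HV, ipBr HV, ipZr HV, ipNr HV); ring.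
  have h1 := bounded_linearZD (-1) b1 (bounded_linearZD 1 b2 (bounded_linearZD (-1) b3 b4)).
  have [_ [C C0 hC]] := bounded_linearZD (2 * pi)^-1 h1 (@bounded_linear0 R d W).
  exists C => // v; apply: le_trans (hC v); rewrite LE le_eqVlt; apply/orP; left; apply/eqP.
  by congr (`| _ |); rewrite addr0 !scaleN1r scale1r !addrA.
- have ractNl (v : V) s : ract (- v) s = - ract v s by rewrite -scaleN1r ractZl scaleN1r.
  by move=> v s; rewrite !LE r1 r2 r3 r4 ractZl !(ractDl, ractNl).
move=> u v.
have pair psi : psi = phi \/ psi = pi - phi ->
    integrable_pos (fun t => ip u (k J psi t v)) -> integrable_pos (fun t => ip u (k (- J) psi t v)) ->
    integral_pos (fun t => ip u (k J psi t v)) + integral_pos (fun t => ip u (k (- J) psi t v)) =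
    - 2 * integral_pos (h psi u v).
  move=> hpsi ia ib; have [ic ec] := integrable_posD ia ib; rewrite -ec.
  have ih : integrable_pos (h psi u v).
    apply: (eq_integrable_pos _ (integrable_posZ (- 2^-1) ic).1) => t t0.
    by rewrite hp//; field.
  by rewrite -(integrable_posZ (-2) ih).2; apply: eq_integral_pos => t t0; rewrite hp.
have := pair _ (or_introl erefl) (i1 u v) (i2 u v).
have := pair _ (or_intror erefl) (i4 u v) (i3 u v).
rewrite LE !(ipZr HV, ipDr HV, ipBr HV, ipNr HV) e1 e2 e3 e4.
move: (integral_pos _) (integral_pos _) (integral_pos _) (integral_pos _) => a b c e.
move: (integral_pos _) (integral_pos _) => x y h2 h1.
have -> : - (-1 * a) + 1 * y - 1 * c + -1 * e = a + y - (e + c) by ring.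
rewrite h1 h2; have : (pi : R) != 0 by rewrite gt_eqF.
by move: (pi : R) => p p0; field.
Qed.

Lemma expJ_direct J psi : (forall t, t *: expJ J psi = iota_slice J (polar psi t)) /\
  - J * expJ J psi = (-1) *: (J * iota_slice J (cis psi)).
Proof.
split; last by rewrite scaleN1r mulNr.
by move=> t; rewrite /expJ /slice_point iotaE /= scalerDr !scalerA.
Qed.

(** A point of the lower half of the slice of [J] lies in the upper half of the
    slice of [- J]. *)
Lemma expJ_reflected J psi psi' : cos psi' = cos psi -> sin psi' = - sin psi ->
  (forall t, t *: expJ J psi' = iota_slice (- J) (polar psi t)) /\
  - J * expJ J psi' = 1 *: (- J * iota_slice (- J) (cis psi)).
Proof.
move=> hc hs; rewrite /expJ /slice_point hc hs /=; split.
  by move=> t; rewrite iotaE /= scalerDr !scalerA scalerN mulrN scaleNr.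
by rewrite scale1r iotaE /= scaleNr scalerN.
Qed.

End Contour.

Section Calculus.
Variables (R : realType) (d : nat) (W : hilbertType R).
Local Notation V := (cliffmod d W).
Local Notation Cl := (clifford R d).
Local Notation ip := (@re_inner R d W).
Local Notation Re := complex.Re.
Local Notation Im := complex.Im.
Local Notation "'N" := (#|{set 'I_d}|%:R : R).
Implicit Types (u v w : V) (z : R[i]) (t phi psi : R) (C : {set 'I_d}) (J K : Cl).
Implicit Types (g : Cl -> Cl) (A B : R[i] -> V -> V) (gc : {set 'I_d} -> R -> R -> R[i]).

Let HV := module_hilbert d W.

Lemma lact_coords (L : V -> V) (h : {set 'I_d} -> R) u v : real_linear L ->
  ip u (L (lact (coords h) v)) = \sum_C h C * ip u (L (lact (cl_basis R C) v)).
Proof.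
move=> lL; rewrite lact_sum.
elim/big_rec2 : _ => [|C y z _ <-]; first by rewrite (real_linear0 lL) (ip0r HV).
by rewrite (real_linearD _ _ lL) (real_linearZ _ _ lL) (ipDr HV) (ipZr HV) ffunE.
Qed.

Definition conj_coords (gc : {set 'I_d} -> R -> R -> R[i]) C phi t : R[i] :=
  Complex ((-1) ^+ inversions C C) 0 * gc C phi t.

Lemma Re_real_mul (a : R) z : Re (Complex a 0 * z) = a * Re z.
Proof. by rewrite cReM /= mul0r subr0. Qed.

Lemma Im_real_mul (a : R) z : Im (Complex a 0 * z) = a * Im z.
Proof. by rewrite cImM /= mul0r addr0. Qed.

Lemma ray_conj gc phi t : ray_re (conj_coords gc) phi t = cl_conj (ray_re gc phi t) /\
  ray_im (conj_coords gc) phi t = cl_conj (ray_im gc phi t).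
Proof.
by split; apply/ffunP => C; rewrite cl_conjE !ffunE -mulrA ?Re_real_mul ?Im_real_mul.
Qed.

Lemma left_form_value omega A B gc phi t u v : 0 < omega < pi / 2 ->
  resolvent_family omega A B -> omega < phi < pi - omega -> 0 < t ->
  Im (left_form A B gc u v phi t * cis phi) =
  ip u (A (polar phi t) (lact (ray_im gc phi t) v)) + ip u (B (polar phi t) (lact (ray_re gc phi t) v)).
Proof.
move=> om rf hphi t0; have [oz _] := outer_sector_polar om hphi t0.
have [lA lB] := rf_linear rf oz.
rewrite !lact_coords// mulr_suml Im_sum -big_split /=; apply: eq_bigr => C _.
by rewrite -mulrA cImM /= mulrC [Re _ * _]mulrC addrC.
Qed.

Lemma right_form_value omega A B gc phi t u v : 0 < omega < pi / 2 ->
  resolvent_family omega A B -> omega < phi < pi - omega -> 0 < t ->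
  Im (left_form (fun z => adj (A z)) (fun z => adj (B z)) (conj_coords gc) v u phi t * cis phi) =
  ip u (lact (ray_im gc phi t) (A (polar phi t) v)) + ip u (lact (ray_re gc phi t) (B (polar phi t) v)).
Proof.
move=> om rf hphi t0; have [oz _] := outer_sector_polar om hphi t0.
have [bA bB] := rf_bounded_linear om rf oz.
rewrite (left_form_value _ _ _ om (rf_adjoint om rf))// (ray_conj _ _ _).1 (ray_conj _ _ _).2.
by rewrite !adjEr// -!lact_adjoint; congr (_ + _); exact: (ipC HV).
Qed.

Variables (T : set (V * V)) (omega theta : R) (A B : R[i] -> V -> V).
Variable gc : {set 'I_d} -> R -> R -> R[i].
Hypothesis omega2 : 0 < omega < pi / 2.
Hypothesis rf : resolvent_family omega A B.
Hypothesis qf : quadratic_family omega T A B.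
Hypothesis sT : single_valued T.
Hypothesis omth : omega < theta.
Hypothesis th2 : theta < pi / 2.
Hypothesis sg : sector_function theta gc.

Definition left_kernel K phi t v :=
  let c := K * ray_re gc phi t - ray_im gc phi t in
  A (polar phi t) (lact c v) + B (polar phi t) (lact (K * c) v).

Definition right_kernel K phi t v :=
  lact (ray_re gc phi t * K - ray_im gc phi t) (A (polar phi t) v + lact K (B (polar phi t) v)).

(** With [c = J X - Y] the terms odd in [J] cancel between [J] and [- J]; what
    remains is [- 2 (A Y + B X)], the imaginary part of [(A + i B) (X + i Y)]. *)
Lemma left_kernel_pair J phi u v t : sphere J -> omega < phi < pi - omega -> 0 < t ->
  ip u (left_kernel J phi t v) + ip u (left_kernel (- J) phi t v) =
  - 2 * Im (left_form A B gc u v phi t * cis phi).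
Proof.
move=> SJ hphi t0; rewrite (left_form_value _ _ _ omega2 rf)//.
have [oz _] := outer_sector_polar omega2 hphi t0; have [lA lB] := rf_linear rf oz.
rewrite /left_kernel !mulrBr !mulrA !mulNr !mulrN opprK (sphere_sqr SJ) mulN1r opprK mul1r.
rewrite !(lactDl, lactNl).
rewrite !(real_linearD _ _ lA, real_linearN _ lA, real_linearD _ _ lB, real_linearN _ lB).
rewrite !(ipDr HV, ipNr HV); ring.
Qed.

Lemma right_kernel_pair J phi u v t : sphere J -> omega < phi < pi - omega -> 0 < t ->
  ip u (right_kernel J phi t v) + ip u (right_kernel (- J) phi t v) =
  - 2 * Im (left_form (fun z => adj (A z)) (fun z => adj (B z)) (conj_coords gc) v u phi t * cis phi).
Proof.
move=> SJ hphi t0; rewrite (right_form_value _ _ _ omega2 rf)//.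
rewrite /right_kernel !lactDr !lactA !mulrDl !mulNr !mulrN !mulNr ?opprK.
rewrite -!mulrA (sphere_sqr SJ) !mulrN1 !(lactDl, lactNl) !(ipDr HV, ipNr HV); ring.
Qed.

Lemma left_kernel_family K phi : omega < phi < pi - omega -> two_sectors theta phi ->
  exists b e c, [/\ 0 < e, 0 <= c, operator_family b (left_kernel K phi) &
    forall t, 0 < t -> b t <= c * weight e t].
Proof.
move=> hphi hs; have [M M0 [fA fB]] := rf_family omega2 rf hphi.
have [e [k [e0 k0 fX fY]]] := of_ray W sg hs.
have fK := of_lact_const W K.
have fc := of_add (of_comp fK fX) fY.
have h := of_add (of_comp fA fc) (of_comp fB (of_comp fK fc)).
eexists; exists e, (M * ('N * `|K| * ('N * k) + 'N * k) * (1 + 'N * `|K|)).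
split; [exact: e0|by rewrite !(mulr_ge0, addr_ge0)|apply: of_eq h _ => t v t0|move=> t t0].
  by rewrite /left_kernel -lactA lactBl lactNl lactA.
rewrite le_eqVlt; apply/orP; left; apply/eqP.
by rewrite /=; field; rewrite gt_eqF.
Qed.

Lemma right_kernel_family K phi : omega < phi < pi - omega -> two_sectors theta phi ->
  exists b e c, [/\ 0 < e, 0 <= c, operator_family b (right_kernel K phi) &
    forall t, 0 < t -> b t <= c * weight e t].
Proof.
move=> hphi hs; have [M M0 [fA fB]] := rf_family omega2 rf hphi.
have [e [k [e0 k0 fX fY]]] := of_ray W sg hs.
have fK := of_lact_const W K.
have fF := of_add fA (of_comp fK fB).
have h := of_add (of_comp fX (of_comp fK fF)) (of_comp fY fF).
eexists; exists e, (M * ('N * `|K| * ('N * k) + 'N * k) * (1 + 'N * `|K|)).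
split; [exact: e0|by rewrite !(mulr_ge0, addr_ge0)|apply: of_eq h _ => t v t0|move=> t t0].
  by rewrite /right_kernel lactBl lactNl lactA.
rewrite le_eqVlt; apply/orP; left; apply/eqP.
by rewrite /=; field; rewrite gt_eqF.
Qed.

Lemma left_ray g J K psi phi s : left_coords theta gc g -> sphere K ->
  omega < phi < pi - omega -> two_sectors theta phi -> s * s = 1 ->
  (forall t, t *: expJ J psi = iota_slice K (polar phi t)) /\
    - J * expJ J psi = s *: (K * iota_slice K (cis phi)) ->
  ray_value (ray_left J T g psi) (left_kernel K phi) s.
Proof.
move=> hg SK hphi hs ss [e1 e2].
have [b [e [c [e0 c0 hk hb]]]] := left_kernel_family K hphi hs.
apply: (bochner_ray e0 c0 ss hk hb) => t v t0.
have [oz _] := outer_sector_polar omega2 hphi t0; have [lA lB] := rf_linear rf oz.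
rewrite /= e1 e2 (SL_family _ sT qf SK oz).1 -cl_scalerAl (left_coefficient hg SK hs t0).
rewrite lactZl lactZr (real_linearZ _ _ lA) (real_linearZ _ _ lB) -scalerDr.
by rewrite lactA.
Qed.

Lemma right_ray g J K psi phi s : right_coords theta gc g -> sphere K ->
  omega < phi < pi - omega -> two_sectors theta phi -> s * s = 1 ->
  (forall t, t *: expJ J psi = iota_slice K (polar phi t)) /\
    - J * expJ J psi = s *: (K * iota_slice K (cis phi)) ->
  ray_value (ray_right J T g psi) (right_kernel K phi) s.
Proof.
move=> hg SK hphi hs ss [e1 e2].
have [b [e [c [e0 c0 hk hb]]]] := right_kernel_family K hphi hs.
apply: (bochner_ray e0 c0 ss hk hb) => t v t0.
have [oz _] := outer_sector_polar omega2 hphi t0.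
rewrite /= e1 e2 (SL_family _ sT qf SK oz).2 -cl_scalerAr (right_coefficient hg SK hs t0).
by rewrite lactZl.
Qed.

Lemma rays_ok phi : omega < phi < theta -> forall psi, psi = phi \/ psi = pi - phi ->
  omega < psi < pi - omega /\ two_sectors theta psi.
Proof.
move=> /andP[p0 p1] psi; case/andP: omega2 => om0 om2; have [ot t2] := (omth, th2).
case=> ->; split.
- by apply/andP; split; lra.
- by apply: two_sectors_right; apply/andP; split; lra.
- by apply/andP; split; lra.
- by apply: two_sectors_left; apply/andP; split; lra.
Qed.

Lemma reflected_angles phi : [/\ cos (- phi) = cos phi, sin (- phi) = - sin phi,
  cos (pi + phi) = cos (pi - phi) & sin (pi + phi) = - sin (pi - phi)].
Proof.
by rewrite cosN sinN cosD cosB sinD sinB cospi sinpi !mul0r !mulN1r; split=> //; ring.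
Qed.

Theorem omegaL_value g J phi : left_coords theta gc g -> sphere J -> omega < phi < theta ->
  [/\ bounded_linear (omegaL J phi T g), right_homogeneous (omegaL J phi T g) &
      is_left_value A B gc phi (omegaL J phi T g)].
Proof.
move=> hg SJ hphi; have SN := sphereN SJ; have ok := rays_ok hphi.
have [q1 s1] := ok _ (or_introl erefl); have [q2 s2] := ok _ (or_intror erefl).
have [a1 a2 a3 a4] := reflected_angles phi.
have ss : (-1) * (-1) = 1 :> R by rewrite mulrNN mulr1.
apply: (contour_value (k := left_kernel) (J := J)
  (h := fun psi u v t => Im (left_form A B gc u v psi t * cis psi))).
- exact: left_ray hg SJ q1 s1 ss (expJ_direct _ _).
- exact: left_ray hg SN q1 s1 (mulr1 _) (expJ_reflected _ a1 a2).
- exact: left_ray hg SN q2 s2 (mulr1 _) (expJ_reflected _ a3 a4).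
- exact: left_ray hg SJ q2 s2 ss (expJ_direct _ _).
- by move=> psi u v t t0 hpsi; apply: left_kernel_pair => //; have [] := ok _ hpsi.
Qed.

(** Moving the resolvent and the coefficient to the other side of the inner
    product conjugates the coefficient and reverses the order of the two: the
    adjoint of the right calculus is a left calculus of the adjoint family. *)
Theorem omegaR_value g J phi : right_coords theta gc g -> sphere J -> omega < phi < theta ->
  [/\ bounded_linear (omegaR J phi T g), right_homogeneous (omegaR J phi T g) &
      is_left_value (fun z => adj (A z)) (fun z => adj (B z)) (conj_coords gc) phi
        (adj (omegaR J phi T g))].
Proof.
move=> hg SJ hphi; have SN := sphereN SJ; have ok := rays_ok hphi.
have [q1 s1] := ok _ (or_introl erefl); have [q2 s2] := ok _ (or_intror erefl).
have [a1 a2 a3 a4] := reflected_angles phi.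
have ss : (-1) * (-1) = 1 :> R by rewrite mulrNN mulr1.
have pair psi u v t : 0 < t -> psi = phi \/ psi = pi - phi ->
    ip u (right_kernel J psi t v) + ip u (right_kernel (- J) psi t v) = - 2 *
    Im (left_form (fun z => adj (A z)) (fun z => adj (B z)) (conj_coords gc) v u psi t * cis psi).
  by move=> t0 hpsi; apply: right_kernel_pair => //; have [] := ok _ hpsi.
have [bL rL hL] := contour_value (right_ray hg SJ q1 s1 ss (expJ_direct _ _))
  (right_ray hg SN q1 s1 (mulr1 _) (expJ_reflected _ a1 a2))
  (right_ray hg SN q2 s2 (mulr1 _) (expJ_reflected _ a3 a4))
  (right_ray hg SJ q2 s2 ss (expJ_direct _ _)) pair.
split; [exact: bL|exact: rL|move=> u v].
by rewrite (adjEr _ _ bL) (ipC HV (omegaR J phi T g u) v); exact: hL.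
Qed.

End Calculus.

(** * Slice functions of polynomial growth *)

Section Growth.
Variables (R : realType) (d : nat).
Local Notation Cl := (clifford R d).
Local Notation Re := complex.Re.
Local Notation Im := complex.Im.
Local Notation normc := ComplexField.Normc.normc.
Implicit Types (z : R[i]) (t phi alpha theta : R) (C : {set 'I_d}) (J K : Cl) (m : nat).
Implicit Types (f g : Cl -> Cl) (F gc : {set 'I_d} -> R -> R -> R[i]).

Lemma one_add_expr_le (x : R) m : 0 <= x -> 1 + x ^+ m.+1 <= (1 + x) ^+ m.+1.
Proof.
move=> x0; elim: m => [|m IH]; first by rewrite !expr1.
rewrite exprS [in leRHS]exprS; have p0 := exprn_ge0 m.+1 x0.
have h : (1 + x) * (1 + x ^+ m.+1) <= (1 + x) * (1 + x) ^+ m.+1.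
  by apply: ler_wpM2l => //; exact: addr_ge0.
apply: le_trans h; rewrite mulrDl mul1r mulrDr mulr1; lra.
Qed.

(** With [a = t^m] and [b = t^alpha] the left hand side is at most
    [a (b + 1/b) / (1 + a^2)] and the weight is [a b / (a^2 + b^2)]; these are
    compared using that [b] lies between [1] and [a]. *)
Lemma regularized_growth alpha m t : 0 <= alpha -> alpha < m%:R -> 0 < t ->
  (t / (1 + t ^+ 2)) ^+ m * (t `^ alpha + t `^ (- alpha)) <= 4 * (t * weight (m%:R - alpha) t).
Proof.
case: m => [|m] al0 alm t0; first by move: (le_lt_trans al0 alm); rewrite ltxx.
have tn0 : t != 0 by rewrite gt_eqF.
have t20 : 0 < 1 + t ^+ 2 by rewrite ltr_pwDl// sqr_ge0.
set a := t ^+ m.+1; set b := t `^ alpha.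
have a0 : 0 < a by rewrite exprn_gt0.
have b0 : 0 < b by exact: powR_gt0.
have eE : t `^ (m.+1%:R - alpha) = a / b.
  by rewrite powRB ?tn0 ?implybT// powR_mulrn// ltW.
have aa : 0 < 1 + a ^+ 2 by rewrite ltr_pwDl// sqr_ge0.
have h1 : (t / (1 + t ^+ 2)) ^+ m.+1 <= a / (1 + a ^+ 2).
  rewrite expr_div_n -/a ler_pM2l// lef_pV2 ?posrE ?exprn_gt0//.
  by have := one_add_expr_le m (sqr_ge0 t); rewrite /a -!exprM mulnC.
rewrite /weight eE powRN -/b.
have -> : t * (a / b / (1 + (a / b) ^+ 2) / t) = a * b / (a ^+ 2 + b ^+ 2).
  have abn : a ^+ 2 + b ^+ 2 != 0 by rewrite gt_eqF// addr_gt0// exprn_gt0.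
  have bn : b != 0 by rewrite gt_eqF.
  have -> : 1 + (a / b) ^+ 2 = (a ^+ 2 + b ^+ 2) / b ^+ 2 by field.
  by field; rewrite tn0 bn abn.
have bb : 0 < b + b^-1 by rewrite addr_gt0// invr_gt0.
apply: le_trans (ler_wpM2r (ltW bb) h1) _.
have ab : 0 < a ^+ 2 + b ^+ 2 by rewrite addr_gt0// exprn_gt0.
suff key : (b ^+ 2 + 1) * (a ^+ 2 + b ^+ 2) <= 4 * b ^+ 2 * (1 + a ^+ 2).
  have abn : a ^+ 2 + b ^+ 2 != 0 by rewrite gt_eqF.
  have bn : b != 0 by rewrite gt_eqF.
  have aan : 1 + a ^+ 2 != 0 by rewrite gt_eqF.
  pose c := a / ((a ^+ 2 + b ^+ 2) * (b * (1 + a ^+ 2))).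
  have -> : a / (1 + a ^+ 2) * (b + b^-1) = (b ^+ 2 + 1) * (a ^+ 2 + b ^+ 2) * c.
    by rewrite /c; field; rewrite abn bn aan.
  have -> : 4 * (a * b / (a ^+ 2 + b ^+ 2)) = 4 * b ^+ 2 * (1 + a ^+ 2) * c.
    by rewrite /c; field; rewrite abn bn aan.
  by apply: ler_wpM2r => //; rewrite divr_ge0 ?mulr_ge0 ?ltW.
have [t1|t1] := leP 1 t.
  have b1 : 1 <= b by rewrite -(powRr0 t) ler_powR.
  have ba : b <= a by rewrite /a -powR_mulrn ?(ltW t0)// ler_powR// ltW.
  have b2 : b ^+ 2 <= a ^+ 2 by rewrite ler_pXn2r// nnegrE ltW.
  have b3 : 1 <= b ^+ 2 by rewrite exprn_ege1.
  by nra.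
have b1 : b <= 1 by rewrite -(powRr0 t) ger_powR// t0 ltW.
have ba : a <= b by rewrite /a -powR_mulrn ?(ltW t0)// ger_powR ?t0 ?ltW.
have b2 : a ^+ 2 <= b ^+ 2 by rewrite ler_pXn2r// nnegrE ltW.
have b3 : b ^+ 2 <= 1 by rewrite exprn_ile1// ltW.
by have a2 := sqr_ge0 a; nra.
Qed.

(** On the double sector [|1 + z^2|] is at least [cos theta (1 + t^2)], so the
    regularizer of order [m] decays like the [m]-th power of min(t, 1/t). *)
Lemma regularized_sector theta alpha m k F : 0 < theta < pi / 2 -> 0 <= alpha ->
  alpha < m%:R -> 0 <= k ->
  (forall C, holomorphic_on (F C) (- theta) theta) ->
  (forall C, holomorphic_on (F C) (pi - theta) (pi + theta)) ->
  (forall C phi t, two_sectors theta phi -> 0 < t ->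
     normc (F C phi t) <= k * (t `^ alpha + t `^ (- alpha))) ->
  (forall C t, 0 < t -> Im (F C 0 t) = 0 /\ Im (F C pi t) = 0) ->
  sector_function theta (iter m (@reg_mul R d) F).
Proof.
move=> th al0 alm k0 Fr Fl Fb FR.
have c0 : 0 < cos theta.
  by apply/cos_gt0_pihalf; move/andP: th => [? ?]; apply/andP; split; lra.
split.
- have [_ hr] := holomorphic_damping th (@two_sectors_right R theta).
  by move=> C; elim: (m) => [//|n IH] /=; exact: holomorphic_onM hr IH.
- have [_ hr] := holomorphic_damping th (@two_sectors_left R theta).
  by move=> C; elim: (m) => [//|n IH] /=; exact: holomorphic_onM hr IH.
- exists (m%:R - alpha), ((cos theta)^-1 ^+ m * k * 4); split.
  + by rewrite subr_gt0.
  + by rewrite !mulr_ge0// exprn_ge0// invr_ge0 ltW.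
  move=> C phi t hs t0; have [_ hr] := damping_normc th hs t0.
  have key n : normc (iter n (@reg_mul R d) F C phi t) <=
      ((cos theta)^-1 * (t / (1 + t ^+ 2))) ^+ n * (k * (t `^ alpha + t `^ (- alpha))).
    elim: n => [|n IH]; first by rewrite expr0 mul1r; exact: Fb.
    rewrite [iter _ _ _]/= {1}/reg_mul ComplexField.Normc.normcM exprS -mulrA.
    exact: (ler_pM (normc_ge0 _) (normc_ge0 _) hr IH).
  apply: le_trans (key m) _; rewrite exprMn.
  have := regularized_growth al0 alm t0; set x := _ ^+ m * _; move=> hx.
  have -> : (cos theta)^-1 ^+ m * (t / (1 + t ^+ 2)) ^+ m * (k * (t `^ alpha + t `^ (- alpha))) =
    (cos theta)^-1 ^+ m * k * x by rewrite /x; ring.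
  rewrite -[leRHS]mulrA; apply: ler_wpM2l => //.
  by rewrite mulr_ge0// exprn_ge0// invr_ge0 ltW.
- move=> C t t0; have [r0 r1 _ _] := reg_real t; have [f0 f1] := FR C t t0.
  elim: (m) => [//|n [h0 h1]] /=.
  by split; exact: Im_mul_real.
Qed.

(** The constant 1, which makes the regularizer itself an instance of a
    regularized function. *)
Definition one_coords C phi t : R[i] := (C == finset.set0)%:R.

Lemma one_sector theta m : 0 < theta < pi / 2 -> (0 < m)%N ->
  sector_function theta (iter m (@reg_mul R d) one_coords).
Proof.
move=> th m0; apply: (@regularized_sector theta 0 m 1) => //.
- by rewrite ltr0n.
- by move=> C; eexists; exact: holomorphic_cst.
- by move=> C; eexists; exact: holomorphic_cst.
- move=> C phi t _ t0; rewrite oppr0 powRr0 /one_coords mul1r.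
  by case: (C == finset.set0); rewrite ?ComplexField.Normc.normc0 ?ComplexField.Normc.normc1//; lra.
- by move=> C t _; rewrite /one_coords; case: (C == finset.set0).
Qed.

Lemma one_left_coords theta : left_coords theta one_coords (fun _ => 1).
Proof.
move=> K phi t _ _ _.
have -> : coords (fun C => Re (one_coords C phi t)) = 1.
  by apply/ffunP => C; rewrite !ffunE /one_coords; case: (C == finset.set0).
have -> : coords (fun C => Im (one_coords C phi t)) = 0.
  by apply/ffunP => C; rewrite !ffunE /one_coords; case: (C == finset.set0).
by rewrite mulr0 addr0.
Qed.

Lemma one_right_coords theta : right_coords theta one_coords (fun _ => 1).
Proof.
move=> K phi t SK hs t0; have := one_left_coords SK hs t0 => ->.
have -> : coords (fun C => Im (one_coords C phi t)) = 0.
  by apply/ffunP => C; rewrite !ffunE /one_coords; case: (C == finset.set0).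
by rewrite mulr0 mul0r.
Qed.

Lemma iter_reg_mulE m F C phi t : iter m (@reg_mul R d) F C phi t = reg_polar phi t ^+ m * F C phi t.
Proof. by elim: m => [|m IH] /=; rewrite ?mul1r// /reg_mul IH exprS mulrA. Qed.

Lemma regularizer_polar K m phi t : sphere K ->
  regularizer m (iota_slice K (polar phi t)) = iota_slice K (reg_polar phi t ^+ m).
Proof. by move=> SK; rewrite regularizer_iota. Qed.

Lemma coords_mul z (F : {set 'I_d} -> R[i]) :
  coords (fun C => Re (z * F C)) = Re z *: coords (fun C => Re (F C)) - Im z *: coords (fun C => Im (F C)) /\
  coords (fun C => Im (z * F C)) = Re z *: coords (fun C => Im (F C)) + Im z *: coords (fun C => Re (F C)).
Proof. by split; apply/ffunP => C; rewrite !ffunE ?cReM ?cImM. Qed.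

Lemma regularized_left theta m F f : left_coords theta F f ->
  left_coords theta (iter m (@reg_mul R d) F) (fun s => regularizer m s * f s).
Proof.
move=> hf K phi t SK hs t0; rewrite regularizer_polar// hf//.
have [eR eI] := coords_mul (reg_polar phi t ^+ m) (fun C => F C phi t).
have -> : (fun C => Re (iter m (@reg_mul R d) F C phi t)) = (fun C => Re (reg_polar phi t ^+ m * F C phi t)).
  by apply/funext => C; rewrite iter_reg_mulE.
have -> : (fun C => Im (iter m (@reg_mul R d) F C phi t)) = (fun C => Im (reg_polar phi t ^+ m * F C phi t)).
  by apply/funext => C; rewrite iter_reg_mulE.
rewrite eR eI iotaE.
set G0 := coords _; set G1 := coords _; set x := Re _; set y := Im _.
have e2 : K * (K * G1) = - G1 by rewrite mulrA (sphere_sqr SK) mulN1r.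
rewrite mulrDl !mulrDr -!cl_scalerAl -!cl_scalerAr e2 !mul1r.
move: (K * G0) (K * G1) => p q.
by apply/ffunP => C; rewrite !ffunE /GRing.scale /=; ring.
Qed.

Lemma regularized_right theta m F f : right_coords theta F f ->
  right_coords theta (iter m (@reg_mul R d) F) (fun s => f s * regularizer m s).
Proof.
move=> hf K phi t SK hs t0; rewrite regularizer_polar// hf//.
have [eR eI] := coords_mul (reg_polar phi t ^+ m) (fun C => F C phi t).
have -> : (fun C => Re (iter m (@reg_mul R d) F C phi t)) = (fun C => Re (reg_polar phi t ^+ m * F C phi t)).
  by apply/funext => C; rewrite iter_reg_mulE.
have -> : (fun C => Im (iter m (@reg_mul R d) F C phi t)) = (fun C => Im (reg_polar phi t ^+ m * F C phi t)).
  by apply/funext => C; rewrite iter_reg_mulE.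
rewrite eR eI iotaE.
set G0 := coords _; set G1 := coords _; set x := Re _; set y := Im _.
have e2 : G1 * K * K = - G1 by rewrite -mulrA (sphere_sqr SK) mulrN1.
rewrite mulrDr !mulrDl -!cl_scalerAl -!cl_scalerAr e2 !mulr1.
move: (G0 * K) (G1 * K) => p q.
by apply/ffunP => C; rewrite !ffunE /GRing.scale /=; ring.
Qed.

Lemma conj_coordsK F : conj_coords (conj_coords F) = F.
Proof.
apply/funext => C; apply/funext => phi; apply/funext => t; rewrite /conj_coords mulrA.
have -> : Complex ((-1) ^+ inversions C C) 0 * Complex ((-1) ^+ inversions C C) 0 = 1 :> R[i].
  by apply: eq_ReIm; rewrite ?cReM ?cImM /= ?mulr0 ?mul0r ?subr0 ?addr0 ?sign_diag.
by rewrite mul1r.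
Qed.

Lemma conj_coords_iter m F :
  conj_coords (iter m (@reg_mul R d) F) = iter m (@reg_mul R d) (conj_coords F).
Proof.
apply/funext => C; apply/funext => phi; apply/funext => t.
by rewrite iter_reg_mulE /conj_coords iter_reg_mulE mulrCA.
Qed.

Lemma conj_one_coords : conj_coords one_coords = one_coords.
Proof.
apply/funext => C; apply/funext => phi; apply/funext => t; rewrite /conj_coords /one_coords.
by case: eqP => [->|_]; rewrite ?mulr0// inversions0l expr0 mulr1.
Qed.

Lemma conj_sector theta F : sector_function theta F -> sector_function theta (conj_coords F).
Proof.
move=> [Fr Fl [e [K [e0 K0 hK]]] FR].
have cst (c : R[i]) a b : holomorphic_on (fun _ _ => c) a b by eexists; exact: holomorphic_cst.
split.
- by move=> C; apply: holomorphic_onM (Fr C).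
- by move=> C; apply: holomorphic_onM (Fl C).
- exists e, K; split=> // C phi t hs t0; rewrite ComplexField.Normc.normcM.
  have -> : normc (Complex ((-1) ^+ inversions C C) 0 : R[i]) = 1.
    by rewrite /= expr0n addr0 sqrr_sign sqrtr1.
  by rewrite mul1r; exact: hK.
- by move=> C t t0; have [f0 f1] := FR C t t0; rewrite /conj_coords !Im_real_mul f0 f1 mulr0.
Qed.

Lemma conj_coordsE F phi t :
  coords (fun C => Re (conj_coords F C phi t)) = cl_conj (coords (fun C => Re (F C phi t))) /\
  coords (fun C => Im (conj_coords F C phi t)) = cl_conj (coords (fun C => Im (F C phi t))).
Proof. by split; apply/ffunP => C; rewrite cl_conjE !ffunE ?Re_real_mul ?Im_real_mul. Qed.

Lemma sharp_right theta F f : left_coords theta F f -> right_coords theta (conj_coords F) (sharp f).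
Proof.
move=> hf K phi t SK hs t0; have SN := sphereN SK; have [-> ->] := conj_coordsE F phi t.
rewrite /sharp iota_conj// -iotaN hf// cl_conjD cl_conjM (sphere_conj SN) opprK.
by [].
Qed.

Lemma sharp_left theta F f : right_coords theta F f -> left_coords theta (conj_coords F) (sharp f).
Proof.
move=> hf K phi t SK hs t0; have SN := sphereN SK; have [-> ->] := conj_coordsE F phi t.
rewrite /sharp iota_conj// -iotaN hf// cl_conjD cl_conjM (sphere_conj SN) opprK.
by [].
Qed.

Lemma sharpK f : sharp (sharp f) = f.
Proof. by apply/funext => s; rewrite /sharp !cl_conjK. Qed.

Lemma growth_sharp theta alpha f : growth theta alpha f -> growth theta alpha (sharp f).
Proof.
move=> [k k0 hk]; exists k => // s [ps s0 hs]; rewrite /sharp cl_conj_norm -(cl_conj_norm s).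
apply: hk; split.
- by move=> A cA; rewrite cl_conjE ps// mulr0.
- by rewrite -normr_eq0 cl_conj_norm normr_eq0.
- move: hs; rewrite /cl_arg cl_conj_norm /cl_re cl_conjE inversions0l expr0 mul1r.
  by [].
Qed.

End Growth.

Section SliceCoordinates.
Variables (R : realType) (d : nat).
Local Notation Cl := (clifford R d).
Local Notation Re := complex.Re.
Local Notation Im := complex.Im.
Local Notation normc := ComplexField.Normc.normc.
Local Notation "'N" := (#|{set 'I_d}|%:R : R).
Implicit Types (z : R[i]) (t phi alpha : R) (C : {set 'I_d}) (J K : Cl) (m : nat).
Implicit Types (f g : Cl -> Cl) (F gc : {set 'I_d} -> R -> R -> R[i]).

Variable theta : R.
Hypothesis th : 0 < theta < pi / 2.

Lemma polar_in_sector K phi t : sphere K -> two_sectors theta phi -> 0 < t ->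
  D_ d theta (iota_slice K (polar phi t)) /\ slice_domain (D_ d theta) (polar_pair phi t).
Proof.
move=> SK hs t0.
have h : slice_domain (D_ d theta) (polar_pair phi t).
  by apply: plane_sector_slice => //; apply/plane_sector_polar => //; exact: cos_two_sectors.
by split=> //; exact: h SK.
Qed.

Lemma slice_coords_regular (f0 f1 : R * R -> Cl) : slice_pair (slice_domain (D_ d theta)) f0 f1 ->
  (exists J : Cl, sphere J) ->
  [/\ forall C, holomorphic_on (slice_coord f0 f1 C) (- theta) theta,
      forall C, holomorphic_on (slice_coord f0 f1 C) (pi - theta) (pi + theta) &
      forall C t, 0 < t -> Im (slice_coord f0 f1 C 0 t) = 0 /\ Im (slice_coord f0 f1 C pi t) = 0].
Proof.
move=> sp [J SJ]; have sub := @plane_sector_slice R d theta th; split.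
- move=> C; eexists; apply: (slice_pair_holomorphic _ sp sub) => phi hphi.
  by apply: cos_two_sectors => //; exact: two_sectors_right.
- move=> C; eexists; apply: (slice_pair_holomorphic _ sp sub) => phi hphi.
  by apply: cos_two_sectors => //; exact: two_sectors_left.
move=> C t t0; have [_ _ hodd] := sp; case/andP: (th) => th0 th2.
have odd0 (x : R) : slice_domain (D_ d theta) (x, 0) -> f1 (x, 0) C = 0.
  move=> hx; have [_ h1 _ _] := hodd x 0 hx; rewrite oppr0 in h1.
  have /ffunP/(_ C) := h1; rewrite ffunE => e.
  have : f1 (x, 0) C + f1 (x, 0) C = 0 by rewrite {1}e addNr.
  by move/eqP; rewrite -mulr2n mulrn_eq0 => /eqP.
have s0 : two_sectors theta 0 by apply: two_sectors_right; apply/andP; split; lra.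
have spi : two_sectors theta pi by apply: two_sectors_left; apply/andP; split; lra.
have [_ h0] := polar_in_sector SJ s0 t0; have [_ hpi] := polar_in_sector SJ spi t0.
move: h0 hpi; rewrite /slice_coord /= /polar_pair sin0 sinpi mulr0 => h0 hpi.
by rewrite (odd0 _ h0) (odd0 _ hpi).
Qed.

Lemma cl_norm_mul (x y : Cl) : `|x * y| <= 'N * `|x| * `|y|.
Proof. by rewrite -lactE; exact: lact_norm. Qed.

(** The coordinates of [f] are recovered from its values at a point and at the
    conjugate point. *)
Lemma coords_growth f F alpha k J : sphere J -> 0 <= k ->
  left_coords theta F f \/ right_coords theta F f ->
  (forall s, D_ d theta s -> `|f s| <= k * (`|s| `^ alpha + `|s| `^ (- alpha))) ->
  forall C phi t, two_sectors theta phi -> 0 < t ->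
    normc (F C phi t) <= (1 + 'N) * k * (t `^ alpha + t `^ (- alpha)).
Proof.
move=> SJ k0 hf hk C phi t hs t0; have SN := sphereN SJ.
pose G0 := coords (fun C => Re (F C phi t)); pose G1 := coords (fun C => Im (F C phi t)).
pose a := f (iota_slice J (polar phi t)); pose b := f (iota_slice (- J) (polar phi t)).
set q := t `^ alpha + t `^ (- alpha).
have bd K : sphere K -> `|f (iota_slice K (polar phi t))| <= k * q.
  move=> SK; have := hk _ (polar_in_sector SK hs t0).1; rewrite norm_iota// normc_polar//.
have ha : `|a| <= k * q := bd J SJ; have hb : `|b| <= k * q := bd _ SN.
have kq0 : 0 <= k * q by exact: le_trans (normr_ge0 _) ha.
have e0 : G0 = 2^-1 *: (a + b).
  rewrite /a /b; case: hf => hf; rewrite !hf// -/G0 -/G1 ?mulNr ?mulrN addrACA subrr addr0;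
  by rewrite -mulr2n -[G0 *+ 2]scaler_nat scalerA mulVf ?scale1r// pnatr_eq0.
have nJ : `|J| = 1 by case: SJ.
have h1 : `|G1| <= 'N * (k * q).
  have two : `|a - b| <= 2 * (k * q).
    by apply: le_trans (ler_normB _ _) _; rewrite mulr_natl mulr2n; exact: lerD.
  have fin (x : Cl) : `|x| <= 'N * `|a - b| -> G1 = - 2^-1 *: x -> `|G1| <= 'N * (k * q).
    move=> hx ->; rewrite normrZ normrN ger0_norm ?invr_ge0//.
    have N0 : 0 <= 'N by []; have h2 := ler_wpM2l N0 two.
    by have := le_trans hx h2; rewrite mulrCA; lra.
  case: hf => hf.
    apply: (fin (J * (a - b))); first by apply: le_trans (cl_norm_mul _ _) _; rewrite nJ mulr1.
    rewrite /a /b !hf// -/G0 -/G1 mulNr opprD opprK addrACA subrr add0r -mulr2n.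
    rewrite mulrnAr mulrA (sphere_sqr SJ) mulN1r mulNrn scalerN scaleNr opprK.
    by rewrite -[G1 *+ 2]scaler_nat scalerA mulVf ?scale1r// pnatr_eq0.
  apply: (fin ((a - b) * J)).
    by apply: le_trans (cl_norm_mul _ _) _; rewrite nJ mulr1.
  rewrite /a /b !hf// -/G0 -/G1 mulrN opprD opprK addrACA subrr add0r -mulr2n.
  rewrite mulrnAl -mulrA (sphere_sqr SJ) mulrN1 mulNrn scalerN scaleNr opprK.
  by rewrite -[G1 *+ 2]scaler_nat scalerA mulVf ?scale1r// pnatr_eq0.
have h0 : `|G0| <= k * q.
  rewrite e0 normrZ ger0_norm ?invr_ge0//; have := ler_normD a b; lra.
apply: le_trans (normc_le _) _.
have -> : Re (F C phi t) = G0 C by rewrite ffunE.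
have -> : Im (F C phi t) = G1 C by rewrite ffunE.
apply: le_trans (lerD (cl_coord_norm G0 C) (cl_coord_norm G1 C)) _.
by rewrite -mulrA mulrDl mul1r; exact: lerD.
Qed.

Lemma SHL_coords f J : sphere J -> SHL (D_ d theta) f -> exists F, left_coords theta F f /\
  forall alpha m, 0 <= alpha -> growth theta alpha f -> alpha < m%:R ->
    sector_function theta (iter m (@reg_mul R d) F).
Proof.
move=> SJ [f0 [f1 [sp hf]]]; exists (slice_coord f0 f1).
have hc : left_coords theta (slice_coord f0 f1) f.
  move=> K phi t SK hs t0; rewrite -slice_polar hf//; last exact: (polar_in_sector SK hs t0).2.
  by congr (_ + _ * _); apply/ffunP => C; rewrite ffunE.
split=> // alpha m al0 [k k0 hk] alm.
have [Fr Fl FR] := slice_coords_regular sp (ex_intro _ J SJ).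
apply: (regularized_sector th al0 alm (k := (1 + 'N) * k)) => //.
  by rewrite mulr_ge0// addr_ge0.
exact: (coords_growth SJ k0 (or_introl hc) hk).
Qed.

Lemma SHR_coords f J : sphere J -> SHR (D_ d theta) f -> exists F, right_coords theta F f /\
  forall alpha m, 0 <= alpha -> growth theta alpha f -> alpha < m%:R ->
    sector_function theta (iter m (@reg_mul R d) F).
Proof.
move=> SJ [f0 [f1 [sp hf]]]; exists (slice_coord f0 f1).
have hc : right_coords theta (slice_coord f0 f1) f.
  move=> K phi t SK hs t0; rewrite -slice_polar hf//; last exact: (polar_in_sector SK hs t0).2.
  by congr (_ + _ * _); apply/ffunP => C; rewrite ffunE.
split=> // alpha m al0 [k k0 hk] alm.
have [Fr Fl FR] := slice_coords_regular sp (ex_intro _ J SJ).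
apply: (regularized_sector th al0 alm (k := (1 + 'N) * k)) => //.
  by rewrite mulr_ge0// addr_ge0.
exact: (coords_growth SJ k0 (or_intror hc) hk).
Qed.

End SliceCoordinates.

(** * Duality *)

Section Duality.
Variables (R : realType) (d : nat) (W : hilbertType R).
Local Notation V := (cliffmod d W).
Local Notation Cl := (clifford R d).
Implicit Types (u v w : V) (J : Cl) (phi : R) (m : nat) (f g : Cl -> Cl).
Implicit Types (T : set (V * V)) (A B : R[i] -> V -> V) (F : {set 'I_d} -> R -> R -> R[i]).

Let HV := module_hilbert d W.

Lemma HinfLE J phi m T f : HinfL J phi m T f =
  [set p | omegaL J phi T (regularizer m) p.2 =
           omegaL J phi T (fun s => regularizer m s * f s) p.1].
Proof.
apply/seteqP; split=> p; rewrite /HinfL /rel_comp /rel_inv /opgraph /mkset /=.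
  by move=> [u -> ->].
by move=> e; eexists; last exact: esym e.
Qed.

Lemma HinfRE J phi m T f : HinfR J phi m T f =
  closure [set p | exists u, p.1 = omegaR J phi T (regularizer m) u /\
                             p.2 = omegaR J phi T (fun s => f s * regularizer m s) u].
Proof.
congr closure; apply/seteqP; split=> p; rewrite /rel_comp /rel_inv /opgraph /mkset /=.
  by move=> [u e1 e2]; exists u.
by move=> [u [e1 e2]]; exists u.
Qed.

Lemma adjoint_range (P Q : V -> V) : bounded_linear P -> bounded_linear Q ->
  right_homogeneous P -> right_homogeneous Q ->
  adjoint (closure [set p | exists u, p.1 = P u /\ p.2 = Q u]) = [set p | adj P p.2 = adj Q p.1].
Proof.
move=> bP bQ rP rQ; have [lP _] := bP; have [lQ _] := bQ.
rewrite adjoint_closure; last first.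
  split=> /=.
  - by exists 0; rewrite !real_linear0.
  - move=> p q [u [e1 e2]] [v [e3 e4]]; exists (u + v).
    by rewrite /= e1 e2 e3 e4 !real_linearD.
  - by move=> p s [u [e1 e2]]; exists (ract u s); rewrite e1 e2 rP rQ.
apply/seteqP; split=> p /= h; last by move=> q [u [-> ->]]; rewrite -!adjE// h.
apply: (ip_ext HV) => u; rewrite !adjEr// (ipC HV) (ipC HV (Q u)).
by apply: (h (P u, Q u)); exists u.
Qed.

Lemma adjK (P : V -> V) : bounded_linear P -> adj (adj P) = P.
Proof.
move=> bP; apply: adj_uniq => [|u v]; first exact: adj_bounded_linear.
by rewrite adjEr.
Qed.

Lemma adjoint_kernel_adj (P Q : V -> V) : bounded_linear P -> bounded_linear Q ->
  right_homogeneous P -> right_homogeneous Q ->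
  adjoint [set p | adj P p.2 = adj Q p.1] = closure [set p | exists u, p.1 = P u /\ p.2 = Q u].
Proof.
move=> bP bQ rP rQ; rewrite adjoint_kernel; try exact: adj_bounded_linear; try exact: adj_right.
by rewrite (adjK bP) (adjK bQ).
Qed.

Lemma quadratic_family_adjK omega T A B : 0 < omega < pi / 2 -> resolvent_family omega A B ->
  quadratic_family omega T A B ->
  quadratic_family omega T (fun z => adj (adj (A z))) (fun z => adj (adj (B z))).
Proof.
move=> om rf qf z oz; have [bA bB] := rf_bounded_linear om rf oz.
have [q [n [m [qr hA hB bnd]]]] := qf z oz; exists q, n, m; split=> //.
  by rewrite adjK.
by rewrite adjK.
Qed.

Section LeftRight.
Variables (T : set (V * V)) (omega theta : R) (A B : R[i] -> V -> V).
Hypothesis omega2 : 0 < omega < pi / 2.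
Hypothesis rf : resolvent_family omega A B.
Hypothesis qf : quadratic_family omega T A B.
Hypothesis sT : single_valued T.
Hypothesis omth : omega < theta.
Hypothesis th2 : theta < pi / 2.

Let th : 0 < theta < pi / 2.
Proof. by case/andP: omega2 => ? _; have ? := th2; have ? := omth; apply/andP; split; lra. Qed.

(** The pair of left values that determines the calculus, for [1] and for [f]. *)
Lemma left_calculus J phi m F f : (0 < m)%N -> sphere J -> omega < phi < theta ->
  left_coords theta F f -> sector_function theta (iter m (@reg_mul R d) F) ->
  let Lo := omegaL J phi T (regularizer m) in
  let Lf := omegaL J phi T (fun s => regularizer m s * f s) in
  [/\ bounded_linear Lo /\ bounded_linear Lf, right_homogeneous Lo /\ right_homogeneous Lf,
    is_left_value A B (iter m (@reg_mul R d) (@one_coords R d)) phi Lo &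
    is_left_value A B (iter m (@reg_mul R d) F) phi Lf].
Proof.
move=> m0 SJ hphi hf sF.
have s1 := @one_sector R d theta m th m0.
have h1 := regularized_left m (@one_left_coords R d theta).
have e1 : (fun s => regularizer m s * 1) = regularizer m :> (Cl -> Cl).
  by apply/funext => s; rewrite mulr1.
rewrite e1 in h1.
have [bo ro vo] := omegaL_value omega2 rf qf sT omth th2 s1 h1 SJ hphi.
have [bf rF vf] := omegaL_value omega2 rf qf sT omth th2 sF (regularized_left m hf) SJ hphi.
by split.
Qed.

Lemma right_calculus J phi m F f : (0 < m)%N -> sphere J -> omega < phi < theta ->
  right_coords theta F f -> sector_function theta (iter m (@reg_mul R d) F) ->
  let Ro := omegaR J phi T (regularizer m) in
  let Rf := omegaR J phi T (fun s => f s * regularizer m s) in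
  let A' := fun z => adj (A z) in let B' := fun z => adj (B z) in
  [/\ bounded_linear Ro /\ bounded_linear Rf, right_homogeneous Ro /\ right_homogeneous Rf,
    is_left_value A' B' (iter m (@reg_mul R d) (@one_coords R d)) phi (adj Ro) &
    is_left_value A' B' (iter m (@reg_mul R d) (conj_coords F)) phi (adj Rf)].
Proof.
move=> m0 SJ hphi hf sF.
have s1 := @one_sector R d theta m th m0.
have h1 := regularized_right m (@one_right_coords R d theta).
have e1 : (fun s => 1 * regularizer m s) = regularizer m :> (Cl -> Cl).
  by apply/funext => s; rewrite mul1r.
rewrite e1 in h1.
have [bo ro vo] := omegaR_value omega2 rf qf sT omth th2 s1 h1 SJ hphi.
have [bf rF vf] := omegaR_value omega2 rf qf sT omth th2 sF (regularized_right m hf) SJ hphi.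
rewrite conj_coords_iter conj_one_coords in vo; rewrite conj_coords_iter in vf.
by split.
Qed.

End LeftRight.

End Duality.

Theorem theorem4p15 (R : realType) (d : nat) (VR : hilbertType R)
    (T : set (cliffmod d VR * cliffmod d VR)) (omega theta : R)
    (f : clifford R d -> clifford R d) :
  (0 < d)%N ->
  bisectorial omega T ->
  injective_rel T ->
  omega < theta < pi / 2 ->
  (SHLpoly theta f ->
     forall J phi m J' phi' m',
       admissible omega theta f J phi m ->
       admissible omega theta (sharp f) J' phi' m' ->
       HinfL J phi m (adjoint T) f = adjoint (HinfR J' phi' m' T (sharp f))) /\
  (SHRpoly theta f ->
     forall J phi m J' phi' m',
       admissible omega theta f J phi m ->
       admissible omega theta (sharp f) J' phi' m' ->
       HinfR J phi m (adjoint T) f = adjoint (HinfL J' phi' m' T (sharp f))).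
Proof.
move=> _ bT iT /andP[omth th2]; have [cT om _ _] := bT; have [rT sT _] := cT.
have th : 0 < theta < pi / 2 by case/andP: om => ? _; apply/andP; split; lra.
have pos (m : nat) (alpha : R) : 0 <= alpha -> alpha < m%:R -> (0 < m)%N.
  by move=> a0 am; rewrite -(ltr0n R) (le_lt_trans a0).
have unsharp alpha : growth theta alpha (sharp f) -> growth theta alpha f.
  by move=> /growth_sharp; rewrite sharpK.
split=> [[fL _]|[fR _]] J phi m J' phi' m' [SJ hphi [al [al0 gf alm]]]
    [SJ' hphi' [be [be0 gs bem]]].
  have m0 := pos _ _ al0 alm; have m0' := pos _ _ be0 bem.
  have [A [B [rf qf]]] := bisectorial_family bT SJ.
  have [F [hF sF]] := SHL_coords th SJ fL.
  have s1 := sF _ _ al0 gf alm; have s2 := sF _ _ be0 (unsharp _ gs) bem.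
  have sTa := adjoint_single_valued om rf qf rT sT iT.
  have [_ _ vo vf] := left_calculus om (rf_adjoint om rf) (quadratic_family_adjoint rT sT qf)
    sTa omth th2 m0 SJ hphi hF s1.
  have sc : sector_function theta (iter m' (@reg_mul R d) (conj_coords F)).
    by rewrite -conj_coords_iter; exact: conj_sector.
  have [[bo bf] [ro rF] vo' vf'] :=
    right_calculus om rf qf sT omth th2 m0' SJ' hphi' (sharp_right hF) sc.
  rewrite conj_coordsK in vf'.
  rewrite HinfLE HinfRE adjoint_range//; apply/funext => p; apply/propext.
  have inj := adjoint_reg_operator_inj om rf qf rT sT iT.
  exact: (regularizer_independence om (rf_adjoint om rf) p.2 p.1 omth th2 inj hphi hphi'
    (one_sector d th m0) (one_sector d th m0') s1 s2 vo vf vo' vf').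
have m0 := pos _ _ al0 alm; have m0' := pos _ _ be0 bem.
have [A [B [rf qf]]] := bisectorial_family bT SJ.
have [F [hF sF]] := SHR_coords th SJ fR.
have s1 := sF _ _ al0 gf alm; have s2 := sF _ _ be0 (unsharp _ gs) bem.
have sTa := adjoint_single_valued om rf qf rT sT iT.
have [[bo bf] [ro rF] vo vf] := right_calculus om (rf_adjoint om rf)
  (quadratic_family_adjoint rT sT qf) sTa omth th2 m0 SJ hphi hF s1.
have rf2 := rf_adjoint om (rf_adjoint om rf); have qf2 := quadratic_family_adjK om rf qf.
have sc (k : nat) : sector_function theta (iter k (@reg_mul R d) F) ->
    sector_function theta (iter k (@reg_mul R d) (conj_coords F)).
  by rewrite -conj_coords_iter; exact: conj_sector.
have [_ _ vo' vf'] := left_calculus om rf2 qf2 sT omth th2 m0' SJ' hphi' (sharp_left hF) (sc _ s2).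
rewrite HinfLE HinfRE.
have -> : [set p | omegaL J' phi' T (regularizer m') p.2 =
                   omegaL J' phi' T (fun s => regularizer m' s * sharp f s) p.1] =
    [set p | adj (omegaR J phi (adjoint T) (regularizer m)) p.2 =
             adj (omegaR J phi (adjoint T) (fun s => f s * regularizer m s)) p.1].
  apply/funext => p; apply/propext.
  have inj := reg_operator_inj om rf2 qf2 rT sT iT.
  exact: (regularizer_independence om rf2 p.2 p.1 omth th2 inj hphi' hphi
    (one_sector d th m0') (one_sector d th m0) (sc _ s2) (sc _ s1) vo' vf' vo vf).
exact/esym/(adjoint_kernel_adj bo bf ro rF).
Qed.
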